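(* Let $d\ge2$, $\gamma>0$ and $\beta>\frac d2+1$, and let $Z'$ be the polytope part of the typical cell of the $\beta'$-Voronoi tessellation in $\mathbb R^d$. Then there exists a constant $c>0$ such that for all integers $n\ge d+1$, $$\mathbb P(Z'\in\mathcal P_n)>c^n,$$ where $\mathcal P_n$ is the set of polytopes in $\mathbb R^d$ with exactly $n$ facets.
   Context: Let $\mu'_\beta(\mathrm dv,\mathrm dh)=\gamma c'_{d+1,\beta}(-h)^{-\beta}\mathbb 1\{h<0\}\,\mathrm dv\,\mathrm dh$ on $\mathbb R^d\times\mathbb R$, $c'_{d+1,\beta}=\frac{\Gamma(\beta)}{\pi^{(d+1)/2}\Gamma(\beta-\frac{d+1}2)}$, and let $\eta'_\beta$ be a Poisson point process with intensity measure $\mu'_\beta$. For $X\subset\mathbb R^d\times\mathbb R$ and $(v,h)\in X$ the Laguerre cell is $\mathscr C_X(v,h)=\{w\in\mathbb R^d:\|w-v\|^2+h\le\|w-v'\|^2+h'\ \forall(v',h')\in X\}$ (possibly empty). The $\beta'$-Voronoi tessellation consists of the nonempty cells $\mathscr C_{\eta'_\beta}(v,h)$, $(v,h)\in\eta'_\beta$. Let $\mathbb K$ be the space of nonempty compact convex subsets of $\mathbb R^d$ with the Hausdorff metric and $\widehat{\mathbb K}_{\mathbf o}=(\{\mathbf o\}\times\mathbb R)\times\mathbb K$, with $\mathbf o$ the origin. The typical cell $\widehat Z'=((\mathbf o,h_{Z'}),Z')$ is a random element of $\widehat{\mathbb K}_{\mathbf o}$ with distribution $$\mathbb P(\widehat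 Z'\in D)=\frac1{\Lambda'_\beta}\mathbb E\big|\{x=(v,h)\in\eta'_\beta:\ v\in[0,1]^d,\ (x,\mathscr C_{\eta'_\beta}(x))\in D+v\}\big|$$ for Borel $D\subset\widehat{\mathbb K}_{\mathbf o}$, where $((\mathbf o,h),K)+v=((v,h),K+v)$ and $\Lambda'_\beta\in(0,\infty)$ is the expected number of $(v,h)\in\eta'_\beta$ with $v\in[0,1]^d$ and $\mathscr C_{\eta'_\beta}(v,h)\neq\emptyset$ (equivalently the expected number of vertices in $[0,1]^d$ of the dual $\beta'$-Delaunay triangulation). Almost surely $Z'$ is a polytope. *)

(* Defs.v *)
From HB Require Import structures.
From mathcomp Require Import all_boot all_order all_algebra.
From mathcomp Require Import all_classical all_reals all_analysis.
From mathcomp Require Import measurable_realfun ring.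

Set Implicit Arguments.
Unset Strict Implicit.
Unset Printing Implicit Defensive.

Import Order.TTheory GRing.Theory Num.Theory.
Import numFieldNormedType.Exports.

Local Open Scope classical_set_scope.
Local Open Scope ring_scope.

(* The library norm on matrices is the sup norm, hence the following. *)
Section Euclidean.
Context {R : realType} {d : nat}.
Implicit Types (u v w : 'rV[R]_d).

Definition dotp u v : R := \sum_i u 0 i * v 0 i.

Definition enorm u : R := Num.sqrt (dotp u u).

Lemma dotpC u v : dotp u v = dotp v u.
Proof. by apply: eq_bigr => i _; rewrite mulrC. Qed.

Lemma dotpDl u v w : dotp (u + v) w = dotp u w + dotp v w.
Proof. by rewrite -big_split; apply: eq_bigr => i _; rewrite mxE mulrDl. Qed.

Lemma dotpZl a u w : dotp (a *: u) w = a * dotp u w.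
Proof. by rewrite mulr_sumr; apply: eq_bigr => i _; rewrite mxE mulrA. Qed.

Lemma dotp_ge0 u : 0 <= dotp u u.
Proof. by apply: sumr_ge0 => i _; rewrite -expr2 sqr_ge0. Qed.

Lemma enorm_ge0 u : 0 <= enorm u.
Proof. exact: sqrtr_ge0. Qed.

Lemma enorm_sqr u : enorm u ^+ 2 = dotp u u.
Proof. by rewrite sqr_sqrtr// dotp_ge0. Qed.

Lemma enormN u : enorm (- u) = enorm u.
Proof.
by congr Num.sqrt; apply: eq_bigr => i _; rewrite mxE mulrNN.
Qed.

Lemma enorm0 : enorm 0 = 0.
Proof. by rewrite /enorm /dotp big1 ?sqrtr0// => i _; rewrite mxE mul0r. Qed.

Lemma enorm_coord u i : `|u 0 i| <= enorm u.
Proof.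
rewrite -[leLHS]sqrtr_sqr ler_sqrt ?dotp_ge0// /dotp (bigD1 i)//= -expr2 lerDl.
by apply: sumr_ge0 => j _; rewrite -expr2 sqr_ge0.
Qed.

Lemma dotp_CS u v : dotp u v ^+ 2 <= dotp u u * dotp v v.
Proof.
have [v0|vN0] := eqVneq (dotp v v) 0.
  have {}v0 i : v 0 i = 0.
    apply/eqP; rewrite -normr_le0 (le_trans (enorm_coord v i))//.
    by rewrite /enorm v0 sqrtr0.
  have -> : dotp u v = 0 by rewrite /dotp big1// => i _; rewrite v0 mulr0.
  by rewrite expr0n mulr_ge0// dotp_ge0.
have vp : 0 < dotp v v by rewrite lt_neqAle eq_sym vN0 dotp_ge0.
have := dotp_ge0 (dotp v v *: u + (- dotp u v) *: v).
rewrite dotpDl !dotpZl ![dotp _ (_ + _)]dotpC !dotpDl !dotpZl (dotpC v u).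
set U := dotp u u; set V := dotp v v; set D := dotp u v.
rewrite (_ : _ + _ = V * (U * V - D ^+ 2)); last by rewrite /U /V /D; ring.
by rewrite pmulr_rge0// subr_ge0.
Qed.

Lemma enormD u v : enorm (u + v) <= enorm u + enorm v.
Proof.
rewrite -ler_sqr ?nnegrE ?addr_ge0 ?enorm_ge0//.
rewrite sqrrD !enorm_sqr dotpDl (dotpC u) (dotpC v) !dotpDl (dotpC v u).
rewrite (_ : _ + _ = dotp u u + dotp u v *+ 2 + dotp v v); last first.
  by rewrite mulr2n !addrA.
rewrite lerD2r lerD2l lerMn2r/= (le_trans (ler_norm _))//.
rewrite -ler_sqr ?nnegrE ?mulr_ge0 ?enorm_ge0//.
by rewrite real_normK ?num_real// exprMn !enorm_sqr dotp_CS.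
Qed.

End Euclidean.

Record convex_body (R : realType) (d : nat) := ConvexBody {
  body :> set 'rV[R]_d ;
  bodyP : [/\ body !=set0, compact body & convex_set body] }.

HB.instance Definition _ (R : realType) (d : nat) :=
  gen_eqMixin (convex_body R d).
HB.instance Definition _ (R : realType) (d : nat) :=
  gen_choiceMixin (convex_body R d).

Section HausdorffDistance.
Context {R : realType} {d : nat}.
Implicit Types (A B : set 'rV[R]_d) (K L M : convex_body R d).

(* A + eB, with B the closed Euclidean unit ball *)
Definition parallel_set A (e : R) : set 'rV[R]_d :=
  [set y | exists2 x, A x & enorm (y - x) <= e].

Definition hausdorff_gaps A B : set R :=
  [set e | [/\ 0 <= e, A `<=` parallel_set B e & B `<=` parallel_set A e]].

Definition hausdorff_dist A B : R := inf (hausdorff_gaps A B).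

Lemma hausdorff_gaps_lb A B : has_lbound (hausdorff_gaps A B).
Proof. by exists 0 => e []. Qed.

Lemma convex_body_bounded K : exists M : R, forall x, body K x -> enorm x <= M.
Proof.
have [_ /compact_bounded [M [Mreal KM]] _] := bodyP K.
exists (Num.sqrt (\sum_(i < d) (M + 1) ^+ 2)) => x Kx.
have M1 : M < M + 1 by rewrite ltrDl.
rewrite ler_sqrt; last by apply: sumr_ge0 => i _; exact: sqr_ge0.
apply: ler_sum => i _; rewrite -expr2 -real_normK ?num_real//.
have xi : `|x 0 i| <= M + 1.
  apply: le_trans (KM _ M1 _ Kx).
  rewrite /Num.norm/= mx_normrE; apply/bigmax_geP; right => /=.
  by exists (0, i).
by rewrite ler_sqr ?nnegrE// (le_trans _ xi).
Qed.

Lemma hausdorff_gaps_neq0 K L : hausdorff_gaps K L !=set0.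
Proof.
have [M KM] := convex_body_bounded K; have [N LN] := convex_body_bounded L.
have [[x Kx] _ _] := bodyP K; have [[y Ly] _ _] := bodyP L.
exists (M + N); split.
- by rewrite addr_ge0// ?(le_trans (enorm_ge0 _) (KM _ Kx))// (le_trans (enorm_ge0 _) (LN _ Ly)).
- move=> z Kz; exists y => //; apply: le_trans (enormD _ _) _.
  by rewrite enormN lerD// ?KM ?LN.
- move=> z Lz; exists x => //; apply: le_trans (enormD _ _) _.
  by rewrite enormN addrC lerD// ?KM ?LN.
Qed.

Lemma hausdorff_distxx K : hausdorff_dist K K = 0.
Proof.
apply/eqP; rewrite eq_le; apply/andP; split; last first.
  by apply: lb_le_inf => [|e []//]; exact: hausdorff_gaps_neq0.
apply: ge_inf; first exact: hausdorff_gaps_lb.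
by split=> // x Kx; exists x => //; rewrite subrr enorm0.
Qed.

Lemma hausdorff_dist_sym K L : hausdorff_dist K L = hausdorff_dist L K.
Proof. by congr inf; apply/seteqP; split=> e [? ? ?]; split. Qed.

Lemma parallel_setD A B C e f : A `<=` parallel_set B e ->
  B `<=` parallel_set C f -> A `<=` parallel_set C (e + f).
Proof.
move=> AB BC x /AB [y /BC [z Cz yz] xy]; exists z => //.
by rewrite -(subrKA y) (le_trans (enormD _ _))// lerD.
Qed.

Lemma hausdorff_dist_triangle L K M :
  hausdorff_dist K M <= hausdorff_dist K L + hausdorff_dist L M.
Proof.
apply/ler_addgt0Pl => e e0.
have e20 : 0 < e / 2 by rewrite divr_gt0.
have hi (X Y : convex_body R d) : has_inf (hausdorff_gaps X Y).
  by split; [exact: hausdorff_gaps_neq0|exact: hausdorff_gaps_lb].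
have [a [a0 KL LK] aKL] := inf_adherent e20 (hi K L).
have [b [b0 LM ML] bLM] := inf_adherent e20 (hi L M).
apply: (@le_trans _ _ (a + b)).
  apply: ge_inf; first exact: hausdorff_gaps_lb.
  split; [exact: addr_ge0|exact: parallel_setD KL LM|].
  by rewrite addrC; exact: parallel_setD ML LK.
rewrite [e]splitr [leRHS]addrC addrACA; apply: ltW; exact: ltrD.
Qed.

Lemma hausdorff_dist0_sub K L : hausdorff_dist K L = 0 -> body K `<=` body L.
Proof.
move=> KL0 x Kx.
have [_ cL _] := bodyP L.
have : closed (body L).
  by apply: compact_closed cL; exact: norm_hausdorff.
apply; move=> U /nbhs_ballP [e /= e0 eU].
have hi : has_inf (hausdorff_gaps K L).
  by split; [exact: hausdorff_gaps_neq0|exact: hausdorff_gaps_lb].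
have [a [a0 /(_ _ Kx)[y Ly xy] _]] := inf_adherent e0 hi.
rewrite -/(hausdorff_dist K L) KL0 add0r => ae.
exists y; split => //; apply: eU; split => // i j.
rewrite (ord1 i) /ball/=; apply: le_lt_trans ae; apply: le_trans xy.
by rewrite (le_trans _ (enorm_coord _ j))// !mxE.
Qed.

Lemma hausdorff_dist_positivity K L : hausdorff_dist K L = 0 -> K = L.
Proof.
move=> KL0.
have : body K = body L.
  apply/seteqP; split; first exact: hausdorff_dist0_sub.
  by apply: hausdorff_dist0_sub; rewrite hausdorff_dist_sym.
case: K L {KL0} => [A AP] [B BP] /= AB.
by case: _ / AB BP => BP; congr ConvexBody; exact: Prop_irrelevance.
Qed.

HB.instance Definition _ := isMetric.Build R (convex_body R d)
  hausdorff_distxx hausdorff_dist_positivity hausdorff_dist_sym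
  hausdorff_dist_triangle.

End HausdorffDistance.

Section Polytopes.
Context {R : realType} {d : nat}.
Implicit Types (A P F : set 'rV[R]_d).

Definition convex_hull A : set 'rV[R]_d :=
  smallest (@convex_set R 'rV[R]_d) A.

Definition polytope P : Prop :=
  exists A, [/\ finite_set A, A !=set0 & P = convex_hull A].

(* The affine hull of A has dimension k; U is its direction space. *)
Definition has_dim A (k : nat) : Prop :=
  A !=set0 /\ exists U : {vspace 'rV[R]_d},
    [/\ \dim U = k,
        (forall x y, A x -> A y -> x - y \in U) &
        (forall V : {vspace 'rV[R]_d},
          (forall x y, A x -> A y -> x - y \in V) -> (U <= V)%VS)].

(* F is the intersection of P with a supporting hyperplane. *)
Definition face P F : Prop :=
  exists (u : 'rV[R]_d) (a : R), [/\ u != 0,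
    (forall x, P x -> dotp u x <= a) & F = P `&` [set x | dotp u x = a]].

Definition facet P F : Prop :=
  face P F /\ exists k : nat, has_dim P k.+1 /\ has_dim F k.

Definition polytopes_with_facets (n : nat) : set (set 'rV[R]_d) :=
  [set P | polytope P /\ ([set F | facet P F] #= `I_n)%card].

End Polytopes.

Definition borel (T : topologicalType) : set (set T) := <<s @open T >>.

Section PoissonProcess.
Context {R : realType} {d : measure_display} {Omega : measurableType d}.
Context {E : topologicalType}.
Variables (P : probability Omega R) (mu : set E -> \bar R).

(* A simple point process, represented by its random set of points: numbers of
   points in Borel sets are Poisson variables, independent over disjoint sets.
   The probabilities are spelled out because [poisson_pmf 0] is not the Dirac
   mass at 0, which is the Poisson law of parameter 0. *)
Definition poisson_point_process (eta : Omega -> set E) : Prop :=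
  let N (B : set E) (omega : Omega) : \bar R :=
    counting (eta omega `&` B) in
  [/\ forall omega, countable (eta omega),
      forall B, borel B -> measurable_fun [set: Omega] (N B),
      forall B, borel B ->
        (mu B = +oo%E -> P [set omega | N B omega = +oo%E] = 1%E) /\
        (forall r : R, mu B = r%:E -> forall k : nat,
          P [set omega | N B omega = k%:R%:E] =
          (r ^+ k / k`!%:R * expR (- r))%:E) &
      forall (m : nat) (B : 'I_m -> set E) (A : 'I_m -> set (\bar R)),
        (forall i, borel (B i)) -> trivIset setT B ->
        (forall i, measurable (A i)) ->
        P (\bigcap_i (N (B i) @^-1` A i)) =
        (\prod_(i < m) P (N (B i) @^-1` A i))%E].

End PoissonProcess.

Section BetaPrime.
Context {R : realType}.

Definition Gamma (x : R) : R :=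
  \int[lebesgue_measure]_(t in `]0, +oo[) (t `^ (x - 1) * expR (- t)).

Definition c_beta' (d : nat) (beta : R) : R :=
  Gamma beta / (pi `^ (d.+1%:R / 2) * Gamma (beta - d.+1%:R / 2)).

(* Lebesgue integral over R^d of a nonnegative Borel function, computed
   coordinate by coordinate (Tonelli) *)
Fixpoint integral_rV (d : nat) : ('rV[R]_d -> \bar R) -> \bar R :=
  match d with
  | 0 => fun f => f 0
  | d'.+1 => fun f => (\int[lebesgue_measure]_(t in [set: R])
      integral_rV (fun v : 'rV[R]_d' => f (row_mx (t%:M : 'rV[R]_1) v)))%E
  end.

Definition mu_beta' (d : nat) (gamma beta : R) (B : set ('rV[R]_d * R)) :
    \bar R :=
  integral_rV (fun v : 'rV[R]_d =>
    (\int[lebesgue_measure]_(h in `]-oo, 0%R[)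
      (gamma * c_beta' d beta * (- h) `^ (- beta) * \1_B (v, h))%:E)%E).

End BetaPrime.

Section TypicalCell.
Context {R : realType} {d : nat}.
Local Notation point := ('rV[R]_d * R)%type.
Local Notation marked := (point * convex_body R d)%type.

Definition laguerre_cell (X : set point) (x : point) : set 'rV[R]_d :=
  [set w | forall y, X y ->
    enorm (w - x.1) ^+ 2 + x.2 <= enorm (w - y.1) ^+ 2 + y.2].

(* ({o} x R) x K, as a closed subset of (R^d x R) x K *)
Definition centred_space : set marked := [set y | y.1.1 = 0].

(* ((o, h), K) + v = ((v, h), K + v) *)
Definition translate (v : 'rV[R]_d) (y : marked) : point * set 'rV[R]_d :=
  ((v, y.1.2), [set w + v | w in body y.2]).

Definition unit_cube : set 'rV[R]_d := [set v | forall i, 0 <= v 0 i <= 1].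

Context {d1 d2 : measure_display}.
Context {Omega : measurableType d1} {Omega' : measurableType d2}.

Definition nonempty_cell_intensity (P : probability Omega R)
    (eta : Omega -> set point) : \bar R :=
  (\int[P]_omega counting
    [set x | [/\ eta omega x, unit_cube x.1 &
                 laguerre_cell (eta omega) x !=set0]])%E.

Definition typical_cell (P : probability Omega R) (eta : Omega -> set point)
    (P' : probability Omega' R) (Z : Omega' -> marked) : Prop :=
  [/\ forall omega', centred_space (Z omega'),
      forall D, borel D -> measurable (Z @^-1` D) &
      forall D, borel D -> D `<=` centred_space ->
        P' (Z @^-1` D) =
        ((nonempty_cell_intensity P eta)^-1 *
         \int[P]_omega counting
           [set x | [/\ eta omega x, unit_cube x.1 &
              (translate x.1 @` D) (x, laguerre_cell (eta omega) x)]])%E].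

End TypicalCell.

(* Main.v *)
Require Import Defs.
From HB Require Import structures.
From mathcomp Require Import finmap.
From mathcomp Require Import all_boot all_order all_algebra.
From mathcomp Require Import all_classical all_reals all_analysis.
From mathcomp Require Import measurable_realfun zify ring lra.

Set Implicit Arguments.
Unset Strict Implicit.
Unset Printing Implicit Defensive.

Import Order.TTheory GRing.Theory Num.Theory.
Import numFieldNormedType.Exports.

Local Open Scope classical_set_scope.
Local Open Scope ring_scope.

(** The typical cell is an average over the points of the process in the unit
    cube, so that the theorem follows once some point of the cube has, with
    probability at least [A * q ^+ m], a cell with exactly [m + d] facets, where
    [A] and [q] are positive and do not depend on [m].

    Bisectors.  Let the power of a site [(v, h)] at [w] be |w - v|^2 + h.  The
    difference of two powers is affine in [w], so a cell is cut out by
    half-spaces, one for each other site.  Put one site, the centre, at the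
    position -L e_z and at the height -L^2, for a large [L]; take [d] wall sites
    whose bisectors with the centre bound a simplicial cone with long horizontal
    sections, and [m] roof sites at i e_x, 0 <= i < m, at a common height -r^2.
    The roofs cut the cone by half-spaces of the form
    2 L z <= (x - i)^2 - x^2 - r^2, each of which is the most restrictive one
    near x = i; so the cell has [m] facets from the roofs and [d] from the walls.

    Stability.  The roof sites can move by a constant and the other sites by a
    constant over [L] without the loss or the gain of a facet
    ([facet_point], [cell_box], [shifted_cell_body]).  Every point of the cell
    stays within a constant distance of some i e_x, and the power of the centre
    is at most -1 there because of the roofs; hence only the sites below one of
    [m] fixed paraboloids could interfere ([cell_shielded]).

    Probability.  The region below these paraboloids has an intensity
    of order [m], whatever [L] is ([mu_below_paraboloids]); this uses
    beta > d/2 + 1.  It is therefore empty, apart from the prescribed sites, with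
    a probability geometric in [m].  The roofs contribute [m] constant factors,
    and the centre and the walls [d + 1] factors polynomial in 1/L; with [L] of
    order 8^m all is geometric ([good_configuration_probability]).

    Measurability.  The law of the typical cell may be evaluated only on Borel
    sets of convex bodies.  The number of facets of a polytope is the largest
    size of a family of its relative boundary points with relatively interior
    midpoints ([polytopes_with_facetsP]); the existence of such a family is a
    countable union of closed conditions for the Hausdorff metric
    ([spread_borel]), and the polytopes form a countable union of compact sets
    ([polytope_borel]). *)

(** * Inner products, convex hulls and their faces *)

Section Dotp.
Context {R : realType} {d : nat}.
Implicit Types u v w : 'rV[R]_d.

Lemma dotpDr w u v : dotp w (u + v) = dotp w u + dotp w v.
Proof. by rewrite dotpC dotpDl !(dotpC w). Qed.

Lemma dotpZr a w u : dotp w (a *: u) = a * dotp w u.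
Proof. by rewrite dotpC dotpZl dotpC. Qed.

Lemma dotpNl u v : dotp (- u) v = - dotp u v.
Proof. by rewrite -scaleN1r dotpZl mulN1r. Qed.

Lemma dotpNr u v : dotp u (- v) = - dotp u v.
Proof. by rewrite dotpC dotpNl dotpC. Qed.

Lemma dotpBl u v w : dotp (u - v) w = dotp u w - dotp v w.
Proof. by rewrite dotpDl dotpNl. Qed.

Lemma dotpBr u v w : dotp u (v - w) = dotp u v - dotp u w.
Proof. by rewrite dotpDr dotpNr. Qed.

Lemma dotp0r u : dotp u 0 = 0.
Proof. by rewrite -(scale0r 0) dotpZr mul0r. Qed.

Lemma dotp0l u : dotp 0 u = 0.
Proof. by rewrite dotpC dotp0r. Qed.

Lemma dotp_sumr (I : Type) (r : seq I) (P : pred I) (F : I -> 'rV[R]_d) u :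
  dotp u (\sum_(i <- r | P i) F i) = \sum_(i <- r | P i) dotp u (F i).
Proof.
apply: (big_morph (dotp u)) => [v w|]; [exact: dotpDr|exact: dotp0r].
Qed.

Definition dotpE := (dotpBl, dotpBr, @dotpDl R d, dotpDr, @dotpZl R d, dotpZr,
  dotpNl, dotpNr).

Lemma dotp_CS_norm u v : `|dotp u v| <= enorm u * enorm v.
Proof.
rewrite -ler_sqr ?nnegrE ?mulr_ge0 ?enorm_ge0//.
by rewrite real_normK ?num_real// exprMn !enorm_sqr dotp_CS.
Qed.

(** The weights in the definition of a convex set live in a type of numbers of the
    unit interval; real weights are more convenient. *)
Lemma convexP (A : set 'rV[R]_d) : convex_set A <->
  (forall x y t, 0 <= t <= 1 -> A x -> A y -> A (t *: x + (1 - t) *: y)).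
Proof.
split=> [cA x y t /andP[t0 t1] Ax Ay|cA x y t /set_mem Ax /set_mem Ay].
  have := cA x y (@Itv.mk _ _ _ t _) (mem_set Ax) (mem_set Ay).
  move=> H; apply/set_mem; apply: H.
  by rewrite /Itv.num_sem/= num_real/=; apply/andP; split; rewrite bnd_simp.
by apply/mem_set; apply: cA => //; apply/andP; split.
Qed.

Lemma convex_mid (A : set 'rV[R]_d) x y : convex_set A -> A x -> A y ->
  A (2^-1 *: (x + y)).
Proof.
move=> /convexP cA Ax Ay.
rewrite (_ : 2^-1 *: _ = 2^-1 *: x + (1 - 2^-1) *: y).
  by apply: cA => //; apply/andP; split; lra.
by rewrite scalerDr; congr (_ + _ *: _); field.
Qed.

Lemma mid_subl (x y : 'rV[R]_d) : 2^-1 *: (x + y) - x = y - 2^-1 *: (x + y).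
Proof. by apply/rowP => i; rewrite !mxE; field. Qed.

Lemma convex_shrink (A : set 'rV[R]_d) x v e f : convex_set A -> 0 < e ->
  0 <= f <= e -> A x -> A (x + e *: v) -> A (x + f *: v).
Proof.
move=> /convexP cA e0 /andP[f0 fe] Ax Av.
rewrite (_ : x + f *: v = (f / e) *: (x + e *: v) + (1 - f / e) *: x).
  apply: cA => //; apply/andP; split; first by rewrite divr_ge0// ltW.
  by rewrite ler_pdivrMr// mul1r.
rewrite [in RHS]scalerDr scalerA divfK ?gt_eqF// [in RHS]scalerBl scale1r.
by rewrite [RHS]addrAC [X in _ = X + _]addrC addrNK.
Qed.

(** A linear form separating a vector from a subspace is obtained from the
    projection along that subspace: a coordinate of the complementary projection
    that does not vanish at the vector. *)
Lemma orthogonal_separation (U : {vspace 'rV[R]_d}) g : g \notin U ->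
  exists w, (forall v, v \in U -> dotp w v = 0) /\ dotp w g != 0.
Proof.
move=> gU.
pose L v := v - projv U v.
have L0 : L g != 0.
  apply: contra gU => /eqP/subr0_eq ->; exact: memv_proj.
have [j Lj] : exists j, L g 0 j != 0.
  apply: contrapT => /forallNP H; move/negP: L0; apply.
  apply/eqP/rowP => j; rewrite [RHS]mxE; apply/eqP.
  by have /negP := H j; rewrite negbK.
pose w : 'rV[R]_d := \row_k (L (delta_mx 0 k)) 0 j.
have wE v : dotp w v = L v 0 j.
  rewrite {2}(row_sum_delta v) /L linear_sum -sumrB summxE.
  by apply: eq_bigr => k _; rewrite linearZ/= -scalerBr !mxE mulrC.
exists w; split; last by rewrite wE.
by move=> v vU; rewrite wE /L projv_id// subrr mxE.
Qed.

End Dotp.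

Section Hull.
Context {R : realType} {d : nat} {I : finType}.
Implicit Types (x : I -> 'rV[R]_d) (A : set 'rV[R]_d).

Definition hull x : set 'rV[R]_d := [set w | exists l : I -> R,
  [/\ forall i, 0 <= l i, \sum_i l i = 1 & w = \sum_i l i *: x i]].

Lemma hull_point x i : hull x (x i).
Proof.
exists (fun j => (j == i)%:R); split=> [j| |].
- by rewrite ler0n.
- rewrite (bigD1 i)//= eqxx big1 ?addr0// => j /negbTE ->//.
- rewrite (bigD1 i)//= eqxx scale1r big1 ?addr0// => j /negbTE -> //.
  by rewrite scale0r.
Qed.

Lemma hull_convex x : convex_set (hull x).
Proof.
apply/convexP => _ _ t /andP[t0 t1] [l [l0 l1 ->]] [l' [l'0 l'1 ->]].
exists (fun i => t * l i + (1 - t) * l' i); split=> [i||].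
- by rewrite addr_ge0// mulr_ge0// subr_ge0.
- by rewrite big_split/= -!mulr_sumr l1 l'1; ring.
- rewrite !scaler_sumr -big_split/=; apply: eq_bigr => i _.
  by rewrite [RHS]scalerDl !scalerA.
Qed.

(** Renormalised partial sums reduce a convex combination to binary ones. *)
Lemma hull_sub x A : convex_set A -> (forall i, A (x i)) -> hull x `<=` A.
Proof.
move=> /convexP cA Ax _ [l [l0 l1 ->]].
have H (r : seq I) : 0 < \sum_(i <- r) l i ->
    A ((\sum_(i <- r) l i)^-1 *: \sum_(i <- r) l i *: x i).
  elim: r => [|i r IH]; first by rewrite big_nil ltxx.
  rewrite !big_cons => s0.
  have r0 : 0 <= \sum_(j <- r) l j by apply: sumr_ge0.
  move: r0; rewrite le_eqVlt => /predU1P[r0|r0].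
    have E : \sum_(j <- r) l j *: x j = 0.
      rewrite big_seq big1// => j jr.
      suff -> : l j = 0 by rewrite scale0r.
      apply/eqP; rewrite eq_le l0 andbT r0 (big_rem j)//=.
      by rewrite lerDl sumr_ge0.
    rewrite -r0 addr0 in s0 *.
    by rewrite E addr0 scalerA mulVf ?scale1r// gt_eqF.
  set s := \sum_(j <- r) l j in s0 r0 IH *.
  set v := \sum_(j <- r) _ in IH *.
  rewrite (_ : _ *: (_ + _) = (l i / (l i + s)) *: x i +
      (1 - l i / (l i + s)) *: (s^-1 *: v)).
    apply: cA => //; last exact: IH.
    by apply/andP; split; [rewrite divr_ge0// ltW|rewrite ler_pdivrMr// mul1r lerDl ltW].
  rewrite scalerDr !scalerA mulrC; congr (_ *: _ + _ *: _).
  by field; rewrite !gt_eqF.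
have := H (index_enum I); rewrite l1 invr1 scale1r; exact.
Qed.

Lemma hullE x : convex_hull (range x) = hull x.
Proof.
apply/seteqP; split.
  apply: smallest_sub; first exact: hull_convex.
  by move=> _ [i _ <-]; exact: hull_point.
move=> w xw A [cA xA]; apply: hull_sub xw => // i; apply: xA.
by exists i.
Qed.

(** The numbers [l i * (a - dotp u (x i))] are nonnegative and add up to zero. *)
Lemma hull_face_weight x (u : 'rV[R]_d) a (l : I -> R) :
  (forall i, dotp u (x i) <= a) -> (forall i, 0 <= l i) -> \sum_i l i = 1 ->
  dotp u (\sum_i l i *: x i) = a -> forall i, dotp u (x i) != a -> l i = 0.
Proof.
move=> ua l0 l1 E i /eqP ni.
have S0 : \sum_i l i * (a - dotp u (x i)) = 0.
  transitivity (a * \sum_i l i - dotp u (\sum_i l i *: x i)); last first.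
    by rewrite E l1 mulr1 subrr.
  rewrite mulr_sumr dotp_sumr -sumrB.
  by apply: eq_bigr => j _; rewrite dotpZr mulrBr [l j * a]mulrC.
have /eqP := S0; rewrite psumr_eq0; last first.
  by move=> j _; rewrite mulr_ge0// subr_ge0.
move=> /allP/(_ i (mem_index_enum _))/=; rewrite mulf_eq0 => /orP[/eqP//|].
by rewrite subr_eq0 => /eqP e; case: ni.
Qed.

End Hull.

Section Polytope.
Context {R : realType} {d : nat}.
Implicit Types (P : set 'rV[R]_d).

Lemma polytopeP P : polytope P <->
  exists (n : nat) (x : 'I_n.+1 -> 'rV[R]_d), P = hull x.
Proof.
split=> [[A [/finite_seqP[s ->] [a as_] ->]]|[n [x ->]]].
  case: s as_ => [//|b s] as_.
  exists (size s), (fun i => nth b (b :: s) i); rewrite -hullE; congr convex_hull.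
  apply/seteqP; split=> [w /= ws|_ [i _ <-]/=]; last exact: mem_nth.
  have iw : (index w (b :: s) < (size s).+1)%N by rewrite -[(size s).+1]/(size (b :: s)) index_mem.
  by exists (Ordinal iw) => //=; rewrite -[RHS](nth_index b ws).
exists (range x); split.
- exact: finite_image.
- by exists (x ord0), ord0.
- by rewrite hullE.
Qed.

Lemma has_dim_unique P k k' : has_dim P k -> has_dim P k' -> k = k'.
Proof.
move=> [_ [U [<- U1 U2]]] [_ [V [<- V1 V2]]].
by apply/eqP; rewrite eqn_leq !dimvS// ?U2 ?V2.
Qed.

End Polytope.

Section FaceSpan.
Context {R : realType} {d : nat} {I : finType}.
Variable x : I -> 'rV[R]_d.

(** The direction space of a face, when [S] is the set of its generators and [p]
    lies in its affine hull. *)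
Definition dirspan (S : pred I) (p : 'rV[R]_d) : {vspace 'rV[R]_d} :=
  <<[seq x i - p | i <- enum S]>>%VS.

Lemma mem_dirspan (S : pred I) p i : S i -> x i - p \in dirspan S p.
Proof. by move=> Si; apply: memv_span; apply: map_f; rewrite mem_enum. Qed.

Lemma dirspan_sub (S : pred I) p (U : {vspace 'rV[R]_d}) :
  (forall i, S i -> x i - p \in U) -> (dirspan S p <= U)%VS.
Proof.
move=> H; apply/span_subvP => _ /mapP[i iS ->]; apply: H.
by rewrite mem_enum in iS.
Qed.

Lemma dirspan_ind (S : pred I) (p : 'rV[R]_d) (P : 'rV[R]_d -> Prop) v :
  v \in dirspan S p -> P 0 -> (forall a b, P a -> P b -> P (a + b)) ->
  (forall (c : R) i, S i -> P (c *: (x i - p))) -> P v.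
Proof.
move=> vS P0 PD PS; pose X := [seq x i - p | i <- enum S].
have /coord_span -> : v \in <<in_tuple X>>%VS by [].
elim/big_ind : _ => // j _; have /mapP[i + ->] := mem_nth 0 (ltn_ord j).
by rewrite mem_enum; exact: PS.
Qed.

Lemma dirspan_orthogonal (S : pred I) (p w : 'rV[R]_d) :
  (forall i, S i -> dotp w (x i - p) = 0) ->
  forall v, v \in dirspan S p -> dotp w v = 0.
Proof.
move=> wS v vS; apply: (dirspan_ind (P := fun v => dotp w v = 0) vS).
  exact: dotp0r.
  by move=> a b wa wb; rewrite dotpDr wa wb addr0.
by move=> c i Si; rewrite dotpZr wS// mulr0.
Qed.

Lemma hull_in_dirspan (S : pred I) p (l : I -> R) :
  \sum_i l i = 1 -> (forall i, ~~ S i -> l i = 0) ->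
  (\sum_i l i *: x i) - p \in dirspan S p.
Proof.
move=> l1 lS.
have -> : \sum_i l i *: x i - p = \sum_i l i *: (x i - p).
  rewrite -[X in _ - X]scale1r -l1 scaler_suml -sumrB.
  by apply: eq_bigr => i _; rewrite scalerBr.
apply: memv_suml => i _; have [Si|nSi] := boolP (S i).
  by rewrite memvZ// mem_dirspan.
by rewrite lS// scale0r mem0v.
Qed.

Lemma has_dim_dirspan (A : set 'rV[R]_d) (S : pred I) p :
  A p -> (forall i, S i -> A (x i)) -> (forall w, A w -> w - p \in dirspan S p) ->
  has_dim A (\dim (dirspan S p)).
Proof.
move=> Ap AS AU; split; first by exists p.
exists (dirspan S p); split=> // [v w Av Aw|U HU].
  by rewrite -[v](subrK p) -addrA -[p - w]opprB rpredB// AU.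
by apply: dirspan_sub => i Si; apply: HU => //; exact: AS.
Qed.

Lemma has_dim_hull p : hull x p -> has_dim (hull x) (\dim (dirspan predT p)).
Proof.
move=> xp; apply: has_dim_dirspan => //; first by move=> i _; exact: hull_point.
by move=> _ [l [l0 l1 ->]]; apply: hull_in_dirspan.
Qed.

Definition active u (a : R) : pred I := fun i => dotp u (x i) == a.

Lemma has_dim_face u a p : (forall i, dotp u (x i) <= a) ->
  hull x p -> dotp u p = a ->
  has_dim (hull x `&` [set w | dotp u w = a]) (\dim (dirspan (active u a) p)).
Proof.
move=> ua xp up; apply: has_dim_dirspan => //.
  by move=> i /eqP ui; split=> //; exact: hull_point.
move=> w [[l [l0 l1 wE]] /= uw]; rewrite wE in uw *.
by apply: hull_in_dirspan => // i; exact: hull_face_weight l1 uw i.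
Qed.

Lemma hull_le u a w : (forall i, dotp u (x i) <= a) -> hull x w -> dotp u w <= a.
Proof.
move=> ua; apply: (@hull_sub _ _ _ x [set w | dotp u w <= a]) => //.
apply/convexP => v v' t /andP[t0 t1] /= va v'a.
rewrite !dotpE (_ : a = t * a + (1 - t) * a); last by ring.
by rewrite lerD// ler_wpM2l// subr_ge0.
Qed.

(** Every proper supporting hyperplane at a point can be tilted about the face
    it cuts out until it touches a further vertex; the dimension of the face
    strictly increases, and a proper face of maximal dimension is a facet. *)
Lemma support_in_facet p u : hull x p ->
  (forall i, dotp u (x i) <= dotp u p) -> (exists i, dotp u (x i) < dotp u p) ->
  exists F, facet (hull x) F /\ F p.
Proof.
move=> xp.
pose V0 := dirspan predT p.
have [n] := ubnP (\dim V0 - \dim (dirspan (active u (dotp u p)) p)).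
elim: n u => // n IH u; rewrite ltnS => dn up [i0 ui0].
set D := dirspan (active u (dotp u p)) p in dn *.
have DV0 : (D <= V0)%VS.
  by apply: dirspan_sub => i _; exact: mem_dirspan.
pose f : 'Hom('rV[R]_d, R^o) := linfun (fun v => dotp u v : R^o).
have fE v : f v = dotp u v.
  have lf : linear (fun v => dotp u v : R^o).
    by move=> a w w'; rewrite dotpDr dotpZr.
  pose h := HB.pack_for {linear 'rV[R]_d -> R^o} (fun v => dotp u v : R^o)
    (GRing.isLinear.Build _ _ _ _ _ lf).
  by rewrite /f -[X in linfun X]/(h : _ -> _) lfunE.
have DK : (D <= V0 :&: lker f)%VS.
  rewrite subv_cap DV0/=; apply: dirspan_sub => i /eqP ui.
  by rewrite memv_ker fE dotpBr ui subrr.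
have lt1 : (\dim D < \dim V0)%N.
  rewrite (ltn_leqif (dimv_leqif_sup DV0)); apply/negP => V0D.
  have /(subvP V0D)/(subvP DK) : x i0 - p \in V0 by exact: mem_dirspan.
  rewrite memv_cap memv_ker fE dotpBr => /andP[_].
  by rewrite subr_eq0 lt_eqF.
have [dimE|ndim] := eqVneq (\dim V0) (\dim D).+1.
  exists (hull x `&` [set w | dotp u w = dotp u p]); split; last by [].
  split.
    exists u, (dotp u p); split=> //.
      by apply/negP => /eqP u0; move: ui0; rewrite u0 !dotp0l ltxx.
    by move=> w; exact: hull_le.
  exists (\dim D); split; first by rewrite -dimE; exact: has_dim_hull.
  exact: has_dim_face.
have [g [gV0 ug gD]] : exists g, [/\ g \in V0, dotp u g = 0 & g \notin D].
  have : ~~ (V0 :&: lker f <= D)%VS.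
    apply/negP => /dimvS KD.
    have := limg_ker_dim f V0.
    have : (\dim (f @: V0) <= 1)%N.
      by apply: leq_trans (dimvS (subvf _)) _; rewrite dimvf.
    move=> fV E; move/negP: ndim; apply; rewrite eqn_leq lt1 andbT.
    by have := leq_add KD fV; rewrite E addn1.
  move=> /subvPn[g]; rewrite memv_cap memv_ker fE => /andP[gV0 /eqP ug] gD.
  by exists g.
have [w0 [w0D w0g]] := orthogonal_separation gD.
have [w [wD wg [k wk]]] : exists w, [/\ forall v, v \in D -> dotp w v = 0,
    dotp w g != 0 & exists k, 0 < dotp w (x k - p)].
  have [k wk] : exists k, dotp w0 (x k - p) != 0.
    apply: contrapT => /forallNP H; move/negP: w0g; apply; apply/eqP.
    apply: (dirspan_orthogonal _ gV0) => i _; apply/eqP.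
    by have /negP := H i; rewrite negbK.
  have [wk0|wk0|wk0] := ltgtP 0 (dotp w0 (x k - p)).
  - by exists w0; split=> //; exists k.
  - exists (- w0); split=> [v vD||].
    + by rewrite dotpNl w0D// oppr0.
    + by rewrite dotpNl oppr_eq0.
    + by exists k; rewrite dotpNl oppr_gt0.
  - by rewrite -wk0 eqxx in wk.
(* The generator x i meets the tilted hyperplane of normal u + t w at t = q i. *)
pose q i := dotp u (p - x i) / dotp w (x i - p).
pose k1 := [arg min_(i < k | 0 < dotp w (x i - p)) q i]%O.
have [wk1 qmin] : 0 < dotp w (x k1 - p) /\
    forall i, 0 < dotp w (x i - p) -> q k1 <= q i.
  by rewrite /k1; case: arg_minP => // i wi H; split=> // j /H.
have uS i : dotp w (x i - p) != 0 -> dotp u (x i) < dotp u p.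
  move=> wi; rewrite lt_neqAle up andbT; apply: contra wi => ui.
  by rewrite wD// mem_dirspan.
pose u' := u + q k1 *: w.
have q0 : 0 < q k1.
  by rewrite divr_gt0// dotpBr subr_gt0 uS// gt_eqF.
have u'E i : dotp u' (x i) <= dotp u' p.
  rewrite -subr_ge0 -dotpBr dotpDl dotpZl.
  have [wi|wi] := ltP 0 (dotp w (x i - p)).
    rewrite -[p - x i]opprB [dotp w _]dotpNr mulrN subr_ge0 -ler_pdivlMr//.
    by rewrite opprB qmin.
  rewrite addr_ge0//; first by rewrite dotpBr subr_ge0.
  by rewrite mulr_ge0 ?(ltW q0)// -[p - x i]opprB dotpNr oppr_ge0.
have u'g : dotp u' g != 0.
  by rewrite dotpDl ug add0r dotpZl mulf_neq0// gt_eqF.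
apply: (IH u') => //.
  set D' := dirspan _ p.
  have D'V0 : (D' <= V0)%VS.
    by apply: dirspan_sub => i _; exact: mem_dirspan.
  have DD' : (D <= D')%VS.
    apply: dirspan_sub => i Si; apply: mem_dirspan.
    rewrite /active /u' !dotpDl !dotpZl (eqP Si); apply/eqP.
    by congr (_ + _ * _); apply/eqP; rewrite -subr_eq0 -dotpBr wD// mem_dirspan.
  have : (\dim D < \dim D')%N.
    rewrite (ltn_leqif (dimv_leqif_sup DD')); apply/negP => /subvP D'D.
    have : x k1 - p \in D'.
      apply: mem_dirspan; rewrite /active -subr_eq0 -dotpBr dotpDl dotpZl.
      have -> : q k1 * dotp w (x k1 - p) = - dotp u (x k1 - p).
        by rewrite /q divfK ?gt_eqF// -[p - _]opprB dotpNr.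
      by rewrite subrr.
    by move=> /D'D/wD e; rewrite e ltxx in wk1.
  move=> ltD; by apply: leq_trans dn; apply: ltn_sub2l.
apply: contrapT => /forallNP H; move/negP: u'g; apply; apply/eqP.
apply: (dirspan_orthogonal _ gV0) => i _.
apply/eqP; rewrite dotpBr subr_eq0 eq_le u'E/= leNgt; apply/negP; exact: H.
Qed.


End FaceSpan.

(** * Counting facets by points of the relative boundary *)

Section Spread.
Context {R : realType} {d : nat}.
Implicit Types (K F : set 'rV[R]_d).

(** For [z] in the convex set [K], this says that [z] is relatively interior, with
    a margin [e] that is uniform over [K]. *)
Definition central (e : R) K z := forall w, K w -> K (z + e *: (z - w)).

(** The [x i] are relative boundary points, supported by [u i], with [y i] off the
    supporting hyperplane.  Sharing one margin [e] in all the conditions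
    makes the relation closed in the points and in [K]. *)
Definition spread_at (e : R) (m : nat) K (x y u : 'I_m -> 'rV[R]_d) : Prop :=
  [/\ forall i, K (x i), forall i, K (y i),
      forall i w, K w -> dotp (u i) w <= dotp (u i) (x i),
      forall i, dotp (u i) (y i) <= dotp (u i) (x i) - e &
      forall i j, i != j -> central e K (2^-1 *: (x i + x j))].

Definition spread m K := exists (e : R) (x y u : 'I_m -> 'rV[R]_d),
  0 < e /\ spread_at e K x y u.

Lemma facet_proper K F : facet K F -> ~ K `<=` F.
Proof.
move=> [[u [a [_ _ FE]]] [k [Kk Fk]]] KF.
have KFE : K = F by apply/seteqP; split=> //; rewrite FE => w [].
by rewrite -KFE in Fk; have := has_dim_unique Kk Fk; lia.
Qed.

Lemma facet_nonempty K F : facet K F -> F !=set0.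
Proof. by move=> [_ [k [_ []]]]. Qed.

(** The midpoint of two points of a facet is on that facet, hence not central; so
    the facets through the points of a spread family are distinct. *)
Lemma spread_facets (I : finType) (x : I -> 'rV[R]_d) m : spread m (hull x) ->
  exists F : 'I_m -> set 'rV[R]_d, injective F /\ forall i, facet (hull x) (F i).
Proof.
move=> [e [p [q [u [e0 [Kp Kq up uq mid]]]]]].
have /choice[F FP] : forall i : 'I_m,
    exists F, facet (hull x) F /\ F (p i).
  move=> i; apply: (@support_in_facet _ _ _ x (p i) (u i)) => //.
    by move=> j; apply: up; exact: hull_point.
  apply: contrapT => /forallNP H.
  have : dotp (- u i) (q i) <= - dotp (u i) (p i).
    apply: (@hull_le _ _ _ x) => // j; rewrite dotpNl lerN2 leNgt; apply/negP.
    exact: H.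
  rewrite dotpNl lerN2 => /le_trans/(_ (uq i)); rewrite lerBrDr gerDl.
  by rewrite leNgt e0.
exists F; split=> [i j Fij|i]; last by have [] := FP i.
apply: contrapT => /eqP ij.
have [fF Fi] := FP i; have [_ Fj] := FP j; rewrite -Fij in Fj.
apply: (facet_proper fF).
have [[v [a [_ va FE]]] _] := fF.
rewrite FE in Fi Fj *; move: Fi Fj => [_ /= vi] [_ /= vj] w Kw; split=> //=.
have /(_ w Kw) := mid i j ij; set z := _ *: _ => /va.
have vz : dotp v z = a by rewrite /z !dotpE vi vj; field.
clearbody z; rewrite !(dotpBr, dotpDr, dotpZr) vz gerDl pmulr_rle0// subr_le0 => aw.
by apply/eqP; rewrite eq_le va.
Qed.

Lemma facet_codim1 K F k k' : facet K F -> has_dim K k.+1 -> has_dim F k' -> k = k'.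
Proof.
by move=> [_ [j [Kj Fj]]] /(has_dim_unique Kj)[<-] /(has_dim_unique Fj).
Qed.

Section FacetPoints.
Context {I : finType}.
Variable x : I -> 'rV[R]_d.
Let K := hull x.

Let sum_active (S : {pred I}) (f : I -> 'rV[R]_d) (c : R) :
  \sum_i (if i \in S then c else 0) *: f i = c *: \sum_(i in S) f i.
Proof.
rewrite [in RHS]big_mkcond scaler_sumr; apply: eq_bigr => i _.
by case: ifP; rewrite ?scale0r ?scaler0.
Qed.

(** The barycentre of the vertices of a facet lies in its relative interior. *)
Definition vertex_mean (S : {pred I}) := #|S|%:R^-1 *: \sum_(i in S) x i.

Lemma vertex_mean_sum (S : {pred I}) p : (0 < #|S|)%N ->
  \sum_(i in S) (x i - p) = #|S|%:R *: (vertex_mean S - p).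
Proof.
move=> S0; rewrite sumrB scalerBr /vertex_mean scalerA divff ?pnatr_eq0 -?lt0n//.
by rewrite scale1r sumr_const scaler_nat.
Qed.

Lemma vertex_mean_hull (S : {pred I}) : (0 < #|S|)%N -> K (vertex_mean S).
Proof.
move=> S0; exists (fun i => if i \in S then #|S|%:R^-1 else 0); split.
- by move=> i; case: ifP => // _; rewrite invr_ge0.
- by rewrite -big_mkcond sumr_const -[_ *+ _]mulr_natr mulVf// pnatr_eq0 -lt0n.
- by rewrite sum_active.
Qed.

Lemma facetE F : facet K F -> exists u a,
  [/\ (forall i, dotp u (x i) <= a), F = K `&` [set w | dotp u w = a],
      (0 < #|active x u a|)%N & dotp u (vertex_mean (active x u a)) = a].
Proof.
move=> fF; have [[u [a [u0 ua FE]]] _] := fF.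
have xa i : dotp u (x i) <= a by apply: ua; exact: hull_point.
have S0 : (0 < #|active x u a|)%N.
  have [w] := facet_nonempty fF; rewrite FE => -[[l [l0 l1 wE]] /= uw].
  apply/card_gt0P; apply: contrapT => /forallNP H.
  have : \sum_i l i = 0.
    apply: big1 => i _; rewrite wE in uw; apply: (hull_face_weight xa l0 l1 uw).
    by apply/negP; exact: H.
  by rewrite l1 => /eqP; rewrite oner_eq0.
exists u, a; split=> //.
rewrite dotpZr dotp_sumr (eq_bigr (fun=> a)); last by move=> i /eqP.
by rewrite sumr_const -(mulr_natr a) mulrCA mulVf ?mulr1// pnatr_eq0 -lt0n.
Qed.

(** By convexity a feasible step can be shortened, and the midpoint of two feasible
    steps of the same length is a feasible one in the direction of the sum. *)
Lemma feasible_cone (z : 'rV[R]_d) (L : 'rV[R]_d -> Prop) :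
  K z -> (forall v, L v <-> exists2 e : R, 0 < e & K (z + e *: v)) ->
  [/\ L 0, forall v w, L v -> L w -> L (v + w) &
      forall (c : R) v, 0 <= c -> L v -> L (c *: v)].
Proof.
move=> Kz LE; have cK := @hull_convex _ _ _ x.
have L0 : L 0 by apply/LE; exists 1 => //; rewrite scaler0 addr0.
split=> // [v w|c v].
  move=> /LE[e e0 Kv] /LE[f f0 Kw]; apply/LE; exists (Order.min e f / 2).
    by rewrite divr_gt0// lt_min e0.
  set g := Order.min e f.
  have g0 : 0 < g by rewrite lt_min e0.
  rewrite (_ : z + _ = 2^-1 *: ((z + g *: v) + (z + g *: w))).
    apply: (convex_mid cK).
      by apply: (convex_shrink cK e0) => //; rewrite ltW//= ge_min lexx.
    by apply: (convex_shrink cK f0) => //; rewrite ltW//= ge_min lexx orbT.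
  by apply/rowP => i; rewrite !mxE; field.
rewrite le_eqVlt => /predU1P[<- _|c0]; first by rewrite scale0r.
move=> /LE[e e0 Kv]; apply/LE; exists (e / c); first by rewrite divr_gt0.
by rewrite scalerA divfK// gt_eqF.
Qed.

Lemma facet_sub_active u a v b : 
  (forall i, dotp u (x i) <= a) -> (forall i, dotp v (x i) <= b) ->
  (forall i, active x u a i -> active x v b i) ->
  K `&` [set w | dotp u w = a] `<=` K `&` [set w | dotp v w = b].
Proof.
move=> ua vb uv w [Kw /= uw]; split=> //=.
have [l [l0 l1 wE]] := Kw; rewrite wE in uw *.
rewrite dotp_sumr -[RHS]mul1r -l1 mulr_suml; apply: eq_bigr => i _; rewrite dotpZr.
have [/uv/eqP ->//|ni] := boolP (active x u a i).
by rewrite (hull_face_weight ua l0 l1 uw ni) !mul0r.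
Qed.

(** Two distinct facets span the polytope, so that the midpoint of their
    barycentres lies in its relative interior. *)
Lemma facet_mid_central u a v b (F G : set 'rV[R]_d) :
  let bF := vertex_mean (active x u a) in
  let bG := vertex_mean (active x v b) in
  facet K F -> facet K G -> F != G ->
  (forall i, dotp u (x i) <= a) -> (forall i, dotp v (x i) <= b) ->
  F = K `&` [set w | dotp u w = a] -> G = K `&` [set w | dotp v w = b] ->
  (0 < #|active x u a|)%N -> (0 < #|active x v b|)%N ->
  dotp u bF = a -> dotp v bG = b ->
  exists2 e : R, 0 < e & central e K (2^-1 *: (bF + bG)).
Proof.
move=> bF bG fF fG FG ua vb FE GE S0 T0 ubF vbG.
set S := active x u a in S0 bF ubF *; set T := active x v b in T0 bG vbG *.
set z := _ *: _.
have KbF : K bF by exact: vertex_mean_hull.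
have KbG : K bG by exact: vertex_mean_hull.
have cK := @hull_convex _ _ _ x.
have Kz : K z by exact: (convex_mid cK).
pose L w := exists2 e : R, 0 < e & K (z + e *: w).
have [L0 LD LZ] := feasible_cone Kz (fun v => iff_refl (L v)).
have LK w : K w -> L (w - z).
  by move=> Kw; exists 1 => //; rewrite scale1r addrC subrK.
have Lsum (A : {pred I}) (f : I -> 'rV[R]_d) : (forall i, L (f i)) ->
    L (\sum_(i in A) f i).
  by move=> Lf; elim/big_ind : _ => // *; exact: LD.
have zz : z - bF = bG - z.
  exact: mid_subl.
have neg (A : {pred I}) (b1 b2 : 'rV[R]_d) i : i \in A -> (0 < #|A|)%N ->
    b1 = vertex_mean A -> z - b1 = b2 - z -> K b2 -> L (z - x i).
  move=> iA A0 b1E b12 Kb2.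
  have -> : z - x i = \sum_(j in [predD1 A & i]) (x j - z) + #|A|%:R *: (z - b1).
    have := vertex_mean_sum z A0; rewrite -b1E (bigD1 i)//= => /eqP.
    rewrite -subr_eq0 => /eqP E.
    rewrite -[z - b1]opprB scalerN.
    under eq_bigl => j do rewrite inE andbC.
    apply/eqP; rewrite -subr_eq0 -oppr_eq0; apply/eqP; rewrite -[RHS]E.
    rewrite -[x i - z]opprB.
    set t := \sum_(_ in _ | _) _; rewrite opprB opprD opprK.
    by rewrite [LHS]addrC addrA.
  apply: LD; first by apply: Lsum => j; apply: LK; exact: hull_point.
  by apply: LZ => //; rewrite b12; exact: LK.
pose W := dirspan x [predU S & T] z.
have LW w : w \in W -> L w.
  move=> /dirspan_ind; apply=> // c i iST.
  have Lp : L (x i - z) by apply: LK; exact: hull_point.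
  have Ln : L (z - x i).
    case/orP: iST => [iS|iT]; first exact: (neg S bF bG).
    apply: (neg T bG bF) => //.
    by rewrite /z [bF + bG]addrC mid_subl.
  have [c0|c0] := leP 0 c; first exact: LZ.
  by rewrite -opprB scalerN -scaleNr; apply: LZ => //; rewrite oppr_ge0 ltW.
have [k [Kk Fk]] := fF.2.
have dimK : \dim (dirspan x predT z) = k.+1.
  exact: has_dim_unique (has_dim_hull Kz) Kk.
have dimS : \dim (dirspan x S bF) = k.
  by apply: has_dim_unique Fk; rewrite FE; exact: has_dim_face.
have dimT : \dim (dirspan x T bG) = k.
  apply/esym; apply: (facet_codim1 fG Kk); rewrite GE; exact: has_dim_face.
have WK : (W <= dirspan x predT z)%VS.
  by apply: dirspan_sub => i _; exact: mem_dirspan.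
have meanW (A : {pred I}) : (0 < #|A|)%N -> (forall i, i \in A -> x i - z \in W) ->
    vertex_mean A - z \in W.
  move=> A0 AW.
  have -> : vertex_mean A - z = #|A|%:R^-1 *: \sum_(i in A) (x i - z).
    by rewrite vertex_mean_sum// scalerA mulVf ?scale1r// pnatr_eq0 -lt0n.
  by rewrite memvZ// memv_suml.
have SW i : i \in S -> x i - z \in W.
  by move=> iS; apply: mem_dirspan; rewrite /= iS.
have TW i : i \in T -> x i - z \in W.
  by move=> iT; apply: mem_dirspan; rewrite /= iT orbT.
have bFW := meanW S S0 SW; have bGW := meanW T T0 TW.
have WS : (dirspan x S bF <= W)%VS.
  apply: dirspan_sub => i iS; rewrite (_ : _ - _ = (x i - z) - (bF - z)).
    by rewrite rpredB// SW.
  by rewrite opprB addrA subrK.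
have WT : (dirspan x T bG <= W)%VS.
  apply: dirspan_sub => i iT; rewrite (_ : _ - _ = (x i - z) - (bG - z)).
    by rewrite rpredB// TW.
  by rewrite opprB addrA subrK.
have dirorth (w : 'rV[R]_d) (c : R) (p : 'rV[R]_d) : dotp w p = c ->
    forall h, h \in dirspan x (active x w c) p -> dotp w h = 0.
  by move=> wp; apply: dirspan_orthogonal => i /eqP wi; rewrite dotpBr wi wp subrr.
have dimW : (k < \dim W)%N.
  rewrite ltn_neqAle -{2}dimS dimvS// andbT; apply: contra FG => /eqP kW.
  have SWE : (W <= dirspan x S bF)%VS by rewrite -(geq_leqif (dimv_leqif_sup WS)) dimS kW.
  have TWE : (W <= dirspan x T bG)%VS by rewrite -(geq_leqif (dimv_leqif_sup WT)) dimT kW.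
  apply/eqP; rewrite FE GE; apply/seteqP; split; apply: facet_sub_active => // i Ai.
    have : x i - bG \in dirspan x T bG.
      apply: (subvP TWE); rewrite (_ : _ - _ = (x i - z) - (bG - z)).
        by rewrite rpredB// SW.
      by rewrite opprB addrA subrK.
    by move=> /(dirorth _ _ _ vbG)/eqP; rewrite dotpBr vbG subr_eq0.
  have : x i - bF \in dirspan x S bF.
    apply: (subvP SWE); rewrite (_ : _ - _ = (x i - z) - (bF - z)).
      by rewrite rpredB// TW.
    by rewrite opprB addrA subrK.
  by move=> /(dirorth _ _ _ ubF)/eqP; rewrite dotpBr ubF subr_eq0.
have KW : (dirspan x predT z <= W)%VS.
  by rewrite -(geq_leqif (dimv_leqif_sup WK)) dimK.
have /choice[e eP] : forall i, exists e : R, 0 < e /\ K (z + e *: (z - x i)).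
  move=> i; have [e e0 Ke] : L (z - x i).
    apply: LW; rewrite -opprB rpredN; apply: (subvP KW); exact: mem_dirspan.
  by exists e.
pose e0 := \big[Order.min/1]_i e i.
have e00 : 0 < e0.
  by rewrite /e0; elim/big_ind : _ => // [p q p0 q0|i _]; [rewrite lt_min p0|have [] := eP i].
exists e0 => //; apply: hull_sub.
  apply/convexP => a' b' t t01 /= Ka Kb; have /convexP/(_ _ _ t t01 Ka Kb) := cK.
  by congr (K _); apply/rowP => i; rewrite !mxE; ring.
move=> i /=; have [ei Ki] := eP i.
have ee : e0 <= e i by rewrite /e0; exact: bigmin_le_cond.
by apply: (convex_shrink cK ei) => //; rewrite ltW.
Qed.

(** Barycentres of the vertices of the facets are spread. *)
Lemma facets_spread m (F : 'I_m -> set 'rV[R]_d) : injective F ->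
  (forall i, facet K (F i)) -> spread m K.
Proof.
move=> Finj fF.
have /choice[ua uaP] : forall i, exists ua : 'rV[R]_d * R,
  [/\ (forall j, dotp ua.1 (x j) <= ua.2), F i = K `&` [set w | dotp ua.1 w = ua.2],
      (0 < #|active x ua.1 ua.2|)%N &
      dotp ua.1 (vertex_mean (active x ua.1 ua.2)) = ua.2].
  by move=> i; have [u [a H]] := facetE (fF i); exists (u, a).
pose p i := vertex_mean (active x (ua i).1 (ua i).2).
have Kp i : K (p i) by apply: vertex_mean_hull; have [] := uaP i.
have /choice[y yP] : forall i, exists y, K y /\ dotp (ua i).1 y < (ua i).2.
  move=> i; apply: contrapT => /forallNP H; apply: (facet_proper (fF i)) => w Kw.
  have [uax -> _ _] := uaP i; split=> //=; apply/eqP; rewrite eq_le (hull_le uax)//=.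
  by rewrite leNgt; apply/negP => uw; exact: (H w).
have /choice[e eP] : forall ij : 'I_m * 'I_m, exists e : R, 0 < e /\
    (ij.1 != ij.2 -> central e K (2^-1 *: (p ij.1 + p ij.2))).
  move=> [i j] /=; have [->|ij] := eqVneq i j; first by exists 1; rewrite ltr01.
  have [uax FE A0 pE] := uaP i; have [uax' FE' A0' pE'] := uaP j.
  have [|e e0 ce] := facet_mid_central (fF i) (fF j) _ uax uax' FE FE' A0 A0' pE pE'.
    by apply: contra ij => /eqP/Finj ->.
  by exists e.
have up i : dotp (ua i).1 (p i) = (ua i).2 by have [] := uaP i.
pose e0 := Order.min (\big[Order.min/1]_ij e ij) (\big[Order.min/1]_i ((ua i).2 - dotp (ua i).1 (y i))).
exists e0, p, y, (fun i => (ua i).1); split; last split.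
- rewrite lt_min; apply/andP; split.
    by elim/big_ind : _ => // [a b a0 b0|ij _]; [rewrite lt_min a0|have [] := eP ij].
  elim/big_ind : _ => // [a b a0 b0|i _]; first by rewrite lt_min a0.
  by rewrite subr_gt0; have [] := yP i.
- by [].
- by move=> i; have [] := yP i.
- by move=> i w Kw; rewrite up; apply: hull_le Kw; have [] := uaP i.
- move=> i; rewrite up lerBrDr addrC -lerBrDr /e0 ge_min; apply/orP; right.
  exact: bigmin_le_cond.
- move=> i j ij w Kw; set z := _ *: _.
  have [eij /(_ ij w Kw)/=] := eP (i, j); rewrite -/z => Ke.
  have ee : e0 <= e (i, j).
    by rewrite /e0 ge_min; apply/orP; left; exact: bigmin_le_cond.
  have e00 : 0 <= e0.
    rewrite le_min; apply/andP; split.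
      by elim/big_ind : _ => // [a b a0 b0|ij' _]; [rewrite le_min a0|have [/ltW] := eP ij'].
    elim/big_ind : _ => // [a b a0 b0|i' _]; first by rewrite le_min a0.
    by rewrite subr_ge0 ltW//; have [] := yP i'.
  have cK := @hull_convex _ _ _ x.
  apply: (convex_shrink cK eij) => //; first by rewrite e00 ee.
  exact: (convex_mid cK (Kp _) (Kp _)).
Qed.

End FacetPoints.
End Spread.

Section PolytopeFacets.
Context {R : realType} {d : nat}.
Implicit Types (K F : set 'rV[R]_d).

(** Replaces cardinals by injections, which is how facets are produced. *)
Lemma card_ge_ordP (T : pointedType) (A : set T) n :
  (`I_n #<= A)%card <-> exists F : 'I_n -> T, injective F /\ forall i, A (F i).
Proof.
split=> [/pcard_leP[f]|[F [Finj AF]]].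
  exists (fun i : 'I_n => f i); split=> [i j fij|i]; last exact: (@funS _ _ _ _ f i (ltn_ord i)).
  by apply/val_inj/('inj_f) => //; rewrite inE/=.
apply: card_le_trans (@subset_card_le _ (range F) A _); last by move=> _ [i _ <-].
have /card_eqPle[_] : (range F #= [set: 'I_n])%card.
  by apply: inj_card_eq => i j _ _; exact: Finj.
by apply: card_le_trans; have /card_eqPle[] := @card_II n.
Qed.

Lemma card_eq_ordP (T : Type) (A : set T) n :
  (A #= `I_n)%card <-> (`I_n #<= A)%card /\ ~ (`I_n.+1 #<= A)%card.
Proof.
split=> [An|[An nAn]].
  by rewrite !(card_le_eqr An) !card_le_II ltnn.
have [/finite_setP[k Ak]|/infiniteP/(card_le_trans _)H] := pselect (finite_set A).
  move: An nAn; rewrite !(card_le_eqr Ak) !card_le_II => nk /negP.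
  by rewrite -leqNgt => kn; rewrite (_ : n = k)//; apply/eqP; rewrite eqn_leq nk.
by exfalso; apply: nAn; apply: H; exact: subset_card_le.
Qed.

(** The number of facets of a polytope is the largest size of a family of points
    of its relative boundary no two of which lie on a common facet. *)
Lemma polytopes_with_facetsP n K :
  polytopes_with_facets n K <-> [/\ polytope K, spread n K & ~ spread n.+1 K].
Proof.
have H m : polytope K -> spread m K <-> (`I_m #<= [set F | facet K F])%card.
  move=> /polytopeP[q [x ->]]; rewrite card_ge_ordP; split=> [/spread_facets//|].
  by move=> [F [Finj fF]]; exact: facets_spread Finj fF.
by split=> [[pK /card_eq_ordP[]]|[pK]]; [rewrite -!H|rewrite !H => // *;
  split=> //; apply/card_eq_ordP].
Qed.

End PolytopeFacets.

(** * Polytopes given by irredundant half-spaces *)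

Section HalfspacePolytope.
Context {R : realType} {d : nat} {I : finType}.
Variables (g : I -> 'rV[R]_d) (b : I -> R).

Definition hpolyhedron : set 'rV[R]_d := [set w | forall i, dotp (g i) w <= b i].

Let Q := hpolyhedron.

Lemma hpolyhedron_convex : convex_set Q.
Proof.
apply/convexP => v w t /andP[t0 t1] Qv Qw i.
rewrite !dotpE (_ : b i = t * b i + (1 - t) * b i); last by ring.
by rewrite lerD// ler_wpM2l// subr_ge0.
Qed.

Hypothesis bounded : exists M, forall w, Q w -> enorm w <= M.

(** Boundedness makes the room left by strict inequalities uniform. *)
Lemma strict_central z : (forall i, dotp (g i) z < b i) ->
  exists2 e : R, 0 < e & central e Q z.
Proof.
move=> zb; have [M0 QM0] := bounded.
pose M := Order.max M0 0.
have M_ge0 : 0 <= M by rewrite le_max lexx orbT.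
have QM w : Q w -> enorm w <= M by move=> /QM0 wM; rewrite le_max wM.
pose s i := 1 + 2 * enorm (g i) * M.
have s0 i : 0 < s i by rewrite ltr_wpDr// !mulr_ge0 ?enorm_ge0.
pose e := \big[Order.min/1]_i ((b i - dotp (g i) z) / s i).
have e0 : 0 < e.
  rewrite /e; elim/big_ind : _ => // [p q p0 q0|i _]; first by rewrite lt_min p0.
  by rewrite divr_gt0// subr_gt0.
have Qz : Q z by move=> i; exact: ltW.
exists e => // w Qw i; rewrite !(dotpBr, dotpDr, dotpZr).
have bnd v : Q v -> `|dotp (g i) v| <= enorm (g i) * M.
  by move=> /QM vM; rewrite (le_trans (dotp_CS_norm _ _))// ler_wpM2l ?enorm_ge0.
have dz : dotp (g i) z - dotp (g i) w <= s i.
  have := bnd _ Qz; have := bnd _ Qw; rewrite !ler_norml /s; lra.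
have : e * s i <= b i - dotp (g i) z.
  by rewrite -ler_pdivlMr// /e bigmin_le_cond.
have : e * (dotp (g i) z - dotp (g i) w) <= e * s i by rewrite ler_pM2l.
lra.
Qed.

Let vertex (w : 'rV[R]_d) := Q w /\ forall z : 'rV[R]_d,
  (forall i, dotp (g i) w = b i -> dotp (g i) z = 0) -> z = 0.

(** From a point whose active normals do not span one can move along a line until
    a further constraint becomes active. *)
Lemma hpolyhedron_ray w z : Q w -> z != 0 ->
  (forall i, dotp (g i) w = b i -> dotp (g i) z = 0) ->
  exists t : R, [/\ 0 < t, Q (w + t *: z) &
    exists i, dotp (g i) w != b i /\ dotp (g i) (w + t *: z) = b i].
Proof.
move=> Qw z0 wz; have [M QM] := bounded.
have ez : 0 < enorm z.
  rewrite lt_neqAle enorm_ge0 andbT eq_sym; apply: contra z0 => /eqP ez.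
  apply/eqP/rowP => j; rewrite mxE; apply/eqP; rewrite -normr_le0 -ez.
  exact: enorm_coord.
have [i0 gi0] : exists i, 0 < dotp (g i) z.
  apply: contrapT => /forallNP H.
  pose t := (M + enorm w + 1) / enorm z.
  have M0 : 0 <= M by apply: le_trans (QM _ Qw); exact: enorm_ge0.
  have t0 : 0 < t by rewrite divr_gt0// ltr_wpDl// addr_ge0// enorm_ge0.
  have : Q (w + t *: z).
    move=> i; rewrite dotpDr dotpZr; apply: le_trans (Qw i); rewrite gerDl.
    by rewrite pmulr_rle0// leNgt; apply/negP; exact: H.
  move=> /QM; have : enorm (t *: z) <= enorm (w + t *: z) + enorm w.
    rewrite -[X in enorm X <= _](addKr w) addrC -(enormN w); exact: enormD.
  have -> : enorm (t *: z) = t * enorm z.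
    by rewrite /enorm dotpZl dotpZr mulrA -expr2 sqrtrM ?sqr_ge0// sqrtr_sqr gtr0_norm.
  rewrite divfK ?gt_eqF//; lra.
pose q i := (b i - dotp (g i) w) / dotp (g i) z.
pose i1 := [arg min_(i < i0 | 0 < dotp (g i) z) q i]%O.
have [gi1 qmin] : 0 < dotp (g i1) z /\ forall i, 0 < dotp (g i) z -> q i1 <= q i.
  by rewrite /i1; case: arg_minP => // i wi H; split=> // j /H.
have neq : dotp (g i1) w != b i1.
  by apply/eqP => /wz e; rewrite e ltxx in gi1.
have q0 : 0 < q i1 by rewrite divr_gt0// subr_gt0 lt_neqAle neq Qw.
exists (q i1); split=> //.
  move=> i; rewrite dotpDr dotpZr -lerBrDl.
  have [gi|gi] := ltP 0 (dotp (g i) z); first by rewrite -ler_pdivlMr// qmin.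
  rewrite (@le_trans _ _ 0)//; first by rewrite mulr_ge0_le0// ltW.
  by rewrite subr_ge0.
exists i1; split=> //; rewrite dotpDr dotpZr /q divfK ?gt_eqF//.
by rewrite addrC subrK.
Qed.

(** Induction on the number of inactive constraints: a point that is not a vertex
    lies between the two ends of a line along which it moves. *)
Lemma hpolyhedron_vertices (A : set 'rV[R]_d) : convex_set A ->
  vertex `<=` A -> Q `<=` A.
Proof.
move=> cA vA w.
have [n] := ubnP #|[pred i | dotp (g i) w != b i]|.
elim: n w => // n IH w; rewrite ltnS => wn Qw.
have [vw|nvw] := pselect (vertex w); first exact: vA.
have [z [wz z0]] : exists z, (forall i, dotp (g i) w = b i -> dotp (g i) z = 0) /\ z != 0.
  apply: contrapT => /forallNP H; apply: nvw; split=> // z wz.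
  by apply/eqP/negPn/negP => z0; exact: (H z).
have step (v : 'rV[R]_d) : (v == z) || (v == - z) -> exists2 t : R, 0 < t & A (w + t *: v).
  move=> vz; have v0 : v != 0 by case/orP: vz => /eqP->; rewrite ?oppr_eq0.
  have wv i : dotp (g i) w = b i -> dotp (g i) v = 0.
    by move=> /wz; case/orP: vz => /eqP-> //; rewrite dotpNr => ->; rewrite oppr0.
  have [t [t0 Qt [i [wi ti]]]] := hpolyhedron_ray Qw v0 wv.
  exists t => //; apply: IH => //; apply: leq_trans wn; apply: proper_card.
  apply/properP; split; last by exists i; rewrite !inE// ti eqxx.
  apply/fintype.subsetP => j; rewrite !inE; apply: contra => /eqP wj.
  by rewrite dotpDr dotpZr wv// mulr0 addr0 wj.
have [s s0 As] := step z (predU1l _ erefl).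
have [t t0 At] : exists2 t : R, 0 < t & A (w + t *: - z).
  by apply: step; rewrite eqxx orbT.
have /convexP cA' := cA.
rewrite (_ : w = (t / (s + t)) *: (w + s *: z) + (1 - t / (s + t)) *: (w + t *: - z)).
  apply: cA' => //; apply/andP; split; first by rewrite divr_ge0 ?addr_ge0// ltW.
  by rewrite ler_pdivrMr ?addr_gt0// mul1r lerDr ltW.
by apply/rowP => i; rewrite !mxE; field; rewrite gt_eqF// addr_gt0.
Qed.

(** A vertex is determined by its set of active constraints, so there are finitely
    many vertices. *)
Lemma hpolyhedron_polytope : Q !=set0 -> polytope Q.
Proof.
move=> [w0 Qw0]; exists vertex.
have cH : convex_set (convex_hull vertex).
  apply/convexP => x y t t01 Hx Hy B [cB vB].
  by have /convexP := cB; apply => //; [exact: Hx|exact: Hy].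
have vH : vertex `<=` convex_hull vertex by exact: sub_smallest.
split.
- pose act (w : 'rV[R]_d) := [set i | dotp (g i) w == b i]%SET.
  rewrite -(@eq_finite_set _ _ (act @` vertex)); first exact: finite_finset.
  apply: inj_card_eq => w v /set_mem[_ vw] /set_mem[_ vv] /setP E.
  apply/eqP; rewrite -subr_eq0; apply/eqP/vw => i wi.
  have := E i; rewrite !inE wi eqxx => /esym/eqP vi.
  by rewrite dotpBr wi vi subrr.
- apply: contrapT => v0; have /(_ set0) := @hpolyhedron_vertices.
  move=> /(_ _ _ w0 Qw0); apply; last by move=> v vv; apply: v0; exists v.
  by move=> x y t; rewrite inE.
- apply/seteqP; split; first exact: hpolyhedron_vertices.
  by apply: smallest_sub; [exact: hpolyhedron_convex|move=> w []].
Qed.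

(** When no half-space is redundant, the witnesses of irredundancy form a largest
    family of boundary points with interior midpoints: two boundary points on
    the same bounding hyperplane have their midpoint on it as well. *)
Lemma hpolyhedron_facets (q : I -> 'rV[R]_d) (o : 'rV[R]_d) :
  (forall i, dotp (g i) o < b i) ->
  (forall i, dotp (g i) (q i) = b i) ->
  (forall i j, j != i -> dotp (g j) (q i) < b j) ->
  polytopes_with_facets #|I| Q.
Proof.
move=> ob qb qlt.
have Qo : Q o by move=> i; exact: ltW.
have Qq i : Q (q i).
  by move=> j; have [->|ji] := eqVneq j i; [rewrite qb|apply/ltW/qlt].
apply/polytopes_with_facetsP; split; first by apply: hpolyhedron_polytope; exists o.
  have /choice[e eP] : forall ij : I * I, exists e : R, 0 < e /\
      (ij.1 != ij.2 -> central e Q (2^-1 *: (q ij.1 + q ij.2))).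
    move=> [i j] /=; have [->|ij] := eqVneq i j; first by exists 1; rewrite ltr01.
    have [k|e e0 ce] := @strict_central (2^-1 *: (q i + q j)); last by exists e.
    rewrite dotpZr dotpDr.
    have [ki|ki] := eqVneq k i.
      have := qlt j k; rewrite ki ij qb => /(_ isT); lra.
    have := qlt i k ki; have := Qq j k; lra.
  pose e0 := Order.min (\big[Order.min/1]_ij e ij)
    (\big[Order.min/1]_i (b i - dotp (g i) o)).
  have e00 : 0 < e0.
    rewrite lt_min; apply/andP; split.
      by elim/big_ind : _ => // [u v u0 v0|ij _]; [rewrite lt_min u0|have [] := eP ij].
    elim/big_ind : _ => // [u v u0 v0|i _]; first by rewrite lt_min u0.
    by rewrite subr_gt0.
  exists e0, (q \o enum_val), (fun=> o), (g \o enum_val); split=> //; split=> //=.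
  - by move=> i w Qw /=; rewrite qb; exact: Qw.
  - move=> i; rewrite qb lerBrDr addrC -lerBrDr /e0 ge_min; apply/orP; right.
    exact: bigmin_le_cond.
  - move=> i j ij w Qw /=; set z := _ *: _.
    have [eij] := eP (enum_val i, enum_val j).
    rewrite /= (inj_eq enum_val_inj) => /(_ ij w Qw) Qz.
    apply: (convex_shrink hpolyhedron_convex eij) => //.
      by rewrite ltW//= /e0 ge_min; apply/orP; left; exact: bigmin_le_cond.
    by apply: (convex_mid hpolyhedron_convex); exact: Qq.
move=> [e [x [y [u [e0 [Qx Qy ux uy mid]]]]]].
have /choice[f fP] : forall k, exists i, dotp (g i) (x k) = b i.
  move=> k; apply: contrapT => /forallNP H.
  have [i|e' e'0 /(_ _ (Qy k))] := @strict_central (x k).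
    by rewrite lt_neqAle Qx andbT; apply/eqP; exact: H.
  move=> /(ux k); rewrite dotpDr gerDl dotpZr pmulr_rle0// dotpBr.
  by have := uy k; lra.
have [k [l [kl fkl]]] : exists k l, k != l /\ f k = f l.
  apply: contrapT => H.
  suff /leq_card : injective f by rewrite card_ord ltnn.
  move=> k l fkl; apply/eqP/negPn/negP => kl; apply: H; by exists k, l.
have /(_ o Qo (f k)) := mid k l kl; set z := _ *: _.
have zb : dotp (g (f k)) z = b (f k).
  by rewrite dotpZr dotpDr {2}fkl !fP fkl; field.
clearbody z; rewrite dotpDr dotpZr dotpBr zb gerDl pmulr_rle0// subr_le0.
by rewrite leNgt ob.
Qed.

End HalfspacePolytope.

(** * The Borel sets of convex bodies with a given number of facets *)

Section Borel.
Context {T : topologicalType}.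
Implicit Types A B : set T.

Lemma borel_open A : open A -> borel A.
Proof. by move=> oA; exact: sub_sigma_algebra. Qed.

Lemma borelC A : borel A -> borel (~` A).
Proof. by move=> bA; rewrite -setTD; exact: sigma_algebraCD. Qed.

Lemma borel_closed A : closed A -> borel A.
Proof. by move=> cA; rewrite -(setCK A); apply: borelC; apply: borel_open; exact: closed_openC. Qed.

Lemma borel_bigcup (F : nat -> set T) :
  (forall n, borel (F n)) -> borel (\bigcup_n F n).
Proof. by move=> bF; exact: sigma_algebra_bigcup. Qed.

Lemma borelU A B : borel A -> borel B -> borel (A `|` B).
Proof. by move=> bA bB; rewrite -bigcup2E; apply: borel_bigcup => -[|[|n]]//=; exact: sigma_algebra0. Qed.

Lemma borelI A B : borel A -> borel B -> borel (A `&` B).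
Proof.
move=> bA bB; rewrite -(setCK A) -(setCK B) -setCU; apply: borelC.
by apply: borelU; exact: borelC.
Qed.

Lemma borelD A B : borel A -> borel B -> borel (A `\` B).
Proof. by move=> bA bB; rewrite setDE; apply: borelI => //; exact: borelC. Qed.

Lemma borel_bigU (I : finType) (F : I -> set T) :
  (forall i, borel (F i)) -> borel (\bigcup_i F i).
Proof.
move=> bF; rewrite (_ : \bigcup_i F i =
    \bigcup_n (if insub n is Some i then F (enum_val (i : 'I_#|I|)) else set0)).
  by apply: borel_bigcup => n; case: insubP => [i _ _//|_]; exact: sigma_algebra0.
apply/seteqP; split=> [x [i _ Fx]|x [n _]].
  by exists (enum_rank i) => //; rewrite insubT => //= lt; rewrite (_ : Sub _ _ = enum_rank i) ?enum_rankK//; exact: val_inj.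
by case: insubP => // i _ _ Fx; exists (enum_val i).
Qed.

End Borel.

Lemma borel_preimage (S T : topologicalType) (f : S -> T) (B : set T) :
  continuous f -> borel B -> borel (f @^-1` B).
Proof.
move=> cf bB; suff : (@borel T) `<=` [set A | borel (f @^-1` A)] by apply.
apply: smallest_sub; last first.
  by move=> A oA; apply: borel_open; move/continuousP: cf; apply.
split=> /= [|A bA|F bF].
- by rewrite preimage_set0; exact: sigma_algebra0.
- by rewrite setTD preimage_setC; exact: borelC.
- by rewrite preimage_bigcup; exact: borel_bigcup.
Qed.

(** The tube lemma. *)
Lemma closed_projection (X Y : topologicalType) (C : set Y) (S : set (X * Y)) :
  compact C -> closed S -> closed [set x | exists2 y, C y & S (x, y)].
Proof.
move=> /compact_near_coveringP cC cS; rewrite -openC openE => x xS.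
have : \forall x' \near x, C `<=` (fun y => ~ S (x', y)).
  apply: (cC X (nbhs x) (fun x' y => ~ S (x', y))) => y Cy.
  have /closed_openC := cS; rewrite openE => /(_ (x, y)) [].
    by move=> Sxy; apply: xS; exists y.
  move=> [A B] /= [nA nB] AB; exists (B, A) => //= -[y' x'] /= [By' Ax'].
  by apply: (AB (x', y')).
by apply: filterS => x' H' [y Cy]; exact: H'.
Qed.

Lemma coord_continuous_mx (T : topologicalType) m n i j :
  continuous (fun M : 'M[T]_(m, n) => M i j).
Proof.
move=> M A nA; exists (fun i' j' => if (i' == i) && (j' == j) then A else setT).
  by move=> i' j'; case: ifP => [/andP[/eqP-> /eqP->]//|_]; exact: filterT.
by move=> N /(_ i j); rewrite !eqxx.
Qed.

Lemma continuous_then (X Y Z : topologicalType) (g : Y -> Z) (f : X -> Y) :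
  continuous f -> continuous g -> continuous (fun x => g (f x)).
Proof. by move=> cf cg x; exact: (continuous_comp (cf x) (cg (f x))). Qed.

Lemma continuous_fst (X Y : topologicalType) : continuous (@fst X Y).
Proof. by move=> x; exact: cvg_fst. Qed.

Lemma continuous_snd (X Y : topologicalType) : continuous (@snd X Y).
Proof. by move=> x; exact: cvg_snd. Qed.

Lemma continuous_sum (R : realType) (W : normedModType R) (I : Type)
    (X : topologicalType) (r : seq I) (f : I -> X -> W) :
  (forall i, continuous (f i)) -> continuous (fun x => \sum_(i <- r) f i x).
Proof.
by move=> fa; apply: continuous_big => [|i _]; [exact: add_continuous|exact: fa].
Qed.

Section Relations.
Context {R : realType} {d : nat} {X : topologicalType}.
Local Notation V := 'rV[R]_d.
Local Notation T := (convex_body R d).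
Implicit Types (f g : X -> V) (k : X -> T).

Lemma nbhs_convex_body (K : T) (P : T -> Prop) (e : R) : 0 < e ->
  (forall L : T, hausdorff_dist K L < e -> P L) -> nbhs K P.
Proof. by move=> e0 H; apply/nbhs_ballP; exists e => // L KL; exact: H. Qed.

Lemma hausdorff_dist_near (K L : T) e x : hausdorff_dist K L < e -> body K x ->
  exists2 y, body L y & enorm (x - y) < e.
Proof.
move=> KL Kx; have hi : has_inf (hausdorff_gaps K L).
  by split; [exact: hausdorff_gaps_neq0|exact: hausdorff_gaps_lb].
have e0 : 0 < e - hausdorff_dist K L by rewrite subr_gt0.
have [a [a0 /(_ _ Kx)[y Ly xy] _]] := inf_adherent e0 hi.
by rewrite addrC subrK => ae; exists y => //; exact: le_lt_trans ae.
Qed.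

Lemma enorm_ball (v w : V) (e : R) : 0 < e -> enorm (v - w) < e -> ball v e w.
Proof.
move=> e0 vw; split=> // i j; rewrite (ord1 i) /ball/=.
by apply: le_lt_trans vw; rewrite (le_trans _ (enorm_coord _ j))// !mxE.
Qed.

Lemma body_closed (K : T) : closed (body K).
Proof.
by have [_ cK _] := bodyP K; apply: compact_closed cK; exact: norm_hausdorff.
Qed.

Lemma closed_mem k f : continuous k -> continuous f -> closed [set x | body (k x) (f x)].
Proof.
move=> ck cf; rewrite -openC openE => x /= nKv.
have /closed_openC := @body_closed (k x); rewrite openE => /(_ _ nKv)/nbhs_ballP[e /= e0 eK].
have e20 : 0 < e / 2 by rewrite divr_gt0.
have : \forall y \near x, hausdorff_dist (k x) (k y) < e / 2.
  by apply: (ck x [set L | hausdorff_dist (k x) L < e / 2]); exact: (nbhs_convex_body e20).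
have : \forall y \near x, ball (f x) (e / 2) (f y).
  by apply: (cf x); exact: nbhsx_ballx.
apply: filterS2 => y xy; rewrite hausdorff_dist_sym => /hausdorff_dist_near H Ky.
have [z Kz yz] := H _ Ky.
apply: (eK z) => //; rewrite (splitr e); apply: (ball_triangle xy).
exact: enorm_ball.
Qed.

(** A point of a body is approximated by points of the bodies nearby, so a closed
    condition on all points passes to the limit. *)
Lemma closed_forall_mem k (S : set (X * V)) : continuous k -> closed S ->
  closed [set x | forall w, body (k x) w -> S (x, w)].
Proof.
move=> ck cS; rewrite -openC openE => x /= /existsNP[w /not_implyP[Kw nS]].
have /closed_openC := cS; rewrite openE => /(_ _ nS)[[A B] /= [nA nB] AB].
have /nbhs_ballP[e /= e0 eB] := nB.
have : \forall y \near x, hausdorff_dist (k x) (k y) < e.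
  by apply: (ck x [set L | hausdorff_dist (k x) L < e]); exact: (nbhs_convex_body e0).
apply: filterS2 nA => y Ay /hausdorff_dist_near/(_ Kw)[w' Kw' ww'] H.
apply: (AB (y, w')) => /=; last exact: H.
by split=> //; apply: eB; exact: enorm_ball.
Qed.

Lemma continuous_dotp f g : continuous f -> continuous g ->
  continuous (fun x => dotp (f x) (g x)).
Proof.
move=> cf cg; apply: (@continuous_sum R R^o) => i x; apply: cvgM.
  exact: (continuous_comp (cf x) (@coord_continuous _ _ _ 0 i _)).
exact: (continuous_comp (cg x) (@coord_continuous _ _ _ 0 i _)).
Qed.

Lemma closed_le_fun (a b : X -> R) : continuous a -> continuous b ->
  closed [set x | a x <= b x].
Proof.
move=> ca cb; rewrite (_ : mkset _ = (fun x => a x - b x) @^-1` [set t | t <= 0]).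
  apply: (continuous_closedP _).1; last exact: closed_le.
  by move=> x; apply: cvgB; [exact: ca|exact: cb].
by apply/seteqP; split=> x /=; rewrite subr_le0.
Qed.

End Relations.

Section SpreadClosed.
Context {R : realType} {d : nat} (m : nat).
Local Notation V := 'rV[R]_d.
Local Notation T := (convex_body R d).
Local Notation Theta := ('rV[V]_m * 'rV[V]_m * 'rV[V]_m)%type.

Definition spread_bounded (e M : R) : set T := [set K | exists2 t : Theta,
  ([set x : 'rV[V]_m | forall i, `|x 0 i| <= M] `*` [set x : 'rV[V]_m | forall i, `|x 0 i| <= M]
   `*` [set x : 'rV[V]_m | forall i, `|x 0 i| <= M]) t &
  spread_at e K (t.1.1 0) (t.1.2 0) (t.2 0)].

Lemma compact_norm_le (M : R) : compact [set x : 'rV[V]_m | forall i, `|x 0 i| <= M].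
Proof.
apply: (@rV_compact _ _ (fun=> [set v : V | `|v| <= M])) => i.
apply: bounded_closed_compact.
  exists M; split; first exact: num_real.
  by move=> N MN v /= vM; exact: le_trans (ltW MN).
by apply: closed_le_fun; [exact: norm_continuous|exact: cst_continuous].
Qed.

(** A projection of a closed relation along the compact set of witnesses. *)
Lemma spread_bounded_closed e M : closed (spread_bounded e M).
Proof.
apply: (@closed_projection T Theta _ [set p : T * Theta |
    spread_at e (body p.1) (p.2.1.1 0) (p.2.1.2 0) (p.2.2 0)]).
  apply: compact_setX; last exact: compact_norm_le.
  by apply: compact_setX; exact: compact_norm_le.
have ck : continuous (fun p : T * Theta => p.1) by exact: continuous_fst.
have c2 : continuous (fun p : T * Theta => p.2) by exact: continuous_snd.
have cx i : continuous (fun p : T * Theta => p.2.1.1 0 i).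
  apply: (@continuous_then _ _ _ (fun x : 'rV[V]_m => x 0 i)); last exact: coord_continuous_mx.
  apply: (@continuous_then _ _ _ fst); last exact: continuous_fst.
  by apply: (@continuous_then _ _ _ fst) => //; exact: continuous_fst.
have cy i : continuous (fun p : T * Theta => p.2.1.2 0 i).
  apply: (@continuous_then _ _ _ (fun x : 'rV[V]_m => x 0 i)); last exact: coord_continuous_mx.
  apply: (@continuous_then _ _ _ snd); last exact: continuous_snd.
  by apply: (@continuous_then _ _ _ fst) => //; exact: continuous_fst.
have cu i : continuous (fun p : T * Theta => p.2.2 0 i).
  apply: (@continuous_then _ _ _ (fun x : 'rV[V]_m => x 0 i)); last exact: coord_continuous_mx.
  by apply: (@continuous_then _ _ _ snd) => //; exact: continuous_snd.
have fst_cont (f : T * Theta -> V) : continuous f ->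
    continuous (fun q : (T * Theta) * V => f q.1).
  by move=> cf; apply: continuous_then cf; exact: continuous_fst.
have csnd : continuous (fun q : (T * Theta) * V => q.2) by exact: continuous_snd.
rewrite (_ : mkset _ = \bigcap_(i in [set: 'I_m]) [set p : T * Theta | body p.1 (p.2.1.1 0 i)] `&`
  \bigcap_(i in [set: 'I_m]) [set p : T * Theta | body p.1 (p.2.1.2 0 i)] `&`
  \bigcap_(i in [set: 'I_m]) [set p : T * Theta | forall w, body p.1 w ->
    [set q : (T * Theta) * V | dotp (q.1.2.2 0 i) q.2 <= dotp (q.1.2.2 0 i) (q.1.2.1.1 0 i)] (p, w)] `&`
  \bigcap_(i in [set: 'I_m]) [set p : T * Theta |
    dotp (p.2.2 0 i) (p.2.1.2 0 i) <= dotp (p.2.2 0 i) (p.2.1.1 0 i) - e] `&`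
  \bigcap_(ij in [set ij : 'I_m * 'I_m | ij.1 != ij.2]) [set p : T * Theta |
    forall w, body p.1 w -> [set q : (T * Theta) * V | body q.1.1
      (2^-1 *: (q.1.2.1.1 0 ij.1 + q.1.2.1.1 0 ij.2) +
       e *: (2^-1 *: (q.1.2.1.1 0 ij.1 + q.1.2.1.1 0 ij.2) - q.2))] (p, w)]); last first.
  apply/seteqP; split=> [[K t] [/= H1 H2 H3 H4 H5]|[K t] /= [[[[H1 H2] H3] H4] H5]].
    by do !split => //=; [move=> i _; exact: H1|move=> i _; exact: H2|
      move=> i _ w; exact: H3|move=> i _; exact: H4|move=> [i j] /= ij w; exact: H5].
  by split=> /= [i|i|i w|i|i j ij w]; [exact: H1|exact: H2|exact: H3|exact: H4|
    exact: (H5 (i, j))].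
apply: closedI; [apply: closedI; [apply: closedI; [apply: closedI|]|]|].
- by apply: closed_bigI => i _; exact: closed_mem.
- by apply: closed_bigI => i _; exact: closed_mem.
- apply: closed_bigI => i _; apply: closed_forall_mem => //.
  by apply: closed_le_fun; apply: continuous_dotp => //;
    first [exact: (fst_cont _ (cu i))|exact: (fst_cont _ (cx i))].
- apply: closed_bigI => i _; apply: closed_le_fun; first exact: continuous_dotp.
  by move=> p; apply: cvgB; [exact: continuous_dotp|exact: cvg_cst].
- apply: closed_bigI => -[i j] _; apply: closed_forall_mem => //=.
  apply: closed_mem.
    by apply: continuous_then ck; exact: continuous_fst.
  have cz : continuous (fun q : (T * Theta) * V =>
      2^-1 *: (q.1.2.1.1 0 i + q.1.2.1.1 0 j) : V).
    by move=> q; apply: cvgZr; apply: cvgD; apply: (fst_cont (fun p => p.2.1.1 0 _)).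
  move=> q; apply: cvgD; first exact: cz.
  by apply: cvgZr; apply: cvgB; [exact: cz|exact: csnd].
Qed.

(** Each family of witnesses is bounded and remains one for a smaller margin, so
    countably many bounds and margins are enough. *)
Lemma spread_borel : borel [set K : T | spread m K].
Proof.
rewrite (_ : mkset _ = \bigcup_n spread_bounded (n.+1%:R^-1) n%:R).
  by apply: borel_bigcup => n; apply: borel_closed; exact: spread_bounded_closed.
apply/seteqP; split=> [K [e [x [y [u [e0 [H1 H2 H3 H4 H5]]]]]]|K [n _ [t _ st]]]; last first.
  by exists n.+1%:R^-1, (t.1.1 0), (t.1.2 0), (t.2 0); split=> //; rewrite invr_gt0.
pose M := e^-1 + \sum_i (`|x i| + `|y i| + `|u i|).
have [n Mn] : exists n : nat, M <= n%:R.
  by exists (Num.truncn M).+1; apply: ltW; exact: truncnS_gt.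
have S0 : 0 <= \sum_i (`|x i| + `|y i| + `|u i|).
  by apply: sumr_ge0 => i _; rewrite !addr_ge0.
have SM : \sum_i (`|x i| + `|y i| + `|u i|) <= n%:R.
  by apply: le_trans Mn; rewrite /M lerDr invr_ge0 ltW.
have xyu i : `|x i| + `|y i| + `|u i| <= n%:R.
  apply: le_trans SM; rewrite (bigD1 i)//= lerDl.
  by apply: sumr_ge0 => j _; rewrite !addr_ge0.
have en : n.+1%:R^-1 <= e.
  rewrite -[leRHS]invrK lef_pV2 ?posrE ?invr_gt0//.
  by rewrite (@le_trans _ _ n%:R) ?ler_nat// (le_trans _ Mn)// /M lerDl.
exists n => //; exists (\row_i x i, \row_i y i, \row_i u i).
  split=> /=; first split=> /=; move=> i; rewrite mxE; have := xyu i;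
    have := normr_ge0 (x i); have := normr_ge0 (y i); have := normr_ge0 (u i); lra.
split=> /= [i|i|i w Kw|i|i j ij w Kw]; rewrite ?mxE//.
- exact: H3.
- by apply: le_trans (H4 i) _; rewrite lerB.
- have [_ _ cK] := bodyP K; apply: (convex_shrink cK e0) => //; first last.
    exact: H5.
    exact: (convex_mid cK (H1 i) (H1 j)).
  by rewrite en andbT invr_ge0.
Qed.

End SpreadClosed.

Section PolytopeBorel.
Context {R : realType} {d : nat}.
Local Notation V := 'rV[R]_d.
Local Notation T := (convex_body R d).

Lemma hull_compact n (x : 'I_n -> V) : compact (hull x).
Proof.
pose D := [set l : 'rV[R]_n | (forall i, 0 <= l 0 i) /\ \sum_i l 0 i = 1].
rewrite (_ : hull x = (fun l : 'rV[R]_n => \sum_i l 0 i *: x i) @` D); last first.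
  apply/seteqP; split=> [_ [l [l0 l1 ->]]|_ [l [l0 l1] <-]].
    exists (\row_i l i); last by apply: eq_bigr => i _; rewrite mxE.
    by split=> [i|]; rewrite ?mxE// -l1; apply: eq_bigr => i _; rewrite mxE.
  by exists (l 0).
apply: continuous_compact.
  apply: continuous_subspaceT; apply: continuous_sum => i.
  apply: (@continuous_then _ _ _ (fun t : R => t *: x i)); last exact: scalel_continuous.
  exact: (@coord_continuous R 1 n 0 i).
apply: bounded_closed_compact.
  exists 1; split; first exact: num_real.
  move=> N N1 l [l0 l1]; rewrite /Num.norm/= mx_normrE; apply/bigmax_leP; split=> [|[i j] _].
    by rewrite (le_trans _ (ltW N1)).
  rewrite (ord1 i) ger0_norm// (le_trans _ (ltW N1))// -l1 (bigD1 j)//= lerDl.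
  exact: sumr_ge0.
have cc i : continuous (fun l : 'rV[R]_n => l 0 i) by exact: coord_continuous.
have cs : continuous (fun l : 'rV[R]_n => \sum_i l 0 i).
  by apply: (@continuous_sum R R^o).
rewrite (_ : D = \bigcap_(i in [set: 'I_n]) [set l | 0 <= l 0 i] `&`
    ([set l | \sum_i l 0 i <= 1] `&` [set l | 1 <= \sum_i l 0 i])).
  apply: closedI; last apply: closedI.
  - by apply: closed_bigI => i _; apply: closed_le_fun => //; exact: cst_continuous.
  - by apply: closed_le_fun => //; exact: cst_continuous.
  - by apply: closed_le_fun => //; exact: cst_continuous.
apply/seteqP; split=> l /= [l0].
  by move=> l1; split=> [i _ /=|]; [exact: l0|rewrite l1].
by move=> [l1 l2]; split=> [i|]; [exact: l0|apply/eqP; rewrite eq_le l1].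
Qed.

Lemma hull_bodyP n (x : 'rV[V]_n.+1) :
  [/\ hull (x 0) !=set0, compact (hull (x 0)) & convex_set (hull (x 0))].
Proof.
split; [|exact: hull_compact|exact: hull_convex].
by exists (x 0 ord0); exact: hull_point.
Qed.

Definition hull_body n (x : 'rV[V]_n.+1) : T := ConvexBody (hull_bodyP x).

Lemma hull_body_near n (x y : 'rV[V]_n.+1) (e : R) : 0 <= e ->
  (forall i, enorm (x 0 i - y 0 i) <= e) -> hull (x 0) `<=` parallel_set (hull (y 0)) e.
Proof.
move=> e0 xy; apply: hull_sub => [|i]; last by exists (y 0 i) => //; exact: hull_point.
have /convexP cy := @hull_convex _ _ _ (y 0).
apply/convexP => a b t t01 [a' ya aa'] [b' yb bb'].
exists (t *: a' + (1 - t) *: b'); first exact: cy.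
have /andP[t0 t1] := t01.
rewrite (_ : _ - _ = t *: (a - a') + (1 - t) *: (b - b')).
  apply: le_trans (enormD _ _) _.
  have eZ (c : R) (v : V) : 0 <= c -> enorm (c *: v) = c * enorm v.
    by move=> c0; rewrite /enorm dotpZl dotpZr mulrA -expr2 sqrtrM ?sqr_ge0// sqrtr_sqr ger0_norm.
  rewrite !eZ ?subr_ge0// (_ : e = t * e + (1 - t) * e); last by ring.
  by rewrite lerD// ler_wpM2l// subr_ge0.
by apply/rowP => i; rewrite !mxE; ring.
Qed.

Lemma hull_body_continuous n : continuous (@hull_body n).
Proof.
move=> x A /nbhs_ballP[e /= e0 eA].
have e20 : 0 < e / 2 by rewrite divr_gt0.
have : \forall y \near x, forall i : 'I_n.+1, enorm (x 0 i - (y : 'rV[V]_n.+1) 0 i) <= e / 2.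
  apply: (@filter_forall _ 'I_n.+1 (fun i (y : 'rV[V]_n.+1) => enorm (x 0 i - y 0 i) <= e / 2) (nbhs x)) => i.
  apply: (@coord_continuous_mx V 1 n.+1 0 i x [set v | enorm (x 0 i - v) <= e / 2]).
  have ce : continuous (fun v : V => enorm (x 0 i - v)).
    apply: (@continuous_then _ _ _ Num.sqrt); last exact: sqrt_continuous.
    have cv : continuous (fun v : V => x 0 i - v : V).
      move=> v; apply: (@cvgB R V _ (nbhs v) _ (fun=> x 0 i) id); [exact: cvg_cst|exact: cvg_id].
    exact: continuous_dotp.
  apply: (ce (x 0 i) [set t | t <= e / 2]); rewrite subrr enorm0.
  by apply: filterS (lt_nbhsl e20) => t; exact: ltW.
apply: filterS => y xy; apply: eA => /=.
apply: le_lt_trans (_ : e / 2 < e); last by rewrite gtr_pMr// invf_lt1// ltr1n.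
apply: ge_inf; first exact: hausdorff_gaps_lb.
split; [exact: ltW|apply: hull_body_near => //; exact: ltW|].
apply: hull_body_near => [|i]; first exact: ltW.
by rewrite -enormN opprB; exact: xy.
Qed.

(** The hull depends continuously on its generators, so the hulls of [n.+1] points
    of a ball form a compact set. *)
Lemma polytope_borel : borel [set K : T | polytope K].
Proof.
pose C n (M : nat) := [set x : 'rV[V]_n.+1 | forall i, `|x 0 i| <= M%:R].
rewrite (_ : mkset _ = \bigcup_n \bigcup_M (@hull_body n @` C n M)).
  apply: borel_bigcup => n; apply: borel_bigcup => M; apply: borel_closed.
  apply: compact_closed; first exact: metric_hausdorff.
  apply: continuous_compact; last exact: compact_norm_le.
  by apply: continuous_subspaceT; exact: hull_body_continuous.
apply/seteqP; split=> [K /polytopeP[n [x KE]]|_ [n _ [M _ [x _ <-]]]]; last first.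
  by apply/polytopeP; exists n, (x 0).
pose M := \sum_i `|x i|.
have xM i : `|x i| <= M.
  by rewrite /M (bigD1 i)//= lerDl sumr_ge0.
exists n => //; exists (Num.truncn M).+1 => //; exists (\row_i x i).
  by move=> i; rewrite mxE (le_trans (xM i))// ltW// truncnS_gt.
apply: hausdorff_dist_positivity.
rewrite (_ : body (hull_body _) = body K) ?hausdorff_distxx//.
rewrite KE /=; congr hull; apply/funext => i; by rewrite mxE.
Qed.

Lemma facet_number_borel n : borel [set K : T | polytopes_with_facets n K].
Proof.
rewrite (_ : mkset _ = [set K : T | polytope K] `&`
    ([set K : T | spread n K] `\` [set K : T | spread n.+1 K])).
  by apply: borelI; [exact: polytope_borel|apply: borelD; exact: spread_borel].
apply/seteqP; split=> K /=; first by move=> /polytopes_with_facetsP[].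
by move=> [pK [sK nK]]; apply/polytopes_with_facetsP.
Qed.

Lemma centred_space_borel : borel (@centred_space R d).
Proof.
apply: borel_closed.
have c11 : continuous (fun y : (V * R) * T => y.1.1).
  by apply: (@continuous_then _ _ _ fst); exact: continuous_fst.
have : closed [set 0 : V] by apply: compact_closed; [exact: norm_hausdorff|exact: compact_set1].
by move/continuous_closedP: c11; apply.
Qed.

Definition centred_with_facets n : set ((V * R) * T) :=
  @centred_space R d `&` [set y | polytopes_with_facets n (body y.2)].

Lemma centred_with_facets_borel n : borel (centred_with_facets n).
Proof.
apply: borelI; first exact: centred_space_borel.
exact: (borel_preimage (@continuous_snd _ _) (facet_number_borel n)).
Qed.

End PolytopeBorel.

(** * The intensity of boxes and of regions below paraboloids *)

(** The integral of a nonnegative function is a supremum over the simple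
    functions below it, whence monotonicity without measurability: the numbers of
    typical points and the inner integrals below come without a proof of it. *)
Lemma ge0_integral_mono d (T : measurableType d) (R : realType)
    (mu : {measure set T -> \bar R}) (D : set T) (f g : T -> \bar R) :
  (forall x, D x -> 0 <= f x)%E -> (forall x, D x -> f x <= g x)%E ->
  (\int[mu]_(x in D) f x <= \int[mu]_(x in D) g x)%E.
Proof.
move=> f0 fg; rewrite !(integral_mkcond D) !ge0_integralTE; last 2 first.
- by move=> x; apply: erestrict_ge0 => t Dt; apply: le_trans (fg t Dt); exact: f0.
- by move=> x; apply: erestrict_ge0.
apply: le_ereal_sup => _ [h hf <-]; exists h => //.
by move=> x; apply: le_trans (hf x) _; exact: lee_restrict.
Qed.

Section PowerIntegrals.
Context {R : realType}.
Notation leb := (@lebesgue_measure R).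
Implicit Types (a c s p x t : R).

Lemma powR_opp_cvg0 c p : 0 < p -> (x + c) `^ (- p) @[x --> +oo] --> (0 : R).
Proof.
move=> p0; apply/cvgrPdist_le => /= e e0; near=> x.
have pe : 0 < e `^ (- p^-1) by rewrite powR_gt0.
have xc : e `^ (- p^-1) <= x + c.
  by rewrite -lerBlDr; near: x; apply: nbhs_pinfty_ge; exact: num_real.
rewrite sub0r normrN ger0_norm ?powR_ge0// powRN.
rewrite -[leRHS]invrK lef_pV2 ?posrE ?powR_gt0 ?invr_gt0//; last exact: lt_le_trans xc.
have -> : e^-1 = (e `^ (- p^-1)) `^ p.
  by rewrite -powRrM mulNr mulVf ?gt_eqF// powR_inv1// ltW.
by apply: ge0_ler_powR => //; rewrite ?nnegrE ltW//; exact: lt_le_trans xc.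
Unshelve. all: by end_near. Qed.

Lemma is_derive_powR_shift c p x : 0 < x + c ->
  is_derive x 1 (fun y => (y + c) `^ p) (p * (x + c) `^ (p - 1)).
Proof.
move=> xc; rewrite -[X in is_derive _ _ _ X]mulr1.
have -> : (fun y : R => (y + c) `^ p) = (fun z : R => z `^ p) \o (fun y : R => y + c) by [].
apply: is_derive1_comp; first exact: is_derive1_powR.
have := is_deriveD (is_derive_id x (1 : R)) (is_derive_cst c x (1 : R)).
by rewrite addr0.
Qed.

Lemma is_derive_continuous_at (f : R -> R) x df : is_derive x 1 f df -> f y @[y --> x] --> f x.
Proof.
by move=> [fx _]; apply: differentiable_continuous; exact/derivable1_diffP.
Qed.

Lemma power_tail c s p : 0 < s + c -> 1 < p ->
  (\int[leb]_(x in `[s, +oo[) ((x + c) `^ (- p))%:E =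
   ((s + c) `^ (1 - p) / (p - 1))%:E)%E.
Proof.
move=> sc p1; have p10 : p - 1 != 0 by rewrite subr_eq0 gt_eqF.
pose F x := - (p - 1)^-1 * (x + c) `^ (1 - p).
have FD x : s <= x -> is_derive x 1 F ((x + c) `^ (- p)).
  move=> sx; have xc : 0 < x + c by apply: lt_le_trans sc _; rewrite lerD2r.
  have -> : (x + c) `^ (- p) = - (p - 1)^-1 *: ((1 - p) * (x + c) `^ (1 - p - 1)).
    rewrite /GRing.scale/= mulrA (_ : - (p - 1)^-1 * (1 - p) = 1); last by field.
    by rewrite mul1r; congr powR; ring.
  exact/is_deriveZ/is_derive_powR_shift.
rewrite (@ge0_continuous_FTC2y _ _ F s 0).
- by rewrite sub0e -EFinN /F mulNr opprK mulrC.
- by move=> x _; exact: powR_ge0.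
- apply/continuous_within_itvcyP; split.
    move=> x; rewrite in_itv/= andbT => sx.
    have xc : 0 < x + c by apply: lt_trans sc _; rewrite ltrD2r.
    exact: (is_derive_continuous_at (is_derive_powR_shift (- p) xc)).
  apply: cvg_at_right_filter.
  exact: (is_derive_continuous_at (is_derive_powR_shift (- p) sc)).
- rewrite -[X in _ --> X](mulr0 (- (p - 1)^-1)); apply: cvgMr.
  by rewrite -opprB; apply: powR_opp_cvg0; rewrite subr_gt0.
- by move=> x sx; have [] := FD x (ltW sx).
- by apply: cvg_at_right_filter; exact: (is_derive_continuous_at (FD s (lexx s))).
- move=> x; rewrite in_itv/= andbT => sx; rewrite derive1E.
  by have [_ ->] := FD x (ltW sx).
Qed.

(** A profile on the line, integrable for [1 < p], whose products dominate the
    powers of the Euclidean distance. *)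
Definition bump p a t : R := (1 + `|t - a|) `^ (- p).

Lemma bump_ge0 p a t : 0 <= bump p a t.
Proof. exact: powR_ge0. Qed.

Lemma bump_continuous p a : continuous (bump p a).
Proof.
move=> t; rewrite /bump.
have p0 : 0 < 1 + `|t - a| by rewrite ltr_pwDl.
apply: (@cvg_comp _ _ _ (fun t : R => 1 + `|t - a|) (fun z : R => z `^ (- p)) _
    (nbhs (1 + `|t - a|))).
  apply: cvgD; first exact: cvg_cst.
  by apply: cvg_norm; apply: cvgB; [exact: cvg_id|exact: cvg_cst].
exact: (is_derive_continuous_at (is_derive1_powR (- p) p0)).
Qed.

Lemma bump_measurable p a : measurable_fun [set: R] (bump p a).
Proof. by apply: continuous_measurable_fun; exact: bump_continuous. Qed.

Lemma integral_bump p a : 1 < p ->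
  (\int[leb]_(t in [set: R]) (bump p a t)%:E <= (2 / (p - 1))%:E)%E.
Proof.
move=> p1.
have mb D : measurable_fun D (fun t => (bump p a t)%:E).
  by apply/measurable_EFinP; apply: measurable_funS (bump_measurable p a).
have b0 t : (0 <= (bump p a t)%:E)%E by rewrite lee_fin bump_ge0.
rewrite -(@setUv _ `[a, +oo[) ge0_integral_setU//=; last 3 first.
- exact: measurableC.
- exact: mb.
- by apply/disj_set2P; rewrite setICr.
have H1 : (\int[leb]_(t in `[a, +oo[) (bump p a t)%:E = (p - 1)^-1%:E)%E.
  transitivity (\int[leb]_(t in `[a, +oo[) ((t + (1 - a)) `^ (- p))%:E)%E.
    apply: eq_integral => t; rewrite inE/= in_itv/= andbT => at_.
    by rewrite /bump ger0_norm ?subr_ge0//; congr (_ `^ _)%:E; ring.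
  rewrite power_tail//; last by rewrite addrCA subrr addr0.
  by rewrite addrCA subrr addr0 powR1 mul1r.
have H2 : (\int[leb]_(t in ~` `[a, +oo[) (bump p a t)%:E <= (p - 1)^-1%:E)%E.
  apply: (@le_trans _ _ (\int[leb]_(t in `]-oo, (- - a)%R]) (bump p a t)%:E)%E).
    rewrite opprK; apply: ge0_subset_integral => //; [exact: measurableC|exact: mb|].
    by move=> t /=; rewrite !in_itv/= andbT => /negP; rewrite -ltNge => /ltW.
  rewrite ge0_integration_by_substitutionNy; last 2 first.
  - by apply: continuous_subspaceT; exact: bump_continuous.
  - by move=> t _; exact: bump_ge0.
  rewrite (_ : (\int[_]_(x in _) _)%E =
      (\int[leb]_(t in `[(- a)%R, +oo[) ((t + (1 + a)) `^ (- p))%:E)%E); last first.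
    apply: eq_integral => t; rewrite inE/= in_itv/= andbT => at_.
    rewrite /bump -normrN opprB opprK ger0_norm; last by rewrite addrC -lerBlDr sub0r.
    by congr (_ `^ _)%:E; ring.
  rewrite power_tail//; last by rewrite addrCA addNr addr0.
  by rewrite addrCA addNr addr0 powR1 mul1r.
apply: (@le_trans _ _ ((p - 1)^-1%:E + (p - 1)^-1%:E)%E); first by rewrite leeD// H1.
by rewrite -EFinD lee_fin mulr_natl mulr2n.
Qed.

(** The square of each coordinate of v - c is at most the squared norm, so the
    exponent can be shared out evenly among the coordinates.  Each of them gets
    the exponent 2 (b - 1) / d, and the product is integrable if it exceeds 1. *)
Lemma radial_bump (d : nat) (b : R) (v c : 'rV[R]_d.+1) : 1 < b ->
  (1 + dotp (v - c) (v - c)) `^ (1 - b) <=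
  2 `^ (b - 1) * \prod_i bump (2 * (b - 1) / d.+1%:R) (c 0 i) (v 0 i).
Proof.
move=> b1; set q := dotp _ _; set p := _ / _.
have q0 : 0 <= q by exact: dotp_ge0.
have q1 : 0 < 1 + q by rewrite ltr_pwDl.
have p0 : 0 <= p by rewrite divr_ge0// mulr_ge0// subr_ge0 ltW.
pose S := (2 * (1 + q)) `^ 2^-1.
have S0 : 0 < S by rewrite powR_gt0// mulr_gt0.
have key i : S `^ (- p) <= bump p (c 0 i) (v 0 i).
  rewrite /bump; set t := `|_|.
  have t0 : 0 <= t by exact: normr_ge0.
  have tq : t ^+ 2 <= q.
    have /= := enorm_coord (v - c) i; rewrite !mxE -/t => te.
    by rewrite /q -enorm_sqr ler_sqr ?nnegrE ?enorm_ge0.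
  have tS : 1 + t <= S.
    rewrite /S powR12_sqrt; last by rewrite mulr_ge0// ltW.
    rewrite -(@ger0_norm _ (1 + t)) ?addr_ge0// -sqrtr_sqr ler_sqrt ?mulr_ge0 ?(ltW q1)//.
    by have := sqr_ge0 (1 - t); nra.
  rewrite !powRN lef_pV2 ?posrE ?powR_gt0// ?ltr_pwDl//.
  by apply: ge0_ler_powR => //; rewrite nnegrE ?addr_ge0// ltW.
  by rewrite mulr_gt0.
have -> : (1 + q) `^ (1 - b) = 2 `^ (b - 1) * (S `^ (- p)) ^+ d.+1.
  rewrite -powR_mulrn ?powR_ge0// -!powRrM.
  have -> : 2^-1 * (- p * d.+1%:R) = 1 - b.
    by rewrite /p mulNr divfK ?pnatr_eq0//; field.
  rewrite powRM ?ltW// mulrA -powRD; last by rewrite pnatr_eq0 implybT.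
  by rewrite (_ : b - 1 + (1 - b) = 0) ?powRr0 ?mul1r//; ring.
rewrite ler_wpM2l ?powR_ge0//.
rewrite -[X in _ ^+ X]card_ord -prodr_const; apply: ler_prod => i _.
by rewrite powR_ge0 key.
Qed.

End PowerIntegrals.

Section IteratedIntegral.
Context {R : realType}.
Notation leb := (@lebesgue_measure R).

Lemma integral_rV_ge0 (d : nat) (f : 'rV[R]_d -> \bar R) :
  (forall v, 0 <= f v)%E -> (0 <= integral_rV f)%E.
Proof.
elim: d f => [|d IH] f f0 //=.
by apply: integral_ge0 => t _; apply: IH.
Qed.

Lemma integral_rV_le (d : nat) (f g : 'rV[R]_d -> \bar R) :
  (forall v, 0 <= f v)%E -> (forall v, f v <= g v)%E ->
  (integral_rV f <= integral_rV g)%E.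
Proof.
elim: d f g => [|d IH] f g f0 fg //=.
apply: ge0_integral_mono => /= t _; last by apply: IH.
by apply: integral_rV_ge0.
Qed.

Lemma integral_rV_prod (d : nat) (a : R) (phi : 'I_d -> R -> R) (I : 'I_d -> R) :
  0 <= a -> (forall i t, 0 <= phi i t) -> (forall i, measurable_fun [set: R] (phi i)) ->
  (forall i, \int[leb]_(t in [set: R]) (phi i t)%:E = (I i)%:E)%E ->
  integral_rV (fun v => (a * \prod_i phi i (v 0 i))%:E) = (a * \prod_i I i)%:E.
Proof.
elim: d a phi I => [|d IH] a phi I a0 phi0 mphi phiI /=; first by rewrite !big_ord0.
transitivity (\int[leb]_(t in [set: R])
    ((a * \prod_i I (lift ord0 i))%:E * (phi ord0 t)%:E))%E.
  apply: eq_integral => t _.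
  rewrite -[RHS]EFinM -mulrA [_ * phi _ _]mulrC mulrA.
  rewrite -(IH (a * phi ord0 t) (fun i => phi (lift ord0 i)) (fun i => I (lift ord0 i)))//; last by rewrite mulr_ge0.
  congr integral_rV; apply/funext => v; rewrite big_ord_recl mulrA; congr (_ * _ * _)%:E.
    congr (phi _ _); rewrite (_ : ord0 = lshift d (ord0 : 'I_1) :> 'I_(1 + d)).
      by transitivity ((t%:M : 'M[R]_1) 0 ord0); [exact: row_mxEl|rewrite mxE].
    exact: val_inj.
  apply: eq_bigr => i _; congr (phi _ _).
  by rewrite (_ : lift ord0 i = rshift 1 i :> 'I_(1 + d)); [exact: row_mxEr|exact: val_inj].
have I0 i : 0 <= I i.
  by rewrite -lee_fin -phiI; apply: integral_ge0 => t _; rewrite lee_fin.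
rewrite ge0_integralZl//.
- by rewrite phiI -EFinM big_ord_recl; congr EFin; ring.
- by apply/measurable_EFinP; exact: mphi.
- by move=> t _; rewrite lee_fin.
- by rewrite lee_fin mulr_ge0// prodr_ge0.
Qed.

End IteratedIntegral.

Section Intensity.
Context {R : realType}.
Variables (d : nat) (gamma beta : R).
Notation leb := (@lebesgue_measure R).
Local Notation point := ('rV[R]_d * R)%type.
Variable kappa : R.
Hypothesis kappaE : gamma * c_beta' d beta = kappa.
Hypothesis kappa_ge0 : 0 <= kappa.
Local Notation mu := (@mu_beta' R d gamma beta).

Lemma intensity_integrand_ge0 (B : set point) v h :
  (0 <= (gamma * c_beta' d beta * (- h) `^ (- beta) * \1_B (v, h))%:E)%E.
Proof.
by rewrite lee_fin kappaE mulr_ge0// mulr_ge0// powR_ge0.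
Qed.

Lemma mu_ge0 B : (0 <= mu B)%E.
Proof.
apply: integral_rV_ge0 => v; apply: integral_ge0 => h _.
exact: intensity_integrand_ge0.
Qed.

Definition cbox (a : 'rV[R]_d) (k delta : R) : set point :=
  [set y : point | (forall i, `|y.1 0 i - a 0 i| <= delta) /\ `|y.2 - k| <= delta].

Definition slab (c e : R) : set R := `[c - e, c + e].

Lemma slabE (c e t : R) : \1_(slab c e) t = ((`|t - c| <= e)%R)%:R :> R.
Proof.
rewrite indicE; have -> // : (t \in slab c e) = (`|t - c| <= e).
by apply/idP/idP; rewrite inE /slab/= in_itv/= ler_norml; lra.
Qed.

Lemma integral_slab (c e : R) : 0 <= e ->
  (\int[leb]_(t in [set: R]) (\1_(slab c e) t)%:E = (2 * e)%:E)%E.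
Proof.
move=> e0; rewrite integral_indic//= ?setIT; last exact: measurable_itv.
rewrite /slab lebesgue_measure_itv/= lte_fin.
case: ltP => [_|]; first by rewrite -EFinB; congr EFin; ring.
by move=> ce; congr EFin; lra.
Qed.

(** On a box below the height -1 the density lies between its value at the bottom
    of the box and [kappa]. *)
Lemma mu_cbox a k delta : 0 <= delta -> k + delta <= - 1 -> 0 <= beta ->
  exists r : R, mu (cbox a k delta) = r%:E /\
    kappa * (delta - k) `^ (- beta) * (2 * delta) ^+ d.+1 <= r <= kappa * (2 * delta) ^+ d.+1.
Proof.
move=> e0 ke b0.
have indB v h : \1_(cbox a k delta) (v, h) =
    (\prod_i \1_(slab (a 0 i) delta) (v 0 i)) * \1_(slab k delta) h :> R.
  have [hk|hk] := boolP (`|h - k| <= delta); last first.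
    rewrite [\1_(slab k delta) h]slabE (negbTE hk) mulr0 indicE memNset//.
    by move=> -[_ /= hk']; rewrite hk' in hk.
  rewrite [\1_(slab k delta) h]slabE hk mulr1.
  have [va|/existsNP[i vi]] := pselect (forall i, `|v 0 i - a 0 i| <= delta).
    by rewrite indicE mem_set// big1// => i _; rewrite slabE va.
  rewrite indicE memNset; last by move=> -[va _]; exact: (vi (va i)).
  by have /negP/negbTE nvi := vi; rewrite (bigD1 i)//= slabE nvi mul0r.
have slab_neg : slab k delta `<=` `]-oo, 0%R[.
  move=> h; rewrite /slab/= !in_itv/= => /andP[_ hk]; rewrite (le_lt_trans hk)//.
  by rewrite (le_lt_trans ke).
have inner_slab (m : R) : 0 <= m ->
  (\int[leb]_(h in `]-oo, 0%R[) (m * \1_(slab k delta) h)%:E = (m * (2 * delta))%:E)%E.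
  move=> m0; under eq_integral do rewrite EFinM.
  rewrite ge0_integralZl//.
  - rewrite integral_indic//=; last exact: measurable_itv.
    rewrite setIidl// EFinM; congr (_ * _)%E.
    by rewrite -(@integral_slab k)// integral_indic ?setIT//; exact: measurable_itv.
  - by apply/measurable_EFinP; apply: measurable_indic; exact: measurable_itv.
have bound h : h \in slab k delta -> (delta - k) `^ (- beta) <= (- h) `^ (- beta) <= 1.
  rewrite inE /slab/= in_itv/= => /andP[h1 h2].
  have h3 : 1 <= - h by lra.
  rewrite !powRN; apply/andP; split.
    rewrite lef_pV2 ?posrE ?powR_gt0//; [|lra|lra].
    by apply: ge0_ler_powR => //; rewrite ?nnegrE; lra.
  rewrite invf_le1 ?powR_gt0//; last lra.
  by rewrite -[leLHS](powRr0 (- h)); apply: ler_powR.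
have prod0 (v : 'rV[R]_d) : 0 <= \prod_i (\1_(slab (a 0 i) delta) (v 0 i) : R).
  by apply: prodr_ge0.
have upper : (mu (cbox a k delta) <= (kappa * (2 * delta) ^+ d.+1)%:E)%E.
  rewrite (_ : kappa * _ = (kappa * (2 * delta)) * \prod_(i < d) (2 * delta)); last first.
    by rewrite prodr_const card_ord exprS mulrA.
  rewrite -(@integral_rV_prod _ _ _ (fun i => \1_(slab (a 0 i) delta)))//; last 3 first.
  - by rewrite !mulr_ge0.
  - by move=> i; apply: measurable_indic; exact: measurable_itv.
  - by move=> i; exact: integral_slab.
  apply: integral_rV_le => v.
    by apply: integral_ge0 => h _; exact: intensity_integrand_ge0.
  set q := \prod_i _; have q0 : 0 <= q by exact: prod0.
  rewrite (_ : _ * q = kappa * q * (2 * delta)); last by ring.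
  rewrite -inner_slab ?mulr_ge0//; apply: ge0_integral_mono => // h _.
    exact: intensity_integrand_ge0.
  rewrite lee_fin indB -/q kappaE.
  rewrite [leLHS](_ : _ = kappa * q * ((- h) `^ (- beta) * \1_(slab k delta) h)); last by ring.
  rewrite ler_wpM2l ?mulr_ge0//.
  have [hk|hk] := boolP (h \in slab k delta); last by rewrite indicE (negbTE hk) mulr0.
  by rewrite indicE hk mulr1; have /andP[] := bound h hk.
have lower : ((kappa * (delta - k) `^ (- beta) * (2 * delta) ^+ d.+1)%:E <=
    mu (cbox a k delta))%E.
  rewrite (_ : kappa * _ * _ = (kappa * (delta - k) `^ (- beta) * (2 * delta)) * \prod_(i < d) (2 * delta)); last first.
    by rewrite prodr_const card_ord exprS; ring.
  rewrite -(@integral_rV_prod _ _ _ (fun i => \1_(slab (a 0 i) delta)))//; last 3 first.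
  - by rewrite !mulr_ge0// powR_ge0.
  - by move=> i; apply: measurable_indic; exact: measurable_itv.
  - by move=> i; exact: integral_slab.
  apply: integral_rV_le => v.
    by rewrite lee_fin mulr_ge0// !mulr_ge0// powR_ge0.
  set q := \prod_i _; have q0 : 0 <= q by exact: prod0.
  rewrite (_ : _ * q = kappa * (delta - k) `^ (- beta) * q * (2 * delta)); last by ring.
  rewrite -inner_slab ?mulr_ge0// ?powR_ge0//; apply: ge0_integral_mono => // h _.
    by rewrite lee_fin !mulr_ge0// powR_ge0.
  rewrite lee_fin indB -/q kappaE.
  rewrite [leLHS](_ : _ = kappa * q * ((delta - k) `^ (- beta) * \1_(slab k delta) h)); last by ring.
  rewrite [leRHS](_ : _ = kappa * q * ((- h) `^ (- beta) * \1_(slab k delta) h)); last by ring.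
  rewrite ler_wpM2l ?mulr_ge0//.
  have [hk|hk] := boolP (h \in slab k delta); last by rewrite indicE (negbTE hk) !mulr0.
  by rewrite indicE hk !mulr1; have /andP[] := bound h hk.
have fin : mu (cbox a k delta) \is a fin_num.
  rewrite ge0_fin_numE ?mu_ge0//; apply: le_lt_trans upper _; exact: ltry.
exists (fine (mu (cbox a k delta))); rewrite fineK//; split=> //.
by rewrite -!lee_fin fineK// lower.
Qed.

End Intensity.

Section IntensityTail.
Context {R : realType}.
Variables (d : nat) (gamma beta : R).
Notation leb := (@lebesgue_measure R).
Local Notation point := ('rV[R]_d.+1 * R)%type.
Variable kappa : R.
Hypothesis kappaE : gamma * c_beta' d.+1 beta = kappa.
Hypothesis kappa_ge0 : 0 <= kappa.
Hypothesis beta_gt : d.+1%:R / 2 + 1 < beta.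
Local Notation mu := (@mu_beta' R d.+1 gamma beta).

(** Only the sites of this region can have a small power near [c]. *)
Definition below_paraboloid (lam : R) (c : 'rV[R]_d.+1) : set point :=
  [set y : point | y.2 < - (lam * (1 + dotp (y.1 - c) (y.1 - c)))].

(** Integration over the heights leaves a power of 1 + |v - c'|^2, with c' the
    nearest of the [m] apices, and [radial_bump] makes it integrable.  As
    the apices are on a line, only one factor of the product has to be
    summed over them, so that the bound is linear in [m]. *)
Lemma mu_below_paraboloids (lam : R) : 0 < lam -> exists2 C : R, 0 <= C &
  forall (m : nat) (c : 'rV[R]_d.+1) (B : set point),
  B `<=` \bigcup_(i < m) below_paraboloid lam (c + i%:R *: delta_mx 0 ord0) ->
  (mu B <= (C * m%:R)%:E)%E.
Proof.
move=> lam0; have b1 : 1 < beta.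
  by apply: le_lt_trans beta_gt; rewrite lerDr divr_ge0.
pose p := 2 * (beta - 1) / d.+1%:R.
have p1 : 1 < p.
  rewrite /p ltr_pdivlMr// mul1r.
  have : d.+1%:R / 2 < beta - 1 by rewrite ltrBrDr.
  by rewrite ltr_pdivrMr// mulrC.
pose C1 := kappa / (beta - 1) * lam `^ (1 - beta) * 2 `^ (beta - 1).
have C10 : 0 <= C1.
  by rewrite /C1 mulr_ge0 ?powR_ge0// mulr_ge0 ?powR_ge0// divr_ge0// subr_ge0 ltW.
exists (C1 * (2 / (p - 1)) ^+ d.+1).
  by rewrite mulr_ge0// exprn_ge0// divr_ge0// subr_ge0 ltW.
move=> m c B BT.
pose phi (k : 'I_d.+1) (t : R) := if k == ord0 then \sum_(i < m) bump p (c 0 ord0 + i%:R) t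
  else bump p (c 0 k) t.
have phi0 k t : 0 <= phi k t.
  by rewrite /phi; case: ifP => _; rewrite ?sumr_ge0// => *; exact: bump_ge0.
have mphi k : measurable_fun [set: R] (phi k).
  rewrite /phi; case: (k == ord0); last exact: bump_measurable.
  by apply: measurable_sum => i; exact: bump_measurable.
have Ifin k : exists r : R, (\int[leb]_(t in [set: R]) (phi k t)%:E = r%:E)%E /\
    0 <= r <= (if k == ord0 then m%:R else 1) * (2 / (p - 1)).
  have I0 : (0 <= \int[leb]_(t in [set: R]) (phi k t)%:E)%E.
    by apply: integral_ge0 => t _; rewrite lee_fin.
  have Iub : (\int[leb]_(t in [set: R]) (phi k t)%:E <=
      ((if k == ord0 then m%:R else 1) * (2 / (p - 1)))%:E)%E.
    rewrite /phi; case: (k == ord0); last by rewrite mul1r; exact: integral_bump.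
    under eq_integral do rewrite -sumEFin.
    rewrite ge0_integral_sum//; last 2 first.
    - by move=> i; apply/measurable_EFinP; exact: bump_measurable.
    - by move=> i t _; rewrite lee_fin bump_ge0.
    apply: (@le_trans _ _ (\sum_(i < m) (2 / (p - 1))%:E)%E).
      by apply: lee_sum => i _; exact: integral_bump.
    rewrite (_ : (\sum_(i < m) _)%R = (\sum_(i < m) (2 / (p - 1)))%:E); last exact: sumEFin.
    suff -> : \sum_(i < m) (2 / (p - 1)) = m%:R * (2 / (p - 1)) by [].
    by rewrite sumr_const card_ord [RHS]mulr_natl.
  have fin : (\int[leb]_(t in [set: R]) (phi k t)%:E)%E \is a fin_num.
    by rewrite ge0_fin_numE//; apply: le_lt_trans Iub _; exact: ltry.
  exists (fine (\int[leb]_(t in [set: R]) (phi k t)%:E)%E); rewrite fineK//; split=> //.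
  by rewrite -!lee_fin fineK// I0.
have [I IP] := choice Ifin.
apply: (@le_trans _ _ (integral_rV (fun v => (C1 * \prod_k phi k (v 0 k))%:E))).
  apply: integral_rV_le => v.
    by apply: integral_ge0 => h _; exact: (intensity_integrand_ge0 kappaE kappa_ge0).
  have [[i0 i0m]|none] := pselect (exists i, (i < m)%N /\
      forall j, (j < m)%N -> dotp (v - (c + i%:R *: delta_mx 0 ord0)) (v - (c + i%:R *: delta_mx 0 ord0))
        <= dotp (v - (c + j%:R *: delta_mx 0 ord0)) (v - (c + j%:R *: delta_mx 0 ord0))); last first.
    rewrite (_ : (\int[_]_(h in _) _)%E = 0%E).
      by rewrite lee_fin mulr_ge0// prodr_ge0.
    apply: integral0_eq => h _; rewrite indicE memNset ?mulr0// => /BT[i /= im _].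
    apply: none.
    have m0 : (0 < m)%N by exact: leq_ltn_trans im.
    pose i1 : 'I_m := Ordinal im.
    pose f (j : 'I_m) := dotp (v - (c + j%:R *: delta_mx 0 ord0)) (v - (c + j%:R *: delta_mx 0 ord0)).
    have [j _ jmin] := @arg_minP _ _ _ i1 xpredT f isT.
    exists j; split=> // k km; exact: (jmin (Ordinal km)).
  case: i0m => i0m imin.
  set ci := c + i0%:R *: delta_mx 0 ord0.
  pose q := dotp (v - ci) (v - ci).
  have q0 : 0 <= q by exact: dotp_ge0.
  pose s := lam * (1 + q).
  have s0 : 0 < s by rewrite mulr_gt0// ltr_pwDl.
  apply: (@le_trans _ _ (kappa * (s `^ (1 - beta) / (beta - 1)))%:E).
    pose A : set R := `]-oo, - s]%classic.
    pose G (h : R) : \bar R := (kappa%:E * ((- h) `^ (- beta))%:E)%E.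
    apply: (@le_trans _ _ (\int[leb]_(h in `]-oo, 0%R[) (G \_ A) h)%E).
      apply: ge0_integral_mono => //= h.
        by move=> _; exact: (intensity_integrand_ge0 kappaE kappa_ge0).
      move=> h0; rewrite patchE /G; case: ifPn => hs.
        by rewrite -EFinM lee_fin kappaE ler_piMr ?mulr_ge0 ?powR_ge0.
      rewrite -[leRHS]/(0%:E) lee_fin indicE memNset ?mulr0// => /BT[j /= jm].
      rewrite /below_paraboloid/= => hj.
      move/negP: hs; apply; rewrite /A inE/= in_itv/= (le_trans (ltW hj))// lerN2.
      by rewrite ler_wpM2l ?(ltW lam0)// lerD2l; exact: imin.
    rewrite -integral_mkcondr setIidr /G /A; last first.
      move=> h; rewrite /= !in_itv/= => /le_lt_trans; apply.
      by rewrite oppr_lt0.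
    have contp : {within `]-oo, - s], continuous (fun h => (- h) `^ (- beta))}.
      apply: continuous_in_subspaceT => h; rewrite inE/= in_itv/= => hs.
      have h0 : 0 < - h by rewrite oppr_gt0 (le_lt_trans hs)// oppr_lt0.
      apply: (@cvg_comp _ _ _ -%R (fun z : R => z `^ (- beta)) _ (nbhs (- h))).
        exact: opp_continuous.
      exact: (is_derive_continuous_at (is_derive1_powR (- beta) h0)).
    rewrite ge0_integralZl//; last 2 first.
    - by apply/measurable_EFinP; apply: subspace_continuous_measurable_fun.
    - by move=> h _; rewrite lee_fin powR_ge0.
    rewrite ge0_integration_by_substitutionNy//; last by move=> h _; exact: powR_ge0.
    rewrite (_ : (\int[_]_(x in _) _)%E = (\int[leb]_(x in `[s, +oo[) ((x + 0) `^ (- beta))%:E)%E).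
      by rewrite power_tail ?addr0// -EFinM.
    by apply: eq_integral => h _; rewrite /= opprK addr0.
  rewrite lee_fin.
  have -> : kappa * (s `^ (1 - beta) / (beta - 1)) =
      kappa / (beta - 1) * lam `^ (1 - beta) * (1 + q) `^ (1 - beta).
    by rewrite /s powRM ?ltW// ?ltr_pwDl//; ring.
  rewrite /C1 -[leRHS]mulrA ler_wpM2l//.
    by rewrite mulr_ge0 ?powR_ge0// divr_ge0// subr_ge0 ltW.
  apply: le_trans (radial_bump v ci b1) _; rewrite ler_wpM2l ?powR_ge0//.
  apply: ler_prod => k _; rewrite bump_ge0/= /phi -/p.
  case: ifPn => [/eqP->|k0]; rewrite /ci !mxE.
    by rewrite !eqxx mulr1 (bigD1 (Ordinal i0m))//= lerDl sumr_ge0// => *; exact: bump_ge0.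
  by rewrite (negbTE k0) andbF mulr0 addr0.
rewrite (@integral_rV_prod _ _ C1 phi I)//; last by move=> k; have [] := IP k.
rewrite lee_fin -mulrA ler_wpM2l//.
apply: (@le_trans _ _ (\prod_(k < d.+1) ((if k == ord0 then m%:R else 1) * (2 / (p - 1))))).
  by apply: ler_prod => k _; have [] := IP k.
rewrite big_split/= prodr_const card_ord mulrC ler_wpM2l ?exprn_ge0 ?divr_ge0 ?subr_ge0 ?(ltW p1)//.
by rewrite big_ord_recl big1 ?mulr1.
Qed.

End IntensityTail.

(** * The configuration of sites and its stability *)

Lemma dotp_sub_le (R : realType) (d : nat) (u v a : 'rV[R]_d) :
  dotp (u - v) (u - v) <= 2 * dotp (u - a) (u - a) + 2 * dotp (a - v) (a - v).
Proof.
have := dotp_ge0 ((u - a) - (a - v)).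
rewrite (_ : u - v = (u - a) + (a - v)); last by rewrite addrA subrK.
set x := u - a; set y := a - v; clearbody x y.
by rewrite !dotpE (dotpC y x); lra.
Qed.

Section Power.
Context {R : realType} {d : nat}.
Local Notation point := ('rV[R]_d * R)%type.

Definition power (p : point) (u : 'rV[R]_d) : R := dotp (u - p.1) (u - p.1) + p.2.

Lemma power_perturb (a : 'rV[R]_d) k delta (q : point) u : delta <= 1 ->
  cbox a k delta q ->
  `|power q u - power (a, k) u| <= delta * (2 * (\sum_i `|u 0 i - a 0 i|) + d%:R + 1).
Proof.
move=> d1 [qa qk]; rewrite /power/=.
have d0 : 0 <= delta by apply: le_trans qk.
rewrite (_ : _ - _ = \sum_i ((a 0 i - q.1 0 i) * (2 * (u 0 i - a 0 i) + (a 0 i - q.1 0 i)))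
   + (q.2 - k)); last first.
  rewrite opprD addrACA; congr (_ + _); rewrite /dotp -sumrB; apply: eq_bigr => i _.
  by rewrite !mxE; ring.
rewrite (le_trans (ler_normD _ _))// mulrDr mulr1 lerD// .
rewrite (le_trans (ler_norm_sum _ _ _))//.
rewrite (_ : 2 * _ + _ = \sum_i (2 * `|u 0 i - a 0 i| + 1)); last first.
  by rewrite big_split/= -mulr_sumr sumr_const card_ord.
rewrite mulr_sumr; apply: ler_sum => i _; rewrite normrM distrC ler_pM//.
rewrite (le_trans (ler_normD _ _))// normrM gtr0_norm// lerD2l distrC.
exact: le_trans d1.
Qed.

End Power.

Section Configuration.
Context {R : realType} (d' m : nat).
Local Notation d := d'.+2.
Local Notation V := 'rV[R]_d.
Local Notation point := (V * R)%type.
Local Notation N := (m%:R : R).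
Local Notation D := (d%:R : R).
Local Notation ex := (delta_mx 0 ord0 : V).
Local Notation ez := (delta_mx 0 ord_max : V).

Implicit Types u : V.

(** Twice the bound 9 D^3 of [cell_near_axis] on squared distances, with a margin 4
    that brings the power of the nearest roof site below -1 on the cell. *)
Definition roof_depth : R := 18 * D ^+ 3 + 4.

Variable L : R.

(** Outer normals of a simplicial cone that opens upwards, along the last
    coordinate.  Its horizontal section at height 0 has a length of order [m] in the
    first direction, and bounded sizes in the others. *)
Definition wall_normal (k : 'I_d) : V := \row_i
  if k == ord0 then (if i == ord0 then - 1 else 0)
  else if k == ord_max then (if i == ord0 then 1 else if i == ord_max then - N else N)
  else (if i == ord0 then 1 else if i == k then - N else 0).

Definition wall_height (k : 'I_d) : R := if k == ord0 then - 1 else - N.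

(** The cone is the set of the [u] with [wall k u <= 0] for all [k]. *)
Definition wall (k : 'I_d) (u : V) : R := dotp u (wall_normal k) + wall_height k.

Definition middle (i : 'I_d) : bool := (i != ord0) && (i != ord_max).

Lemma sum_coords (F : 'I_d -> R) :
  \sum_i F i = F ord0 + F ord_max + \sum_(i | middle i) F i.
Proof. by rewrite (bigD1 ord0)//= (bigD1 ord_max)//= addrA. Qed.

Lemma wall0 u : wall ord0 u = - (u 0 ord0 + 1).
Proof.
rewrite /wall /dotp sum_coords !mxE eqxx/= mulr0 big1 => [|i /andP[i0 _]].
  by rewrite /wall_height eqxx; ring.
by rewrite mxE eqxx (negbTE i0) mulr0.
Qed.

Lemma wall_max u :
  wall ord_max u = - (N - u 0 ord0 - N * (\sum_(i | middle i) u 0 i) + N * u 0 ord_max).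
Proof.
rewrite /wall /dotp sum_coords !mxE eqxx/= mulr_sumr.
rewrite (eq_bigr (fun i => N * u 0 i)) => [|i /andP[i0 im]].
  by rewrite /wall_height/= !eqxx/=; ring.
by rewrite mxE eqxx/= (negbTE i0) (negbTE im) mulrC.
Qed.

Lemma wall_middle k u : middle k -> wall k u = - (N * u 0 k + N - u 0 ord0).
Proof.
move=> mk; have /andP[k0 km] := mk.
rewrite /wall /dotp sum_coords !mxE (negbTE k0) (negbTE km)/= .
rewrite (eq_sym ord_max) (negbTE km) (bigD1 k)//= big1 => [|i /andP[/andP[i0 _] ik]].
  by rewrite !mxE (negbTE k0) (negbTE km) eqxx /wall_height (negbTE k0); ring.
by rewrite !mxE (negbTE k0) (negbTE km) (negbTE i0) (negbTE ik) mulr0.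
Qed.

Lemma wall_normal_le k i : (0 < m)%N -> `|wall_normal k 0 i| <= N.
Proof.
move=> m0; rewrite mxE; have : 1 <= N by rewrite ler1n.
by do ?case: ifP => _; rewrite ?normr0 ?normrN ?normr1 ?normr_nat// => /(le_trans ler01).
Qed.

Definition centre_site : point := (- L *: ez, - L ^+ 2).
Definition roof_site (i : 'I_m) : point := ((i : nat)%:R *: ex, - roof_depth).
Definition wall_vertex k : V := - L *: ez + 2^-1 *: wall_normal k.
Definition wall_site (k : 'I_d) : point :=
  (wall_vertex k, - dotp (wall_vertex k) (wall_vertex k) - wall_height k).

Lemma dotp_delta (u : V) i : dotp u (delta_mx 0 i) = u 0 i.
Proof.
rewrite /dotp (bigD1 i)//= big1 => [|j ji]; rewrite !mxE ?eqxx ?mulr1 ?addr0//.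
by rewrite (negbTE ji) andbF mulr0.
Qed.

Lemma power_centre u : power centre_site u = dotp u u + 2 * L * u 0 ord_max.
Proof.
rewrite /power/= !dotpE !dotp_delta (dotpC _ u) dotp_delta mxE !eqxx/=; ring.
Qed.

Lemma power_roof i u : power (roof_site i) u =
  dotp u u - 2 * i%:R * u 0 ord0 + i%:R ^+ 2 - roof_depth.
Proof.
rewrite /power/= !dotpE !dotp_delta (dotpC _ u) dotp_delta mxE !eqxx/=; ring.
Qed.

(** The sites of the walls are chosen for this: their bisectors with the centre are
    the walls of the cone, whatever [L] is. *)
Lemma power_wall k u : power (wall_site k) u = power centre_site u - wall k u.
Proof.
rewrite power_centre /power/= /wall /wall_vertex; set g := wall_normal k.
rewrite !dotpE !dotp_delta !(dotpC _ u) !(dotpC (delta_mx _ _)) !dotp_delta.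
set z := wall_height k; clearbody z g.
by field.
Qed.

(** The centre and the walls are at a distance of order [L] from the cell, and their
    powers vary by about [L] times their displacement; the powers of the roofs
    vary only with the distance to the roofs, which is bounded where it matters. *)
Definition wall_radius : R := (100 * D * L)^-1.
Definition roof_radius : R := (32 * D)^-1.

Hypothesis m_gt0 : (0 < m)%N.
Hypothesis L_large : 4 * roof_depth * N ^+ 3 <= L.

Lemma N_ge1 : 1 <= N. Proof. by rewrite ler1n. Qed.
Lemma D_ge2 : 2 <= D. Proof. by rewrite ler_nat. Qed.

Lemma roof_depth_large : 18 * D + 4 <= roof_depth /\ 76 <= roof_depth.
Proof.
have D2 := D_ge2; have D4 : 4 <= D ^+ 2 by nra.
by rewrite /roof_depth exprS; split; nra.
Qed.

Lemma L_bounds : [/\ 5 * D * N <= L, 2 * D * N ^+ 2 <= L,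
  2 * N * (N ^+ 2 + roof_depth + 1) <= L & roof_depth + N + 1 <= L].
Proof.
have N1 := N_ge1; have [r1 r2] := roof_depth_large; have D2 := D_ge2.
have N2 : N <= N ^+ 2 by rewrite expr2; nra.
have N3 : N ^+ 2 <= N ^+ 3 by rewrite exprSr; nra.
have DN : D * N <= roof_depth * N ^+ 3 / 18 by nra.
have DN2 : D * N ^+ 2 <= roof_depth * N ^+ 3 / 18 by nra.
have rN : roof_depth * N <= roof_depth * N ^+ 3 by nra.
have NN : N ^+ 3 <= roof_depth * N ^+ 3 / 76 by nra.
have rr : roof_depth <= roof_depth * N ^+ 3 by nra.
have e3 : N * N ^+ 2 = N ^+ 3 by rewrite -exprS.
have LX : 4 * (roof_depth * N ^+ 3) <= L by rewrite mulrA.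
rewrite [2 * N * _](_ : _ = 2 * (N * N ^+ 2 + roof_depth * N + N)); last by ring.
rewrite e3 -!mulrA; split; lra.
Qed.

Lemma L_gt0 : 0 < L.
Proof. by have [_ _ _] := L_bounds; have [_] := roof_depth_large; have := N_ge1; lra. Qed.

Variables (p0 : point) (pr : 'I_m -> point) (pw : 'I_d -> point).
Hypothesis p0_near : cbox (centre_site).1 (centre_site).2 wall_radius p0.
Hypothesis pr_near : forall i, cbox (roof_site i).1 (roof_site i).2 roof_radius (pr i).
Hypothesis pw_near : forall k, cbox (wall_site k).1 (wall_site k).2 wall_radius (pw k).

Lemma wall_radius_le1 : wall_radius <= 1.
Proof.
rewrite /wall_radius invf_le1; have := L_gt0; have := D_ge2; have := L_bounds => -[_ _ _];
 have [_] := roof_depth_large; have := N_ge1; nra.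
Qed.

Lemma wall_radius_perturb (a : 'rV[R]_d) k (q : point) u :
  cbox a k wall_radius q -> (forall i, `|u 0 i - a 0 i| <= 3 * L) ->
  `|power q u - power (a, k) u| <= 8^-1.
Proof.
move=> qa ua; apply: le_trans (power_perturb _ wall_radius_le1 qa) _.
have L0 := L_gt0; have D2 := D_ge2.
have S : \sum_i `|u 0 i - a 0 i| <= D * (3 * L).
  rewrite (le_trans (ler_sum _ (fun i _ => ua i)))// sumr_const card_ord.
  by rewrite -[leLHS]mulr_natl.
have [_ _ _ L4] := L_bounds; have [_ r2] := roof_depth_large; have N1 := N_ge1.
rewrite /wall_radius -ler_pdivlMl ?invr_gt0 ?mulr_gt0 ?(lt_le_trans _ D2)// invrK.
have : D <= D * L by nra.
by nra.
Qed.

Lemma centre_near u : (forall i, `|u 0 i| <= 5 * D * N) ->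
  `|power p0 u - (dotp u u + 2 * L * u 0 ord_max)| <= 8^-1.
Proof.
move=> uM; rewrite -power_centre; apply: wall_radius_perturb => // i.
have [L1 _ _ _] := L_bounds; have L0 := L_gt0.
rewrite (le_trans (ler_normB _ _))// (_ : 3 * L = L + 2 * L); last by ring.
rewrite lerD ?(le_trans (uM i))// !mxE normrM normrN (gtr0_norm L0).
by case: (_ && _); rewrite ?normr1 ?normr0; lra.
Qed.

Lemma wall_near k u : (forall i, `|u 0 i| <= 5 * D * N) ->
  `|power (pw k) u - (dotp u u + 2 * L * u 0 ord_max - wall k u)| <= 8^-1.
Proof.
move=> uM; rewrite -power_centre -power_wall; apply: wall_radius_perturb (pw_near k) _ => i.
have [L1 _ _ _] := L_bounds; have L0 := L_gt0; have N1 := N_ge1; have D2 := D_ge2.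
have gN := wall_normal_le k i m_gt0.
rewrite /= /wall_vertex; set g := wall_normal k in gN *; clearbody g; rewrite !mxE.
set e := (_ && _); have eE : (e%:R = 0 :> R) \/ (e%:R = 1 :> R) by case: e; [right|left].
have := uM i; have := gN; rewrite !ler_norml => /andP[g1 g2] /andP[u1 u2].
have NL : N <= L by nra.
by apply/andP; split; case: eE => ->; lra.
Qed.

Lemma roof_near (i : 'I_m) u X Y : `|u 0 ord0 - i%:R| <= X ->
  (forall k, k != ord0 -> `|u 0 k| <= Y) -> 0 <= Y ->
  `|power (pr i) u - (dotp u u - 2 * i%:R * u 0 ord0 + i%:R ^+ 2 - roof_depth)|
    <= (2 * X + 2 * D * Y + D + 1) / (32 * D).
Proof.
move=> uX uY Y0; rewrite -power_roof.
have D2 := D_ge2; have r1 : roof_radius <= 1 by rewrite /roof_radius invf_le1; lra.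
apply: le_trans (power_perturb _ r1 (pr_near i)) _.
rewrite mulrC ler_wpM2r ?invr_ge0 ?mulr_ge0//= lerD2r lerD2r -mulrA -mulrDr ler_wpM2l//.
rewrite (bigD1 ord0)//= !mxE mulr1 lerD//.
apply: (@le_trans _ _ (\sum_(k < d) Y)); last by rewrite sumr_const card_ord mulr_natl.
rewrite [leRHS](bigD1 ord0)//= ler_wpDl//; apply: ler_sum => k k0.
by rewrite !mxE (negbTE k0) andbF mulr0 subr0 uY.
Qed.

Definition neighbour (k : 'I_m + 'I_d) : point :=
  match k with inl i => pr i | inr k => pw k end.

Definition cell : set V := [set u | forall k, power p0 u <= power (neighbour k) u].

Lemma sum_middle_const (c : R) : \sum_(i | middle i) c = d'%:R * c.
Proof.
have := sum_coords (fun=> c); rewrite sumr_const card_ord -[c *+ _]mulr_natl => e.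
have -> : d'%:R = D - 2 by rewrite -[d in RHS]addn2 natrD addrK.
by rewrite mulrBl e; ring.
Qed.

(** The walls and the first roof bound all coordinates.  The error in the wall
    functions is controlled only in the box of half-width [5 * D * N], hence the
    restriction, which [cell_box] removes. *)
Lemma bounded_in_box u : (forall i, `|u 0 i| <= 5 * D * N) -> cell u ->
  -2 <= u 0 ord0 <= N + 1 /\ forall k, k != ord0 -> `|u 0 k| <= 3 * D.
Proof.
move=> uM Qu.
have N1 := N_ge1; have D2 := D_ge2; have L0 := L_gt0.
have [_ L2 _ _] := L_bounds; have [_ rsq1] := roof_depth_large.
have /andP[c1 c2] : - 8^-1 <= power p0 u - (dotp u u + 2 * L * u 0 ord_max) <= 8^-1.
  by rewrite -ler_norml centre_near.
have w k : wall k u <= 4^-1.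
  have := Qu (inr k) => /= Qk.
  have /andP[] : - 8^-1 <= power (pw k) u - (dotp u u + 2 * L * u 0 ord_max - wall k u) <= 8^-1.
    by rewrite -ler_norml wall_near.
  by lra.
have zN : N * u 0 ord_max <= 4^-1.
  have := Qu (inl (Ordinal m_gt0)) => /= Qk.
  have M0 : 0 <= 5 * D * N by rewrite !mulr_ge0.
  have := @roof_near (Ordinal m_gt0) u (5 * D * N) (5 * D * N).
  rewrite subr0 uM => /(_ isT (fun k _ => uM k) M0).
  rewrite ler_norml !(mulr0, mul0r, expr0n, subr0, addr0)/= => /andP[_ r].
  have b : (2 * (5 * D * N) + 2 * D * (5 * D * N) + D + 1) / (32 * D) <= D * N.
    rewrite ler_pdivrMr ?mulr_gt0 ?(lt_le_trans _ D2)//.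
    have DN : D <= D * N by nra.
    have : 2 * (D * N) <= D * (D * N) by nra.
    by nra.
  have z : 2 * L * u 0 ord_max <= D * N by move: (le_trans r b) => {r b}; lra.
  have : N * (2 * L * u 0 ord_max) <= N * (D * N) by rewrite ler_wpM2l.
  by rewrite expr2 in L2 => ?; nra.
have x1 := w ord0; rewrite wall0 in x1.
have t1 := w ord_max; rewrite wall_max in t1.
have y1 k : middle k -> - (N * u 0 k + N - u 0 ord0) <= 4^-1.
  by move=> mk; rewrite -wall_middle.
have y2 k : middle k -> - (5 / 2) <= u 0 k.
  move=> /y1 k1; rewrite -(ler_pM2l (lt_le_trans ltr01 N1)); lra.
move: t1; set S := \sum_(i | _) _ => t1.
have S1 : d'%:R * (u 0 ord0 - N - 4^-1) <= N * S.
  rewrite mulr_sumr -sum_middle_const; apply: ler_sum => k /y1; lra.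
have S2 : d'%:R * - (5 / 2) <= S.
  by rewrite -sum_middle_const; apply: ler_sum => k /y2.
have d0 : 0 <= d'%:R :> R by [].
have DE : D = d'%:R + 2 by rewrite -[d in LHS]addn2 natrD.
have x2 : u 0 ord0 <= N + 1 by rewrite leNgt; apply/negP => ?; nra.
have S3 : S <= 3 by rewrite -(ler_pM2l (lt_le_trans ltr01 N1)); lra.
split=> [|k k0]; first by rewrite x2 andbT; lra.
rewrite ler_norml DE; have [->|km] := eqVneq k ord_max.
  apply/andP; split; rewrite -(ler_pM2l (lt_le_trans ltr01 N1)); nra.
have mk : middle k by apply/andP.
have := y2 _ mk; have : u 0 k + 5 / 2 <= S + d'%:R * (5 / 2).
  rewrite -sum_middle_const -big_split/= (bigD1 k)//= lerDl.
  by apply: sumr_ge0 => i /andP[/y2]; lra.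
by move=> ? ?; apply/andP; split; lra.
Qed.

(** The error in the difference of two powers is at most 1/4, so that a wall
    function of modulus at least 1/2 has the sign of the exact one. *)
Lemma wall_decides k u : (forall i, `|u 0 i| <= 5 * D * N) ->
  (wall k u <= - 2^-1 -> power p0 u < power (pw k) u) /\
  (2^-1 <= wall k u -> power (pw k) u < power p0 u).
Proof.
move=> uM; have := centre_near uM; have := wall_near k uM.
by rewrite !ler_norml => /andP[a1 a2] /andP[b1 b2]; split=> ?; lra.
Qed.

Lemma below_roofs i u : (forall k, `|u 0 k| <= 3 / 2) -> u 0 ord0 <= 0 ->
  u 0 ord_max <= - 2^-1 -> power p0 u < power (pr i) u.
Proof.
move=> u2 x0 z0; have N1 := N_ge1; have D2 := D_ge2.
have L0 := L_gt0; have [_ _ _ L4] := L_bounds.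
have : `|power p0 u - (dotp u u + 2 * L * u 0 ord_max)| <= 8^-1.
  by apply: centre_near => k; rewrite (le_trans (u2 k))//; nra.
have iN : i%:R <= N by rewrite ler_nat ltnW.
have xi : `|u 0 ord0 - i%:R| <= 3 / 2 + N.
  by rewrite (le_trans (ler_normB _ _))// normr_nat lerD.
have Y0 : (0 : R) <= 3 / 2 by [].
have := roof_near xi (fun k _ => u2 k) Y0; set b := (X in _ <= X).
have b1 : b <= N.
  rewrite /b ler_pdivrMr ?mulr_gt0 ?(lt_le_trans _ D2)//.
  have : 2 * N <= D * N by nra.
  have : D <= D * N by nra.
  by lra.
clearbody b; rewrite !ler_norml => /andP[a1 _] /andP[_ b2].
have h1 : 2 * L * u 0 ord_max <= - L by nra.
have h2 : i%:R * u 0 ord0 <= 0 by rewrite mulr_ge0_le0.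
have h3 : 0 <= i%:R ^+ 2 :> R by rewrite sqr_ge0.
by lra.
Qed.

Definition axis_point (k : 'I_d) (x y z : R) : V := \row_i
  if i == ord0 then x else if i == ord_max then z else if i == k then y else 0.

Lemma axis_point_sum k x y z :
  \sum_(i | middle i) axis_point k x y z 0 i = if middle k then y else 0.
Proof.
case: ifPn => mk.
  rewrite (bigD1 k)//= big1 => [|i /andP[/andP[i0 im] ik]]; last first.
    by rewrite mxE (negbTE i0) (negbTE im) (negbTE ik).
  by have /andP[k0 km] := mk; rewrite mxE (negbTE k0) (negbTE km) eqxx addr0.
rewrite big1// => i mi; have /andP[i0 im] := mi; rewrite mxE (negbTE i0) (negbTE im).
by case: eqP => // ik; rewrite -ik mi in mk.
Qed.

Lemma wall_axis_point k x y z j : (~~ middle k -> y = 0) ->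
  wall j (axis_point k x y z) = if j == ord0 then - (x + 1)
    else if j == ord_max then - (N - x - N * y + N * z)
    else if j == k then - (N * y + N - x) else - (N - x).
Proof.
move=> y0; case: eqVneq => [->|j0]; first by rewrite wall0 mxE eqxx.
case: eqVneq => [->|jm].
  rewrite wall_max axis_point_sum !mxE eqxx/= !eqxx.
  by case: ifPn => // /y0 ->.
rewrite wall_middle ?mxE; last by apply/andP.
rewrite (negbTE j0) (negbTE jm) eqxx/=.
by case: eqVneq => // _; ring.
Qed.

(** Points near the middle of each wall, on which the other walls are slack. *)
Lemma wall_witness k (s : R) : `|s| <= 2^-1 -> exists u, [/\
  forall i, `|u 0 i| <= 3 / 2, u 0 ord0 <= 0, u 0 ord_max <= - 2^-1,
  wall k u = s & forall j, j != k -> wall j u <= - 2^-1].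
Proof.
rewrite ler_norml => /andP[s1 s2]; have N1 := N_ge1.
have N0 : N != 0 by rewrite gt_eqF// (lt_le_trans ltr01).
have [t tN /andP[t1 t2]] : exists2 t, N * t = s & - 2^-1 <= t <= 2^-1.
  exists (s / N); first by rewrite mulrC divfK.
  rewrite ler_pdivrMr ?ler_pdivlMr ?(lt_le_trans ltr01)//; apply/andP; split; nra.
have [k0|k0] := eqVneq k ord0; last have [km|km] := eqVneq k ord_max.
- exists (axis_point ord0 (- 1 - s) 0 (- 2^-1)).
  split=> [i||||j]; rewrite ?wall_axis_point ?mxE ?k0 ?eqxx//=.
  + by do ![case: ifP => _]; rewrite ler_norml; apply/andP; split; lra.
  + by lra.
  + by ring.
  + by move=> /negbTE->; case: ifP => _; lra.
- exists (axis_point ord0 0 0 (- 1 - t)).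
  split=> [i||||j]; rewrite ?wall_axis_point ?mxE ?km ?eqxx//=.
  + by do ![case: ifP => _]; rewrite ler_norml; apply/andP; split; lra.
  + by lra.
  + by rewrite mulrBr tN; ring.
  + by move=> /negbTE->; do ![case: ifP => _]; lra.
- exists (axis_point k 0 (- 1 - t) (- 2^-1)).
  have mk : middle k by apply/andP.
  split=> [i||||j]; rewrite ?wall_axis_point ?mxE ?mk ?eqxx//=.
  + by do ![case: ifP => _]; rewrite ler_norml; apply/andP; split; lra.
  + by rewrite (negbTE k0) (negbTE km) mulrBr tN; ring.
  + by move=> /negbTE->; rewrite mulrBr tN; do ![case: ifP => _]; lra.
Qed.

(** At the abscissa [i] the bisector functions of the roofs [i] and [j] differ by
    (i - j)^2, which exceeds the prescribed value [s] for the roof [i] by more than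
    the total error 1/4 + |i - j|/32. *)
Lemma roof_witness (i : 'I_m) (s : R) : `|s| <= 2^-1 -> exists u, [/\
  forall k, power p0 u < power (pw k) u,
  s = 2^-1 -> power (pr i) u < power p0 u,
  s = - 2^-1 -> power p0 u < power (pr i) u &
  forall j, j != i -> power p0 u < power (pr j) u].
Proof.
rewrite ler_norml => /andP[s1 s2]; have N1 := N_ge1; have D2 := D_ge2.
have L0 := L_gt0; have [_ _ L3 L4] := L_bounds; have [_ rsq1] := roof_depth_large.
have iN : i.+1%:R <= N by rewrite ler_nat.
rewrite -natr1 in iN; have i0 : 0 <= i%:R :> R by [].
(* The height at which the bisector function of the roof i takes the value s. *)
pose z := (s - i%:R ^+ 2 - roof_depth) / (2 * L).
have zE : 2 * L * z = s - i%:R ^+ 2 - roof_depth by rewrite /z mulrC divfK ?mulf_neq0 ?gt_eqF.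
clearbody z; have i3 : 0 <= i%:R ^+ 2 :> R by rewrite sqr_ge0.
have i2 : i%:R ^+ 2 <= N ^+ 2 by rewrite ler_sqr ?nnegrE//; lra.
have Nz : - 4^-1 <= N * z.
  have : L * - 2^-1 <= L * (2 * (N * z)).
    rewrite (_ : L * (2 * (N * z)) = N * (2 * L * z)); last by ring.
    rewrite zE; nra.
  by rewrite ler_pM2l//; lra.
have z0 : z <= 0 by rewrite -(ler_pM2l L0) mulr0; lra.
have z1 : - 1 <= z by nra.
pose u := axis_point ord0 i%:R 0 z; exists u.
have ux : u 0 ord0 = i%:R by rewrite mxE eqxx.
have uz : u 0 ord_max = z by rewrite mxE eqxx.
have uY k : k != ord0 -> `|u 0 k| <= 1.
  move=> /negbTE k0; rewrite mxE k0; case: ifP => _; last by rewrite normr0.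
  by rewrite ler_norml; apply/andP; split; lra.
have uM k : `|u 0 k| <= 5 * D * N.
  have [->|/uY k1] := eqVneq k ord0; first by rewrite ux normr_nat; nra.
  by rewrite (le_trans k1)//; nra.
have := centre_near uM; rewrite uz zE ler_norml => /andP[c1 c2].
have rj (j : 'I_m) : `|(power (pr j) u - power p0 u) - ((i%:R - j%:R) ^+ 2 - s)| <=
    4^-1 + `|i%:R - j%:R| / 32.
  have xj : `|u 0 ord0 - j%:R| <= `|i%:R - j%:R| by rewrite ux.
  have := roof_near xj uY ler01; set b := (X in _ <= X).
  have b1 : b <= 8^-1 + `|i%:R - j%:R| / 32.
    rewrite /b ler_pdivrMr ?mulr_gt0 ?(lt_le_trans _ D2)//.
    have := normr_ge0 (i%:R - j%:R : R); nra.
  clearbody b; rewrite ux !ler_norml => /andP[a1 a2]; apply/andP; split; lra.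
split=> [k|se|se|j ji].
- have [+ _] := wall_decides k uM; apply; rewrite wall_axis_point//.
  by do ![case: ifP => _]; lra.
- by have := rj i; rewrite subrr normr0 expr0n/= ler_norml => /andP[_ ?]; lra.
- by have := rj i; rewrite subrr normr0 expr0n/= ler_norml => /andP[? _]; lra.
have : 1 <= `|i%:R - j%:R| :> R.
  have : (i : nat) != j by rewrite eq_sym; exact: ji.
  rewrite neq_ltn => /orP[] lt.
    rewrite distrC -natrB 1?ltnW// normr_nat ler1n subn_gt0//.
  by rewrite -natrB 1?ltnW// normr_nat ler1n subn_gt0.
have := rj j; rewrite -[X in X - s]real_normK ?num_real//.
by set t := `|_ - j%:R|; rewrite ler_norml => /andP[? _] ?; nra.
Qed.

Definition bisector_normal k : V := 2 *: ((neighbour k).1 - p0.1).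
Definition bisector_offset k : R :=
  dotp (neighbour k).1 (neighbour k).1 + (neighbour k).2 - dotp p0.1 p0.1 - p0.2.

Lemma bisectorE k u : power p0 u - power (neighbour k) u =
  dotp (bisector_normal k) u - bisector_offset k.
Proof.
rewrite /power /bisector_normal /bisector_offset.
by rewrite !dotpE (dotpC u) (dotpC u); ring.
Qed.

Lemma cellE : cell = hpolyhedron bisector_normal bisector_offset.
Proof.
have e k u : (power p0 u <= power (neighbour k) u) =
    (dotp (bisector_normal k) u <= bisector_offset k).
  by rewrite -subr_le0 bisectorE subr_le0.
by apply/seteqP; split=> u uk k; have := uk k; rewrite e.
Qed.

Lemma cell_interior : exists2 o : V, forall i, `|o 0 i| <= 3 / 2 &
  forall k, power p0 o < power (neighbour k) o.
Proof.
have [|o [oM x0 z0 w0 ws]] := @wall_witness ord0 (- 2^-1); first by rewrite normrN ger0_norm.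
exists o => // -[i|k] /=; first exact: below_roofs.
have [|+ _] := @wall_decides k o.
  by move=> i; rewrite (le_trans (oM i))//; have := N_ge1; have := D_ge2; nra.
by apply; have [->|/ws//] := eqVneq k ord0; rewrite w0.
Qed.

Lemma bisector_crossed k : exists u v, [/\ power p0 u < power (neighbour k) u,
  power (neighbour k) v < power p0 v & forall j, j != k ->
  power p0 u < power (neighbour j) u /\ power p0 v < power (neighbour j) v].
Proof.
have s1 : `|2^-1| <= 2^-1 :> R by rewrite ger0_norm.
have s2 : `|- 2^-1| <= 2^-1 :> R by rewrite normrN.
have DN : 3 / 2 <= 5 * D * N by have := N_ge1; have := D_ge2; nra.
case: k => k.
  have [v [v1 /(_ erefl) v2 _ v3]] := roof_witness k s1.
  have [u [u1 _ /(_ erefl) u2 u3]] := roof_witness k s2.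
  exists u, v; split=> // -[j|j] jk /=; last by split.
  have {}jk : j != k by apply: contraNneq jk => ->.
  by split; [exact: u3|exact: v3].
have [v [v1 v2 v3 v4 v5]] := wall_witness k s1.
have [u [u1 u2 u3 u4 u5]] := wall_witness k s2.
have [du _] := wall_decides k (fun i => le_trans (u1 i) DN).
have [_ dv] := wall_decides k (fun i => le_trans (v1 i) DN).
exists u, v; split=> /=; [by rewrite du ?u4|by rewrite dv ?v4|].
move=> [j|j] jk /=; first by split; apply: below_roofs.
have {}jk : j != k by apply: contraNneq jk => ->.
have [eu _] := wall_decides j (fun i => le_trans (u1 i) DN).
have [ev _] := wall_decides j (fun i => le_trans (v1 i) DN).
by split; [apply/eu/u5|apply/ev/v5].
Qed.

(** The k-th affine function changes sign on a segment along which the other ones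
    stay negative. *)
Lemma facet_point k : exists q, dotp (bisector_normal k) q = bisector_offset k /\
  forall j, j != k -> dotp (bisector_normal j) q < bisector_offset j.
Proof.
have [u [v [uk vk jk]]] := bisector_crossed k.
move: uk vk; rewrite -subr_lt0 bisectorE => uk; rewrite -subr_gt0 bisectorE => vk.
set a := (X in X < 0) in uk; set b := (X in 0 < X) in vk.
have ba : 0 < b - a by lra.
pose t := b / (b - a).
have tE : t * (b - a) = b by rewrite /t divfK// gt_eqF.
have t0 : 0 < t by rewrite divr_gt0.
have t1 : 0 < 1 - t by nra.
exists (t *: u + (1 - t) *: v); split.
  rewrite dotpDr !(dotpZr _ (bisector_normal _)); apply/eqP; rewrite -subr_eq0; apply/eqP.
  rewrite (_ : _ - _ = t * a + (1 - t) * b); last by rewrite /a /b; ring.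
  by nra.
move=> j /jk[]; rewrite -subr_lt0 bisectorE => uj; rewrite -subr_lt0 bisectorE => vj.
rewrite -subr_lt0 dotpDr !(dotpZr _ (bisector_normal _)); set g := dotp _ u in uj *; set h := dotp _ v in vj *.
rewrite (_ : _ - _ = t * (g - bisector_offset j) + (1 - t) * (h - bisector_offset j)); last by ring.
by nra.
Qed.

(** If a point of the convex cell were outside the large box, then a point between
    it and an interior point would be in the large box but not in the small one,
    against [bounded_in_box]. *)
Lemma cell_box u : cell u ->
  -2 <= u 0 ord0 <= N + 1 /\ forall k, k != ord0 -> `|u 0 k| <= 3 * D.
Proof.
move=> Qu; apply: bounded_in_box => // i; rewrite leNgt; apply/negP => iM.
have N1 := N_ge1; have D2 := D_ge2.
have [c cM cS] := cell_interior.
pose k := [arg max_(j > i) `|u 0 j|]%O.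
have [uk kM] : 5 * D * N < `|u 0 k| /\ forall j, `|u 0 j| <= `|u 0 k|.
  rewrite /k; case: arg_maxP => // j _ jM; split=> [|l]; last exact: jM.
  exact: lt_le_trans iM (jM _ _).
(* The interior point c has coordinates of modulus at most 3 / 2. *)
pose t := (5 * D * N - 3 / 2) / `|u 0 k|.
have DN : 2 * N <= D * N by nra.
have k0 : 0 < `|u 0 k| by lra.
have tE : t * `|u 0 k| = 5 * D * N - 3 / 2 by rewrite divfK ?gt_eqF.
have t0 : 0 <= t by rewrite divr_ge0 ?(ltW k0)//; lra.
have t1 : t <= 1 by rewrite ler_pdivrMr//; lra.
pose w := t *: u + (1 - t) *: c.
have Qw : cell w.
  rewrite cellE; have /convexP := @hpolyhedron_convex _ _ _ bisector_normal bisector_offset.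
  apply; rewrite -?cellE ?t0// => j; exact/ltW/cS.
have cj j : `|(1 - t) * c 0 j| <= 3 / 2.
  by rewrite normrM ger0_norm ?subr_ge0//; have := cM j; have := normr_ge0 (c 0 j); nra.
have wM j : `|w 0 j| <= 5 * D * N.
  rewrite !mxE (le_trans (ler_normD _ _))// (_ : 5 * D * N = t * `|u 0 k| + 3 / 2).
    by rewrite lerD// normrM ger0_norm// ler_wpM2l.
  by rewrite tE; ring.
have [/andP[x1 x2] y] := bounded_in_box wM Qw.
have : 5 * D * N - 3 <= `|w 0 k|.
  rewrite !mxE (_ : _ - 3 = `|t * u 0 k| - 3 / 2); last first.
    by rewrite normrM (ger0_norm t0) tE; lra.
  rewrite lerBlDr -{1}[t * u 0 k](addrK ((1 - t) * c 0 k)) (le_trans (ler_normB _ _))//.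
  by rewrite lerD2l.
have [->|/y] := eqVneq k ord0; last by nra.
have : `|w 0 ord0| <= N + 2 by rewrite ler_norml; apply/andP; split; lra.
by lra.
Qed.

Lemma cell_near_axis u : cell u -> exists i : 'I_m,
  dotp (u - i%:R *: ex) (u - i%:R *: ex) <= 9 * D ^+ 3.
Proof.
move=> Qu; have [/andP[x1 x2] y] := cell_box Qu; have D2 := D_ge2.
have [i ix] : exists i : 'I_m, `|u 0 ord0 - i%:R| <= 2.
  have [x0|x0] := ltP (u 0 ord0) 0.
    exists (Ordinal m_gt0); rewrite subr0 ler_norml; apply/andP; split; lra.
  have /andP[t1 t2] := truncn_itv x0; set t := Num.truncn _ in t1 t2.
  rewrite -natr1 in t2; have [tm|mt] := ltnP t m.
    by exists (Ordinal tm); rewrite ler_norml /=; apply/andP; split; lra.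
  have mm : (m.-1 < m)%N by rewrite prednK.
  exists (Ordinal mm) => /=; have mE : N = m.-1%:R + 1 by rewrite natr1 prednK.
  have : N <= t%:R by rewrite ler_nat.
  by move=> ?; rewrite ler_norml; apply/andP; split; lra.
exists i; rewrite (_ : 9 * D ^+ 3 = \sum_(k < d) (3 * D) ^+ 2).
  apply: ler_sum => k _; rewrite -expr2 -ler_sqrt ?sqr_ge0// !sqrtr_sqr.
  rewrite [leRHS]ger0_norm ?mulr_ge0// !mxE eqxx/=.
  have [->|k0] := eqVneq k ord0; last by rewrite mulr0 subr0 y.
  by rewrite mulr1 (le_trans ix)//; lra.
by rewrite sumr_const card_ord -mulr_natl; ring.
Qed.

(** With D2 = 9 D^3 the bound of [cell_near_axis], lam = 1 / (1 + 2 D2) is such that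
    lam (1 + 2 t + 2 D2) <= 1 + t for all t >= 0. *)
Definition reach : R := (1 + 18 * D ^+ 3)^-1.

(** Let [u] be near the apex i e_x.  The power of the centre at [u] is at most that
    of the roof [i], which is at most -1.  The squared distance of a site [q] to
    the apex is at most twice the sum of those of [u] to [q] and to the apex, so
    that the power of [q] at [u] is at least -1 if [q] is above the paraboloid. *)
Lemma cell_shielded (q : point) u : cell u ->
  (forall i : 'I_m, ~ below_paraboloid reach (i%:R *: ex) q) -> power p0 u <= power q u.
Proof.
move=> Qu qfar; have [i iu] := cell_near_axis Qu; have D2 := D_ge2.
have D3 : 8 <= D ^+ 3 by rewrite (_ : 8 = 2 ^+ 3 :> R) ?ler_pXn2r ?nnegrE//; ring.
apply: (@le_trans _ _ (- 1)).
  apply: le_trans (Qu (inl i)) _ => /=.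
  have [qi hi] := pr_near i; rewrite /power.
  have r1 : 2 * (D * roof_radius ^+ 2) <= 2 /\ roof_radius <= 1.
    have e : roof_radius * (32 * D) = 1 by rewrite /roof_radius mulVf// gt_eqF//; lra.
    have : 0 < roof_radius by rewrite invr_gt0; lra.
    by rewrite expr2; split; nra.
  have : dotp (i%:R *: ex - (pr i).1) (i%:R *: ex - (pr i).1) <= D * roof_radius ^+ 2.
    rewrite mulr_natl -[d in leRHS]card_ord -sumr_const; apply: ler_sum => k _.
    rewrite -expr2 -ler_sqrt ?sqr_ge0// !sqrtr_sqr [leRHS]ger0_norm.
      by rewrite !mxE distrC; have := qi k; rewrite !mxE.
    by rewrite invr_ge0 mulr_ge0.
  have := dotp_sub_le u (pr i).1 (i%:R *: ex).
  move: hi; rewrite ler_norml /= => /andP[_]; case: r1; rewrite /roof_depth; lra.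
have := dotp_sub_le q.1 (i%:R *: ex) u; have := qfar i; rewrite /below_paraboloid/= => /negP.
rewrite -leNgt /power; set a := dotp (q.1 - _) _; set b := dotp (u - _) _ in iu *.
rewrite (_ : dotp (q.1 - u) (q.1 - u) = dotp (u - q.1) (u - q.1)); last first.
  by rewrite -opprB dotpNl dotpNr opprK.
set c := dotp (u - _) _ => qa ac.
have r0 : 0 < reach by rewrite invr_gt0; lra.
have rE : reach * (1 + 18 * D ^+ 3) = 1 by rewrite mulVf// gt_eqF//; lra.
have c0 : 0 <= c by exact: dotp_ge0.
have r2 : reach * 2 <= 1 by nra.
have : reach * a <= reach * (2 * c + 2 * (9 * D ^+ 3)) by rewrite ler_pM2l//; lra.
have : reach * 2 * c <= 1 * c by rewrite ler_wpM2r.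
by lra.
Qed.

Lemma cell_enorm u : cell u -> enorm u <= Num.sqrt (\sum_(k < d) (5 * D * N) ^+ 2).
Proof.
move=> /cell_box[/andP[x1 x2] y]; have N1 := N_ge1; have D2 := D_ge2.
rewrite ler_sqrt; last by apply: sumr_ge0 => k _; exact: sqr_ge0.
apply: ler_sum => k _; rewrite -expr2 -ler_sqrt ?sqr_ge0// !sqrtr_sqr.
rewrite [leRHS]ger0_norm ?mulr_ge0//.
have [->|/y k1] := eqVneq k ord0; last by rewrite (le_trans k1)//; nra.
by rewrite ler_norml; apply/andP; split; nra.
Qed.

(** The shift moves the cell so that its own site becomes the origin, as in
    the definition of the typical cell. *)
Lemma shifted_cell_body (s : V) : exists2 K : convex_body R d,
  body K = [set w | cell (w + s)] & polytopes_with_facets (m + d) (body K).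
Proof.
pose b' k := bisector_offset k - dotp (bisector_normal k) s.
have e : [set w | cell (w + s)] = hpolyhedron bisector_normal b'.
  have b'E w k : (dotp (bisector_normal k) w <= b' k) =
      (dotp (bisector_normal k) (w + s) <= bisector_offset k) by rewrite lerBrDr dotpDr.
  by rewrite cellE; apply/seteqP; split=> w wk k; have := wk k; rewrite b'E.
have bd : exists M, forall w, hpolyhedron bisector_normal b' w -> enorm w <= M.
  exists (Num.sqrt (\sum_(k < d) (5 * D * N) ^+ 2) + enorm s) => w; rewrite -e => /cell_enorm ws.
  by rewrite -[w](addrK s) (le_trans (enormD _ _))// enormN lerD.
have [c _ cS] := cell_interior.
have cS' k : dotp (bisector_normal k) (c - s) < b' k.
  by rewrite dotpBr ltrD2r -subr_lt0 -bisectorE subr_lt0.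
have KP : [/\ [set w | cell (w + s)] !=set0, compact [set w | cell (w + s)] &
    convex_set [set w | cell (w + s)]].
  rewrite e; split; last exact: hpolyhedron_convex.
  - by exists (c - s) => k; exact: ltW.
  have [M hM] := bd.
  apply: bounded_closed_compact.
    exists M; split=> [|M' MM' w /hM wM]; first exact: num_real.
    have w0 := enorm_ge0 w.
    rewrite /Num.norm/= mx_normrE; apply/bigmax_leP; split=> [|[i j] _ /=]; first by lra.
    by rewrite (ord1 i) (le_trans (enorm_coord w j))//; lra.
  rewrite (_ : hpolyhedron _ _ = \bigcap_(k in [set: 'I_m + 'I_d])
      [set w | dotp (bisector_normal k) w <= b' k]).
    apply: closed_bigI => k _; apply: closed_le_fun; last exact: cst_continuous.
    by apply: continuous_dotp; [exact: cst_continuous|move=> ?; exact: cvg_id].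
  by apply/seteqP; split=> w wk k; [move=> _|]; exact: wk.
exists (ConvexBody KP) => //=.
have /choice[q qP] := facet_point.
rewrite e (_ : (m + d)%N = #|{: 'I_m + 'I_d}|); last by rewrite card_sum !card_ord.
apply: (hpolyhedron_facets bd (q := fun k => q k - s) cS') => [k|k j jk].
  by rewrite dotpBr (qP k).1.
by rewrite dotpBr ltrD2r (qP k).2.
Qed.

End Configuration.

(** * Boxes of sites and the facets of a Laguerre cell *)

Section Blobs.
Context {R : realType} (d' m : nat) (L : R).
Local Notation d := d'.+2.
Local Notation V := 'rV[R]_d.
Local Notation point := (V * R)%type.
Local Notation N := (m%:R : R).
Local Notation D := (d%:R : R).
Local Notation ex := (delta_mx 0 ord0 : V).
Local Notation ez := (delta_mx 0 ord_max : V).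
Local Notation index := (option ('I_m + 'I_d)).

(** [None] is the centre, [inl i] a roof and [inr k] a wall. *)
Definition site (o : index) : point := match o with
  | None => centre_site d' L
  | Some (inl i) => roof_site d' i
  | Some (inr k) => wall_site m L k
  end.

Definition site_radius (o : index) : R :=
  if o is Some (inl _) then roof_radius d' else wall_radius d' L.

Definition blob (c : V) (o : index) : set point :=
  cbox (c + (site o).1) (site o).2 (site_radius o).

(** The region that must be free of other points of the process. *)
Definition shield (c : V) : set point :=
  \bigcup_(i < m) below_paraboloid (reach d') (c + i%:R *: ex).

Hypothesis m_gt0 : (0 < m)%N.
Hypothesis L_large : 4 * roof_depth d' * N ^+ 3 <= L.

Lemma enorm_power (z : point) (c w : V) :
  enorm (w - z.1) ^+ 2 + z.2 = power (z.1 - c, z.2) (w - c).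
Proof. by rewrite enorm_sqr /power/= opprB addrA subrK. Qed.

Lemma laguerre_cell_facets (c : V) (X : set point) (y : index -> point) :
  (forall o, X (y o)) -> (forall o, blob c o (y o)) ->
  (forall z, X z -> (exists o, z = y o) \/ ~ shield c z) ->
  exists2 K : convex_body R d,
    body K = [set w | laguerre_cell X (y None) (w + (y None).1)] &
    polytopes_with_facets (m + d) (body K).
Proof.
move=> Xy yb Xz; pose p o : point := ((y o).1 - c, (y o).2).
have pb o : cbox (site o).1 (site o).2 (site_radius o) (p o).
  have [y1 y2] := yb o; split=> // i; have := y1 i; rewrite !mxE => h.
  by apply: le_trans h; rewrite -addrA opprD.
have p0b := pb None.
have prb i := pb (Some (inl i)); have pwb k := pb (Some (inr k)).
have [K KE Kf] := shifted_cell_body m_gt0 L_large p0b prb pwb ((y None).1 - c).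
exists K => //; rewrite KE; apply/seteqP; split=> w; rewrite /= addrA.
  move=> wc z /Xz [[j ->]|zs]; rewrite !(enorm_power _ c).
    case: j => [[i|k]|]; [exact: wc (inl i)|exact: wc (inr k)|exact: lexx].
  apply: (cell_shielded m_gt0 L_large p0b prb pwb wc (q := (z.1 - c, z.2))) => i zi.
  apply: zs; exists i; first exact: ltn_ord; move: zi; rewrite /below_paraboloid/=.
  by rewrite opprD (addrA z.1).
move=> wl [i|k] /=; have := wl _ (Xy (Some _)).
  by move=> /(_ (inl i)); rewrite !(enorm_power _ c).
by move=> /(_ (inr k)); rewrite !(enorm_power _ c).
Qed.

Lemma radius_small o : 0 < site_radius o <= 64^-1.
Proof.
have D2 := @D_ge2 R d'; have [_ _ _ L4] := L_bounds m_gt0 L_large.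
have [_ r2] := @roof_depth_large R d'; have N1 := @N_ge1 R m m_gt0.
have inv (x : R) : 64 <= x -> 0 < x^-1 <= 64^-1.
  by move=> x64; rewrite invr_gt0 lef_pV2 ?posrE; [apply/andP; split; lra|lra|].
by case: o => [[i|k]|] /=; apply: inv; nra.
Qed.

Lemma wall_normal_diag (k : 'I_d) : wall_normal m k 0 k <= -1 :> R.
Proof.
have N1 := @N_ge1 R m m_gt0; rewrite mxE !eqxx.
by case: eqP => ?; [|case: eqP => ?]; rewrite ?lerN2.
Qed.

(** With [wall_normal_diag], this separates two wall sites along one coordinate. *)
Lemma wall_normal_offdiag (k k' : 'I_d) : k' != k -> 0 <= wall_normal m k' 0 k :> R.
Proof.
rewrite mxE => /negbTE kk; do ![case: eqVneq => [?|_] //=]; subst; by rewrite ?eqxx in kk *.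
Qed.

Lemma site_bottom o : (if o is Some (inl _) then False else True) ->
  (site o).1 0 ord_max <= - L.
Proof.
case: o => [[i|k]|] //= _; rewrite !mxE !eqxx/= ?mulr1//.
have N0 : 0 <= N by [].
by do ![case: ifP => _]; lra.
Qed.

Lemma sites_apart o o' : o != o' -> exists j,
  2^-1 <= `|(site o).1 0 j - (site o').1 0 j|.
Proof.
have L0 := L_gt0 m_gt0 L_large; have [_ _ _ L4] := L_bounds m_gt0 L_large.
have [_ r2] := @roof_depth_large R d'; have N1 := @N_ge1 R m m_gt0.
have top i : (site (Some (inl i))).1 0 ord_max = 0 by rewrite /= !mxE mulr0.
have roofs i z : (if z is Some (inl _) then False else True) ->
    2^-1 <= `|(site (Some (inl i))).1 0 ord_max - (site z).1 0 ord_max|.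
  by move=> /site_bottom zb; rewrite top ler_normr; apply/orP; left; lra.
have centre k : 2^-1 <= `|(site None).1 0 k - (site (Some (inr k))).1 0 k|.
  have := wall_normal_diag k; rewrite /= /wall_vertex; set g := wall_normal m k.
  by clearbody g; rewrite !mxE ler_normr => ?; apply/orP; left; lra.
case: o o' => [[i|k]|] [[i'|k']|] // oo.
- have ii : (i : nat) != i' by apply: contraNneq oo => /val_inj->.
  exists ord0; rewrite /= !mxE eqxx !mulr1.
  move: ii; rewrite neq_ltn => /orP[] lt.
    rewrite distrC -natrB 1?ltnW// normr_nat (@le_trans _ _ 1)//; first by lra.
    by rewrite ler1n subn_gt0.
  rewrite -natrB 1?ltnW// normr_nat (@le_trans _ _ 1)//; first by lra.
  by rewrite ler1n subn_gt0.
- by exists ord_max; exact: roofs.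
- by exists ord_max; exact: roofs.
- by exists ord_max; rewrite distrC; exact: roofs.
- have kk : k' != k by apply: contraNneq oo => ->.
  exists k; have := wall_normal_diag k; have := wall_normal_offdiag kk.
  rewrite /= /wall_vertex; set g := wall_normal m k; set g' := wall_normal m k'.
  by clearbody g g'; rewrite !mxE ler_normr => ? ?; apply/orP; right; lra.
- by exists k; rewrite distrC; exact: centre.
- by exists ord_max; rewrite distrC; exact: roofs.
- by exists k'; exact: centre.
Qed.

Lemma blob_disjoint c : trivIset setT (blob c).
Proof.
apply/trivIsetP => o o' _ _ oo; rewrite -subset0 => z [[z1 _] [z2 _]].
have [j oj] := sites_apart oo.
have /andP[_ r1] := radius_small o; have /andP[_ r2] := radius_small o'.
have := z1 j; have := z2 j; rewrite !mxE; move: oj; set a := (site o).1 0 j.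
set b := (site o').1 0 j => ab h1 h2.
have : `|a - b| <= site_radius o + site_radius o'.
  rewrite (_ : a - b = (z.1 0 j - (c 0 j + b)) - (z.1 0 j - (c 0 j + a))); last by ring.
  by rewrite (le_trans (ler_normB _ _))// addrC lerD.
by lra.
Qed.

Lemma site_height o : (site o).2 + site_radius o <= - 1.
Proof.
have /andP[_ r1] := radius_small o.
have L0 := L_gt0 m_gt0 L_large; have [_ _ _ L4] := L_bounds m_gt0 L_large.
have [_ r2] := @roof_depth_large R d'; have N1 := @N_ge1 R m m_gt0.
suff : (site o).2 <= - 2 by lra.
case: o r1 => [[i|k]|] _ /=; [by lra| |by nra].
have L2 : L ^+ 2 <= dotp (wall_vertex m L k) (wall_vertex m L k).
  rewrite /dotp (bigD1 ord_max)//= -expr2 -[leLHS]addr0 lerD//.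
    have zb := @site_bottom (Some (inr k)) Logic.I; rewrite /= in zb.
    by rewrite -(sqrrN (wall_vertex _ _ _ _ _)) ler_sqr ?nnegrE; lra.
  by apply: sumr_ge0 => j _; rewrite -expr2 sqr_ge0.
have : - N <= @wall_height R d' m k by rewrite /wall_height; case: ifP => _; lra.
by nra.
Qed.

Lemma wall_site_depth o : (if o is Some (inl _) then False else True) ->
  site_radius o - (site o).2 <= 5 * D * L ^+ 2.
Proof.
move=> ho; have /andP[_ r1] := radius_small o; have D2 := @D_ge2 R d'.
have L0 := L_gt0 m_gt0 L_large; have [_ _ _ L4] := L_bounds m_gt0 L_large.
have [_ r2] := @roof_depth_large R d'; have N1 := @N_ge1 R m m_gt0.
have LL : L <= L ^+ 2 by nra.
have DL : 2 * L ^+ 2 <= D * L ^+ 2 by nra.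
suff : - (site o).2 <= 4 * D * L ^+ 2 + N by lra.
case: o ho {r1} => [[i|k]|] //= _; last by lra.
have : dotp (wall_vertex m L k) (wall_vertex m L k) <= 4 * D * L ^+ 2.
  rewrite (_ : 4 * D * _ = \sum_(j < d) (2 * L) ^+ 2); last first.
    by rewrite sumr_const card_ord -mulr_natl; ring.
  apply: ler_sum => j _; rewrite -expr2 -ler_sqrt ?sqr_ge0// !sqrtr_sqr.
  rewrite (ger0_norm (_ : 0 <= 2 * L)); last by lra.
  have := @wall_normal_le R d' m k j m_gt0; rewrite /wall_vertex; set g := wall_normal m k.
  clearbody g; rewrite !mxE (_ : 2 * L = L + L); last by ring.
  move=> gN; rewrite (le_trans (ler_normD _ _))// !normrM normrN (gtr0_norm L0) lerD//.
    by case: (_ && _); rewrite ?normr1 ?normr0; lra.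
  by rewrite ger0_norm//; lra.
have : @wall_height R d' m k <= 0 by rewrite /wall_height; case: ifP => _; lra.
by lra.
Qed.

Lemma centre_in_cube y : blob (const_mx 2^-1 + L *: ez) None y -> unit_cube y.1.
Proof.
move=> [y1 _] i; have := y1 i; have /andP[_ r1] := radius_small None.
by rewrite !mxE ler_norml => /andP[? ?]; apply/andP; split; lra.
Qed.

End Blobs.

(** * The probability of a good configuration *)

Section Counting.
Context {R : realType} {T : choiceType}.
Implicit Types A B : set T.

Lemma counting_ge0 A : (0 <= counting A :> \bar R)%E.
Proof. by rewrite /counting; case: ifP => _; rewrite ?lee_fin// leey. Qed.

Lemma counting_set1 (x : T) : counting [set x] = 1%E :> \bar R.
Proof. by rewrite /counting asboolT// fset_set1 cardfs1. Qed.

Lemma counting_eqP A n : counting A = n%:R%:E :> \bar R ->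
  finite_set A /\ #|` fset_set A| = n.
Proof.
rewrite /counting; case: ifPn => // /asboolP fA [] /eqP.
by rewrite eqr_nat => /eqP.
Qed.

Lemma counting_eq0 A : counting A = 0%E :> \bar R -> A = set0.
Proof.
move=> /(@counting_eqP _ 0)[fA] /eqP; rewrite cardfs_eq0 => /eqP.
exact: fset_set_set0.
Qed.

Lemma counting_eq1 A : counting A = 1%E :> \bar R -> exists x, A = [set x].
Proof.
move=> /(@counting_eqP _ 1)[fA] /eqP/cardfs1P[x Ax]; exists x.
by rewrite -[A]fset_setK// Ax set_fset1.
Qed.

Lemma le_counting A B : A `<=` B -> (counting A <= counting B :> \bar R)%E.
Proof.
move=> AB; rewrite /counting; case: (asboolP (finite_set B)) => fB; last by rewrite leey.
have fA := sub_finite_set AB fB; rewrite asboolT// lee_fin ler_nat.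
by apply: fsubset_leq_card; rewrite -fset_set_sub.
Qed.

Lemma isolated_point (X B : set T) : counting (X `&` B) = 1%E :> \bar R ->
  exists x, [/\ X x, B x & forall z, X z -> B z -> z = x].
Proof.
move=> /counting_eq1[x XB]; have [Xx Bx] : (X `&` B) x by rewrite XB.
by exists x; split=> // z Xz Bz; have : (X `&` B) z by []; rewrite XB.
Qed.

End Counting.

Lemma prod_option (R : comPzRingType) (I : finType) (F : option I -> R) :
  \prod_o F o = F None * \prod_i F (Some i).
Proof.
rewrite (bigD1 None)//=; congr (_ * _).
by rewrite (reindex_omap Some id) => [|[i|]]//=; apply: eq_bigl => i; rewrite eqxx.
Qed.

Lemma powR_exprn (R : realType) (x y : R) m : 0 <= x -> (x ^+ m) `^ y = (x `^ y) ^+ m.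
Proof.
by move=> x0; rewrite -powR_mulrn// -powRrM mulrC powRrM powR_mulrn// powR_ge0.
Qed.

Section PoissonConfiguration.
Context {R : realType} {d : measure_display} {Omega : measurableType d}.
Context {E : topologicalType} {P : probability Omega R} {mu : set E -> \bar R}.
Context {eta : Omega -> set E}.
Hypothesis poisson : poisson_point_process P mu eta.

Local Notation hits B omega := (counting (eta omega `&` B) : \bar R).

Lemma hits_measurable (B : set E) (x : \bar R) : borel B ->
  measurable [set omega | hits B omega = x].
Proof.
case: poisson => _ mN _ _ bB; rewrite -[X in measurable X]setTI.
exact: (mN _ bB measurableT _ (emeasurable_set1 x)).
Qed.

(** Passes from families indexed by ordinals to those indexed by any finite type. *)
Lemma hits_independent (I : finType) (B : I -> set E) (x : I -> \bar R) :
  (forall i, borel (B i)) -> trivIset setT B ->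
  P [set omega | forall i, hits (B i) omega = x i] =
  (\prod_i P [set omega | hits (B i) omega = x i])%E.
Proof.
case: poisson => _ _ _ indep bB tB.
have ind := indep #|I| (B \o enum_val) (fun j => [set x (enum_val j)]).
rewrite [RHS](reindex _ (onW_bij _ (enum_val_bij I))) -ind.
- congr (P _); apply/seteqP; split=> omega h i; first by move=> _; exact: h.
  by have := h (enum_rank i) Logic.I; rewrite /= enum_rankK.
- by move=> j; exact: bB.
- apply/trivIsetP => i j _ _ ij; move/trivIsetP: tB; apply=> //.
  by apply: contraNneq ij => /enum_val_inj->.
- by move=> j; exact: emeasurable_set1.
Qed.

Lemma one_point_each (I : finType) (B : I -> set E) (r : I -> R) (W : set E) (w : R) :
  (forall i, borel (B i)) -> trivIset setT B -> borel W ->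
  (forall i, B i `&` W = set0) ->
  (forall i, mu (B i) = (r i)%:E) -> mu W = w%:E ->
  let G := [set omega | (forall i, hits (B i) omega = 1%E) /\ hits W omega = 0%E] in
  measurable G /\ P G = ((\prod_i (r i * expR (- r i))) * expR (- w))%:E.
Proof.
move=> bB tB bW BW muB muW G; have [_ _ law _] := poisson.
pose C (o : option I) := if o is Some i then B i else W.
pose x (o : option I) : \bar R := if o is Some i then 1%E else 0%E.
have GE : G = [set omega | forall o, hits (C o) omega = x o].
  apply/seteqP; split=> [omega [h1 h2] [i|] //=|omega h].
  by split=> [i|]; [exact: (h (Some i))|exact: (h None)].
have bC o : borel (C o) by case: o.
split.
  rewrite GE (_ : [set _ | _] = \bigcap_(o in [set: option I]) [set omega | hits (C o) omega = x o]).
    by apply: fin_bigcap_measurable => // o _; exact: hits_measurable.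
  by apply/seteqP; split=> omega h o; [move=> _|]; exact: h.
rewrite GE hits_independent//; last first.
  apply/trivIsetP => -[i|] [j|] _ _ // ij; rewrite /C ?[W `&` _]setIC ?BW//.
  by move/trivIsetP: tB; apply=> //; apply: contraNneq ij => ->.
rewrite (eq_bigr (fun o => (if o is Some i then r i * expR (- r i) else expR (- w))%:E)).
  by rewrite -(big_morph EFin (@EFinM R) erefl) prod_option mulrC.
case=> [i|] _ /=.
  by have [_ /(_ _ (muB i) 1%N)] := law _ (bB i); rewrite expr1 (_ : 1`! = 1%N)// divr1.
by have [_ /(_ _ muW 0%N)] := law _ bW; rewrite expr0 fact0 divr1 mul1r.
Qed.

End PoissonConfiguration.

Section GoodConfigurations.
Context {R : realType} (d' : nat) (gamma beta kappa : R).
Local Notation d := d'.+2.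
Local Notation V := 'rV[R]_d.
Local Notation point := (V * R)%type.
Local Notation D := (d%:R : R).
Local Notation mu := (@mu_beta' R d gamma beta).
Hypothesis kappaE : gamma * c_beta' d beta = kappa.
Hypothesis kappa_gt0 : 0 < kappa.
Hypothesis beta_gt : D / 2 + 1 < beta.

(** Large enough for the configuration, since m^3 <= 8^m, and geometric in [m]. *)
Definition depth (m : nat) : R := 4 * roof_depth d' * 8 ^+ m.

Lemma depth_large m : 4 * roof_depth d' * m%:R ^+ 3 <= depth m.
Proof.
have [_ r2] := @roof_depth_large R d'; rewrite /depth ler_wpM2l//; first by lra.
by rewrite -!natrX ler_nat (_ : 8 = 2 ^ 3)%N// -expnM mulnC expnM leq_exp2r// ltnW// ltn_expl.
Qed.

Let beta_ge0 : 0 <= beta.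
Proof. by rewrite (le_trans _ (ltW beta_gt))// addr_ge0// divr_ge0. Qed.

Lemma cbox_borel (a : V) k delta : borel (cbox a k delta).
Proof.
apply: borel_closed; rewrite (_ : cbox _ _ _ =
    (\bigcap_(i in [set: 'I_d]) [set y : point | `|y.1 0 i - a 0 i| <= delta]) `&`
    [set y : point | `|y.2 - k| <= delta]); last first.
  by apply/seteqP; split=> y [y1 y2]; split=> // i; [move=> _|]; exact: y1.
have fstc i : continuous (fun y : point => y.1 0 i).
  apply: (@continuous_then _ _ _ (fun v : V => v 0 i)); last exact: coord_continuous_mx.
  exact: continuous_fst.
have absc (f : point -> R) (c : R) : continuous f -> continuous (fun y => `|f y - c|).
  by move=> fc y; apply: cvg_norm; apply: cvgB; [exact: fc|exact: cvg_cst].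
apply: closedI; first apply: closed_bigI => i _.
  by apply: closed_le_fun; [exact: absc (fstc i)|exact: cst_continuous].
by apply: closed_le_fun; [apply/absc/continuous_snd|exact: cst_continuous].
Qed.

Lemma shield_borel m (c : V) : borel (shield m c).
Proof.
apply: borel_open; apply: bigcup_open => i _.
rewrite /below_paraboloid; set lam := reach _; set e := c + _.
rewrite (_ : [set _ | _] = ~` [set y : point | - (lam * (1 + dotp (y.1 - e) (y.1 - e))) <= y.2]).
  apply: closed_openC; apply: closed_le_fun; last exact: continuous_snd.
  have fc : continuous (fun y : point => y.1 - e).
    by move=> y; apply: cvgB; [exact: continuous_fst|exact: cvg_cst].
  have gc := continuous_dotp fc fc.
  move=> y; apply: cvgN; apply: cvgM; first exact: cvg_cst.
  by apply: cvgD; [exact: cvg_cst|exact: gc].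
by apply/seteqP; split=> y /=; rewrite ltNge => /negP.
Qed.

(** The boxes of the roofs do not depend on [m]; those of the other sites have a
    size of order 8^-m and lie at a depth of order 64^m. *)
Lemma blob_intensity_ge : exists s t q : R, [/\ 0 < s, 0 < t, 0 < q &
  forall m (c : V) o, (0 < m)%N -> exists r : R, [/\ mu (blob (m := m) (depth m) c o) = r%:E, r <= kappa &
    if o is Some (inl _) then s <= r else t * q ^+ m <= r]].
Proof.
have D2 := @D_ge2 R d'; have [_ r2] := @roof_depth_large R d'.
pose rr : R := roof_radius d'.
have rr0 : 0 < rr by rewrite invr_gt0; lra.
pose s : R := kappa * (rr + roof_depth d') `^ (- beta) * (2 * rr) ^+ d.+1.
pose b : R := 5 * D * (4 * roof_depth d') ^+ 2.
have b0 : 0 < b by rewrite !mulr_gt0 ?exprn_gt0//; lra.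
pose w : R := 2 * (100 * D * (4 * roof_depth d'))^-1.
have w0 : 0 < w by rewrite mulr_gt0// invr_gt0 !mulr_gt0//; lra.
pose t : R := kappa * b `^ (- beta) * w ^+ d.+1.
pose q : R := 64 `^ (- beta) * 8^-1 ^+ d.+1.
exists s, t, q; split.
- have rp : 0 < rr + roof_depth d' by rewrite addr_gt0//; lra.
  by rewrite mulr_gt0 ?exprn_gt0 ?mulr_gt0 ?powR_gt0.
- by apply: mulr_gt0; [apply: mulr_gt0 => //; exact: powR_gt0|exact: exprn_gt0].
- by rewrite mulr_gt0 ?powR_gt0 ?exprn_gt0 ?invr_gt0.
move=> m c o m0; have Ll := depth_large m.
have L0 := L_gt0 m0 Ll.
have /andP[rad0 rad1] := radius_small m0 Ll o.
have kap0 := ltW kappa_gt0.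
have [r [mur /andP[rl ru]]] :=
  mu_cbox kappaE kap0 (c + (site (depth m) o).1) (ltW rad0) (site_height m0 Ll o) beta_ge0.
exists r; split=> //.
  apply: le_trans ru _; rewrite ler_piMr//; apply: exprn_ile1; lra.
have bottom : (if o is Some (inl _) then False else True) ->
    site_radius (depth m) o = wall_radius d' (depth m) -> t * q ^+ m <= r.
  move=> ho ro; apply: le_trans rl.
  have dE : 5 * D * depth m ^+ 2 = b * 64 ^+ m.
    by rewrite /b /depth [in LHS]exprMn -exprM mulnC exprM mulrA (_ : 8 ^+ 2 = 64)//; ring.
  have wE : 2 * site_radius (depth m) o = w * 8^-1 ^+ m.
    rewrite ro /wall_radius /w /depth exprVn [100 * D * (_ * _)]mulrA.
    by set A := 100 * D * _; rewrite invfM [LHS]mulrA.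
  rewrite wE (_ : t * q ^+ m = kappa * (b * 64 ^+ m) `^ (- beta) * (w * 8^-1 ^+ m) ^+ d.+1).
    have w1 : 0 <= (w * 8^-1 ^+ m) ^+ d.+1.
      by apply: exprn_ge0; apply: mulr_ge0; [exact: ltW|exact: exprn_ge0].
    apply: ler_wpM2r => //; apply: ler_wpM2l => //.
    have := wall_site_depth m0 Ll ho; rewrite dE => xB.
    have hx := site_height m0 Ll o.
    have x0 : 0 < site_radius (depth m) o - (site (depth m) o).2 by lra.
    have B0 : 0 < b * 64 ^+ m by rewrite mulr_gt0 ?exprn_gt0.
    rewrite !powRN lef_pV2 ?posrE ?powR_gt0//.
    by rewrite ge0_ler_powR ?nnegrE ?(ltW x0) ?(ltW B0).
  rewrite powRM ?exprn_ge0 ?(ltW b0)// /t /q.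
  have -> : (w * 8^-1 ^+ m) ^+ d.+1 = w ^+ d.+1 * (8^-1 ^+ d.+1) ^+ m.
    by rewrite exprMn -!exprM mulnC.
  rewrite powR_exprn// [(_ * _) ^+ m]exprMn.
  move: (b `^ _) (w ^+ _) (_ `^ _ ^+ m) (_ ^+ _ ^+ m) => *; ring.
case: o rad0 rad1 mur rl ru bottom => [[i|k]|] rad0 rad1 mur rl ru bottom.
- by apply: le_trans rl; rewrite /= opprK.
- exact: bottom.
- exact: bottom.
Qed.

Context {disp : measure_display} {Omega : measurableType disp}.
Context {P : probability Omega R} {eta : Omega -> set point}.
Hypothesis poisson : poisson_point_process P mu eta.

Definition good_configuration m (c : V) (X : set point) : Prop :=
  (forall o, counting (X `&` blob (m := m) (depth m) c o) = 1%E :> \bar R) /\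
  counting (X `&` (shield m c `\` \bigcup_o blob (m := m) (depth m) c o)) = 0%E :> \bar R.

(** By independence the probability is a product of the factors r e^-r of the boxes
    and of e^-w, where [w] is of order [m] by [mu_below_paraboloids]. *)
Lemma good_configuration_probability : exists A q : R, [/\ 0 < A, 0 < q &
  forall m (c : V), (0 < m)%N ->
    measurable [set omega | good_configuration m c (eta omega)] /\
    ((A * q ^+ m)%:E <= P [set omega | good_configuration m c (eta omega)])%E].
Proof.
have [s [t [q1 [s0 t0 q10 rP]]]] := blob_intensity_ge.
have reach0 : 0 < reach d' :> R.
  by rewrite invr_gt0 ltr_pwDl// mulr_ge0.
have [C C0 muW] := mu_below_paraboloids kappaE (ltW kappa_gt0) beta_gt reach0.
pose ek := expR (- kappa).
have ek0 : 0 < ek by exact: expR_gt0.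
exists ((t * ek) ^+ d.+1), (s * ek * q1 ^+ d.+1 * expR (- C)); split.
- by rewrite exprn_gt0 ?mulr_gt0.
- have qd : 0 < q1 ^+ d.+1 by exact: exprn_gt0.
  by rewrite mulr_gt0 ?expR_gt0// mulr_gt0// mulr_gt0.
move=> m c m0.
have /choice[r rB] : forall o : option ('I_m + 'I_d), exists r : R,
    [/\ mu (blob (depth m) c o) = r%:E, r <= kappa &
    if o is Some (inl _) then s <= r else t * q1 ^+ m <= r].
  by move=> o; exact: rP.
have bB (o : option ('I_m + 'I_d)) : borel (blob (depth m) c o) by exact: cbox_borel.
pose W := shield m c `\` \bigcup_o blob (m := m) (depth m) c o.
have bW : borel W by apply: borelD; [exact: shield_borel|exact: borel_bigU].
have [w muWE wC] : exists2 w : R, mu W = w%:E & w <= C * m%:R.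
  have W1 : (mu W <= (C * m%:R)%:E)%E by apply: (muW m c) => z [zs _]; exact: zs.
  have W0 : (0 <= mu W)%E by exact: (mu_ge0 kappaE (ltW kappa_gt0)).
  case: (mu W) W0 W1 => [w| |] //; rewrite !lee_fin => w0 w1; by exists w.
have BW (o : option ('I_m + 'I_d)) : blob (depth m) c o `&` W = set0.
  by rewrite -subset0 => z [zo [_ zW]]; apply: zW; exists o.
have [mG PG] := one_point_each poisson bB (blob_disjoint m0 (depth_large m) (c := c)) bW BW
  (fun o => let: And3 e _ _ := rB o in e) muWE.
split; first exact: mG.
have {}PG : P [set omega | good_configuration m c (eta omega)] =
  ((\prod_o (r o * expR (- r o))) * expR (- w))%:E := PG.
rewrite PG lee_fin prod_option big_sumType/=.
have q1m : 0 < t * q1 ^+ m by rewrite mulr_gt0 ?exprn_gt0.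
have fac x (y : R) : 0 < y -> y <= x -> x <= kappa -> y * ek <= x * expR (- x).
  move=> y0 yx xk; rewrite ler_pM ?(ltW y0) ?(ltW ek0)//.
  by rewrite ler_expR lerN2.
pose a := t * q1 ^+ m * ek; pose b := s * ek.
have a0 : 0 < a by rewrite mulr_gt0.
have b0 : 0 < b by rewrite mulr_gt0.
have alg n (x y z e : R) : x ^+ n.+1 * (y * z ^+ n.+1 * e) ^+ m =
    (x * z ^+ m) * (y ^+ m * (x * z ^+ m) ^+ n) * e ^+ m.
  rewrite [(x * _) * (y ^+ m * _)]mulrCA -[(x * z ^+ m) * _]exprS [(x * _) ^+ _]exprMn.
  by rewrite [(_ * e) ^+ m]exprMn [(y * _) ^+ m]exprMn -!exprM (mulnC m); ring.
have -> : (t * ek) ^+ d.+1 * (s * ek * q1 ^+ d.+1 * expR (- C)) ^+ m =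
    a * (b ^+ m * a ^+ d) * expR (- C) ^+ m.
  by rewrite alg /a /b [t * _ * ek]mulrAC.
have f0 : a <= r None * expR (- r None) by have [_ rk rt] := rB None; exact: fac.
have fr i : b <= r (Some (inl i)) * expR (- r (Some (inl i))).
  by have [_ rk rt] := rB (Some (inl i)); exact: fac.
have fw i : a <= r (Some (inr i)) * expR (- r (Some (inr i))).
  by have [_ rk rt] := rB (Some (inr i)); exact: fac.
clearbody a b; move: (ltW a0) (ltW b0) => {}a0 {}b0.
have ad : 0 <= a ^+ d by exact: exprn_ge0.
have bm : 0 <= b ^+ m by exact: exprn_ge0.
apply: ler_pM => //.
- by apply: mulr_ge0 => //; exact: mulr_ge0.
- apply: ler_pM => //; first exact: mulr_ge0.
  apply: ler_pM => //.
    rewrite -[m in X in X <= _]card_ord -prodr_const; apply: ler_prod => i _.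
    by rewrite b0 fr.
  rewrite -[d in X in X <= _]card_ord -prodr_const; apply: ler_prod => i _.
  by rewrite a0 fw.
- by rewrite -expRM_natr ler_expR mulNr lerN2.
Qed.

End GoodConfigurations.

(** * From the Poisson process to the typical cell *)

Lemma integral_rV0 (R : realType) (d : nat) :
  integral_rV (fun _ : 'rV[R]_d => 0%E) = 0%E.
Proof. by elim: d => //= d IH; rewrite integral0_eq. Qed.

Lemma Gamma_ge0 (R : realType) (x : R) : 0 <= Gamma x.
Proof. by apply: Rintegral_ge0 => t _; rewrite mulr_ge0 ?powR_ge0 ?expR_ge0. Qed.

Lemma c_beta'_ge0 (R : realType) d (beta : R) : 0 <= c_beta' d beta.
Proof. by rewrite divr_ge0 ?mulr_ge0 ?powR_ge0 ?Gamma_ge0. Qed.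

Section TypicalCell.
Context {R : realType} {d : nat} {d1 d2 : measure_display}.
Context {Omega : measurableType d1} {Omega' : measurableType d2}.
Context {P : probability Omega R} {P' : probability Omega' R}.
Local Notation point := ('rV[R]_d * R)%type.
Local Notation marked := (point * convex_body R d)%type.
Context {eta : Omega -> set point} {Z : Omega' -> marked}.
Hypothesis typical : typical_cell P eta P' Z.

Definition typical_points (D : set marked) (X : set point) : set point :=
  [set x | [/\ X x, unit_cube x.1 & (translate x.1 @` D) (x, laguerre_cell X x)]].

(** The law of the typical cell has mass 1, and a product with the inverse of 0 or
    of +oo cannot be 1 when the other factor is at most the number inverted. *)
Lemma nonempty_cell_intensity_fin : exists2 Lam : R, 0 < Lam &
  nonempty_cell_intensity P eta = Lam%:E.
Proof.
have [Z1 _ /(_ _ (@centred_space_borel _ _) (fun _ h => h)) ZD] := typical.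
move: ZD; have -> : Z @^-1` (@centred_space R d) = setT.
  by apply/seteqP; split=> // w _; exact: Z1.
rewrite probability_setT; set J := (\int[P]_omega _)%E => JE.
have J0 : (0 <= J)%E by apply: integral_ge0 => w _; exact: counting_ge0.
have JL : (J <= nonempty_cell_intensity P eta)%E.
  apply: ge0_integral_mono => w _; first exact: counting_ge0.
  apply: le_counting => x [wx xc [y _ [_ ye]]]; split=> //.
  by have [[v yv] _ _] := bodyP y.2; exists (v + x.1); rewrite -ye; exists v.
move: JE JL; case: (nonempty_cell_intensity P eta) => [l| |]; last 2 first.
- by rewrite invey mul0e => /eqP; rewrite onee_eq0.
- by move=> _ /(le_trans J0).
move=> JE JL; exists l => //; have l0 : 0 <= l by rewrite -lee_fin (le_trans J0).
rewrite lt_neqAle l0 andbT; apply/eqP => l0'.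
have J00 : J = 0%E by apply/eqP; rewrite eq_le J0 andbT (le_trans JL)// -l0'.
by move: JE; rewrite J00 mule0 => /eqP; rewrite onee_eq0.
Qed.

Lemma typical_cell_facets n : P' [set w | polytopes_with_facets n (Z w).2] =
  ((nonempty_cell_intensity P eta)^-1 * \int[P]_omega counting
    (typical_points (centred_with_facets n) (eta omega)))%E.
Proof.
have [Z1 _ <-] := typical.
- by congr (P' _); apply/seteqP; split=> w; [move=> h; split=> //; exact: Z1|case].
- exact: centred_with_facets_borel.
- by move=> y [].
Qed.

(** A vanishing density would leave no points and hence no cells. *)
Lemma intensity_neq0 gamma beta : poisson_point_process P (mu_beta' gamma beta) eta ->
  gamma * c_beta' d beta != 0.
Proof.
move=> poisson; apply/eqP => k0; have [_ mN law _] := poisson.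
have bT : borel [set: point] by apply: borel_open; exact: openT.
have mu0 : mu_beta' gamma beta [set: point] = 0%:E.
  rewrite -[RHS](@integral_rV0 R d); congr integral_rV; apply/funext => v.
  by rewrite integral0_eq// => h _; rewrite k0 !mul0r.
have [_ /(_ _ mu0 0%N)] := law _ bT.
rewrite expr0 fact0 divr1 mul1r oppr0 expR0 => P1.
have [l l0 lE] := nonempty_cell_intensity_fin.
suff : (nonempty_cell_intensity P eta <= 0)%E by rewrite lE lee_fin leNgt l0.
apply: (@le_trans _ _ (\int[P]_w counting (eta w `&` setT))%E).
  apply: ge0_integral_mono => w _; first exact: counting_ge0.
  by apply: le_counting => x [].
rewrite (@ge0_ae_eq_integral _ _ _ P setT _ (fun=> 0%E))//; first by rewrite integral0.
- exact: mN.
- by move=> w _; exact: counting_ge0.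
exists (~` [set w | counting (eta w `&` setT) = 0%E :> \bar R]); split.
- by apply: measurableC; exact: (hits_measurable poisson 0%E bT).
- have h0 := hits_measurable poisson 0%E bT.
  by transitivity (1 - P [set w | counting (eta w `&` setT) = 0%E :> \bar R])%E;
    [exact: (probability_setC P h0)|rewrite P1 subee].
- by move=> w /= /not_implyP[_].
Qed.

End TypicalCell.

(** The shift by the vector with all coordinates 1/2 plus [depth d' m] e_z puts the
    centre at the middle of the unit cube. *)
Lemma good_configuration_cell (R : realType) (d' m : nat) (X : set ('rV[R]_d'.+2 * R)) :
  (0 < m)%N ->
  good_configuration m (const_mx 2^-1 + depth d' m *: delta_mx 0 ord_max) X ->
  (1 <= counting (typical_points (@centred_with_facets R d'.+2 (m + d'.+2)) X) :> \bar R)%E.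
Proof.
set c := _ + _ => m0 [one none].
have /choice[y yP] := fun o => isolated_point (one o).
have [|||K KE Kf] := @laguerre_cell_facets R d' m (depth d' m) m0 (depth_large d' m) c X y.
- by move=> o; have [] := yP o.
- by move=> o; have [] := yP o.
- move=> z Xz; have [[j _ zj]|no] := pselect ((\bigcup_o blob (m := m) (depth d' m) c o) z).
    by left; exists j; have [_ _] := yP j; exact.
  right=> zs; have : (X `&` (shield m c `\` \bigcup_o blob (m := m) (depth d' m) c o)) z by [].
  by rewrite (counting_eq0 none).
have [Xy yb _] := yP None.
rewrite -(counting_set1 (y None)); apply: le_counting => _ ->; split=> //.
  exact: (centre_in_cube m0 (depth_large d' m) yb).
exists ((0, (y None).2), K); first by split.
rewrite /translate/= KE; congr (_, _); first by case: (y None).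
apply/seteqP; split=> [_ [w wl <-]|w wl] //=.
by exists (w - (y None).1); rewrite ?subrK.
Qed.

Theorem theorem5p7 (R : realType) (d : nat) (gamma beta : R)
    (d1 d2 : measure_display)
    (Omega : measurableType d1) (P : probability Omega R)
    (eta : Omega -> set ('rV[R]_d * R))
    (Omega' : measurableType d2) (P' : probability Omega' R)
    (Z : Omega' -> ('rV[R]_d * R) * convex_body R d) :
  (2 <= d)%N -> 0 < gamma -> d%:R / 2 + 1 < beta ->
  poisson_point_process P (mu_beta' gamma beta) eta ->
  typical_cell P eta P' Z ->
  exists c : R, 0 < c /\
    forall n : nat, (d.+1 <= n)%N ->
      ((c ^+ n)%:E <
        P' [set omega | polytopes_with_facets n (Z omega).2])%E.
Proof.
case: d eta Z => [|[|d']]// eta Z _ gamma0 beta_gt poisson typical.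
have kappa0 : 0 < gamma * c_beta' d'.+2 beta.
  by rewrite lt_neqAle eq_sym (intensity_neq0 typical poisson) mulr_ge0 ?c_beta'_ge0 ?ltW.
have [A [q [A0 q0 good]]] := good_configuration_probability erefl kappa0 beta_gt poisson.
have [l l0 lE] := nonempty_cell_intensity_fin typical.
have Al0 : 0 < A / l by rewrite divr_gt0.
pose b := Num.min (A / l) 1; pose c := Num.min q 1 * (b / 2).
have [b0 b1 bA] : [/\ 0 < b, b <= 1 & b <= A / l].
  by rewrite /b lt_min Al0 ltr01 !ge_min !lexx orbT.
have [q'0 q'1 q'q] : [/\ 0 < Num.min q 1, Num.min q 1 <= 1 & Num.min q 1 <= q].
  by rewrite lt_min q0 ltr01 !ge_min !lexx orbT.
have c0 : 0 < c by rewrite mulr_gt0 ?divr_gt0.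
exists c; split=> // n dn.
have [m m0 ->] : exists2 m, (0 < m)%N & n = (m + d'.+2)%N.
  by exists (n - d'.+2)%N; [rewrite subn_gt0|rewrite subnK// ltnW].
have [mG PG] := good m (const_mx 2^-1 + depth d' m *: delta_mx 0 ord_max) m0.
rewrite (typical_cell_facets typical) lE inver gt_eqF//.
apply: (@lt_le_trans _ _ (l^-1%:E * (A * q ^+ m)%:E)%E); last first.
  rewrite lee_pmul2l ?fin_numE// ?lte_fin ?invr_gt0//.
  apply: le_trans PG _.
  rewrite -[X in P X]setIT -integral_indic//; apply: ge0_integral_mono => w _.
    by rewrite lee_fin.
  rewrite indicE; case wE: (_ \in _); last exact: counting_ge0.
  by exact: (good_configuration_cell m0 (set_mem wE)).
rewrite -EFinM lte_fin mulrA (mulrC _ A).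
have cm : c ^+ m <= q ^+ m * (b / 2).
  rewrite /c exprMn ler_pM ?exprn_ge0 ?(ltW q'0) ?divr_ge0 ?(ltW b0)//.
    by rewrite lerXn2r ?nnegrE ?(ltW q'0) ?(ltW q0).
  case: m m0 {mG PG} => // m _; rewrite exprS ler_piMr ?divr_ge0 ?(ltW b0)//.
  by rewrite exprn_ile1 ?divr_ge0 ?(ltW b0)//; lra.
have cd : c ^+ d'.+2 <= 1.
  by rewrite exprn_ile1 ?(ltW c0)// mulr_ile1 ?(ltW q'0) ?divr_ge0 ?(ltW b0)//; lra.
have qm : 0 < q ^+ m by rewrite exprn_gt0.
(* The factors c ^+ d'.+2 are dropped, and one factor b / 2 out of m is kept. *)
rewrite exprD; apply: (@le_lt_trans _ _ (q ^+ m * (b / 2))).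
  apply: le_trans cm; rewrite ler_piMr ?exprn_ge0 ?(ltW c0)//.
rewrite [ltRHS]mulrC ltr_pM2l//; lra.
Qed.
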